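(* The optimal branching variable problem (OBV) for backtracking is $\Delta^p_2[O(\log n)]$-hard (under polynomial-time many-one reductions). Here OBV is: given a CNF formula $F$ and a variable $x$, decide whether $x$ is the root of some minimum-size backtracking search tree of $F$.
   Context: A CNF formula is a finite set of clauses; the empty clause is unsatisfiable. For a partial assignment $I$ (set of literals), $F|I$ is obtained by deleting clauses containing a literal true under $I$ and deleting false literals from the remaining clauses. $Var(F)$ is the set of variables of $F$. A binary tree is empty $()$ or a triple $(x~T_1~T_2)$ (root label, left and right subtrees); its size is its number of nodes. A backtracking search tree (BST) of $F$ is: $()$ if $F$ contains the empty clause; otherwise $(x~T_1~T_2)$ with $x\in Var(F)$, $T_1$ a BST of $F|\{\neg x\}$, $T_2$ a BST of $F|\{x\}$. (A satisfiable formula has no BST.) $\Delta^p_2[O(\log n)]$ (also written $\Theta^p_2$) is the class of problems solvable in polynomial time with $O(\log n)$ queries to an NP oracle. *)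

(* Defs.v *)
From Stdlib Require Import List Arith NArith.
Import ListNotations.

(* A literal is (variable, polarity): (v, true) is v, (v, false) is ~v. *)
Definition lit := (nat * bool)%type.
Definition clause := list lit.          (* a clause, read as a finite set of literals *)
Definition cnf := list clause.          (* a CNF formula, read as a finite set of clauses *)
Definition assignment := list lit.      (* a partial assignment: set of literals *)

Definition lit_eqb (l1 l2 : lit) : bool :=
  Nat.eqb (fst l1) (fst l2) && Bool.eqb (snd l1) (snd l2).
Definition neg_lit (l : lit) : lit := (fst l, negb (snd l)).

Definition restrict (F : cnf) (I : assignment) : cnf :=
  map (fun C => filter (fun l => negb (existsb (lit_eqb (neg_lit l)) I)) C)
      (filter (fun C => negb (existsb (fun l => existsb (lit_eqb l) I) C)) F).

Definition vars (F : cnf) : list nat := flat_map (map fst) F.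

Inductive tree : Type :=
| Leaf : tree
| Node : nat -> tree -> tree -> tree.

Fixpoint tree_size (t : tree) : nat :=
  match t with
  | Leaf => 0
  | Node _ t1 t2 => S (tree_size t1 + tree_size t2)
  end.

Inductive is_bst : cnf -> tree -> Prop :=
| bst_leaf F : In [] F -> is_bst F Leaf
| bst_node F x T1 T2 :
    ~ In [] F -> In x (vars F) ->
    is_bst (restrict F [(x, false)]) T1 ->
    is_bst (restrict F [(x, true)]) T2 ->
    is_bst F (Node x T1 T2).

Definition OBV (F : cnf) (x : nat) : Prop :=
  exists T1 T2, is_bst F (Node x T1 T2) /\
    forall T, is_bst F T -> tree_size (Node x T1 T2) <= tree_size T.

Fixpoint pos_bits (p : positive) : list bool :=
  match p with
  | xH => [true]
  | xO p => false :: pos_bits p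
  | xI p => true :: pos_bits p
  end.
Definition nat_bits (n : nat) : list bool :=
  match N.of_nat n with N0 => [] | Npos p => pos_bits p end.

Definition tok_digit (b : bool) : list bool := [false; b].
Definition tok_end_lit : list bool := [true; false].
Definition tok_end_clause : list bool := [true; true].

Definition enc_nat (n : nat) : list bool := flat_map tok_digit (nat_bits n).
Definition enc_lit (l : lit) : list bool :=
  tok_digit (snd l) ++ enc_nat (fst l) ++ tok_end_lit.
Definition enc_clause (C : clause) : list bool := flat_map enc_lit C ++ tok_end_clause.
Definition enc_cnf (F : cnf) : list bool := flat_map enc_clause F.
Definition enc_obv (F : cnf) (x : nat) : list bool := enc_nat x ++ tok_end_lit ++ enc_cnf F.

Definition OBV_lang (s : list bool) : Prop :=
  exists F x, s = enc_obv F x /\ OBV F x.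

Definition sym := option bool.   (* None = blank *)
Inductive move := MLeft | MRight | MStay.

Definition q_start := 0.
Definition q_acc := 1.
Definition q_rej := 2.
Definition q_query := 3.
Definition q_yes := 4.
Definition q_no := 5.

Record TM : Type := {
  nst : nat;                                   (* states are 0 .. nst-1 *)
  delta : nat -> sym -> nat * sym * move;
  nst_ge : 6 <= nst;
  delta_ok : forall q a, q < nst -> fst (fst (delta q a)) < nst
}.

(* left part stored nearest-first *)
Record config : Type := mkconf {
  cst : nat; cleft : list sym; ccur : sym; cright : list sym }.

Definition apply_move (m : move) (l : list sym) (a : sym) (r : list sym)
  : list sym * sym * list sym :=
  match m with
  | MStay => (l, a, r)
  | MLeft => match l with [] => ([], a, r) | b :: l' => (l', b, a :: r) end
  | MRight => match r with [] => (a :: l, None, []) | b :: r' => (a :: l, b, r') end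
  end.

Fixpoint take_nonblank (s : list sym) : list bool :=
  match s with
  | Some b :: s' => b :: take_nonblank s'
  | _ => []
  end.

(* the string read from the head position rightwards up to the first blank:
   the oracle query (in state q_query) and the output (in state q_acc) *)
Definition read_from (c : config) : list bool := take_nonblank (ccur c :: cright c).

Definition init (w : list bool) : config :=
  match map Some w with
  | [] => mkconf q_start [] None []
  | a :: r => mkconf q_start [] a r
  end.

Definition delta_step (M : TM) (c : config) : config :=
  let '(q', b, m) := delta M (cst c) (ccur c) in
  let '(l, a, r) := apply_move m (cleft c) b (cright c) in
  mkconf q' l a r.

Inductive step (M : TM) (O : list bool -> Prop) : config -> config -> bool -> Prop :=
| st_delta c : cst c <> q_acc -> cst c <> q_rej -> cst c <> q_query ->
    step M O c (delta_step M c) false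
| st_yes c : cst c = q_query -> O (read_from c) ->
    step M O c (mkconf q_yes (cleft c) (ccur c) (cright c)) true
| st_no c : cst c = q_query -> ~ O (read_from c) ->
    step M O c (mkconf q_no (cleft c) (ccur c) (cright c)) true.

Inductive reaches (M : TM) (O : list bool -> Prop) : nat -> nat -> config -> config -> Prop :=
| reach0 c : reaches M O 0 0 c c
| reachS n k c c' c'' b : step M O c c' b -> reaches M O n k c' c'' ->
    reaches M O (S n) (if b then S k else k) c c''.

Definition decides (M : TM) (O : list bool -> Prop) (L : list bool -> Prop)
  (t qb : nat -> nat) : Prop :=
  forall w, exists n k c, reaches M O n k (init w) c /\
    n <= t (length w) /\ k <= qb (length w) /\
    (cst c = q_acc \/ cst c = q_rej) /\ (cst c = q_acc <-> L w).

Definition poly (a d : nat) (n : nat) : nat := a * n ^ d + a.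
Definition no_oracle : list bool -> Prop := fun _ => False.

Definition in_P (L : list bool -> Prop) : Prop :=
  exists M a d, decides M no_oracle L (poly a d) (poly a d).

Definition pair_enc (w y : list bool) : list bool := flat_map tok_digit w ++ tok_end_clause ++ y.

Definition in_NP (L : list bool -> Prop) : Prop :=
  exists V a d, in_P V /\
    forall w, L w <-> exists y, length y <= poly a d (length w) /\ V (pair_enc w y).

Definition in_Theta2 (L : list bool -> Prop) : Prop :=
  exists M A a d c, in_NP A /\
    decides M A L (poly a d) (fun n => c * Nat.log2 n + c).

Definition fp_computable (f : list bool -> list bool) : Prop :=
  exists M a d, forall w, exists n k c, reaches M no_oracle n k (init w) c /\
    n <= poly a d (length w) /\ cst c = q_acc /\ read_from c = f w.

Definition pm_reduces (L1 L2 : list bool -> Prop) : Prop :=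
  exists f, fp_computable f /\ forall w, L1 w <-> L2 (f w).

Definition Theta2_hard (L : list bool -> Prop) : Prop :=
  forall L', in_Theta2 L' -> pm_reduces L' L.

(* Main.v *)
(** An oracle machine M for a language in Theta2 asks q = O(log n) queries. Guess the answers, and let a
    positive answer be certified by an accepting run of the NP verifier. Give a run the value of its string of
    answers, read as a position in an interval of length T >= 2^q that is halved by each query. A wrong
    certified guess can only be a negative answer to a positive query, hence the correct run is the
    certified run of maximum value v, and w is in the language iff that run accepts.

    Tableaux of Horn clauses, as in the Cook-Levin theorem, give formulas E_k ("some certified run has value
    at least k") and O_k ("some certified run has value more than k, or has value k and does not reject"),
    k < T. They are satisfiable for k <= v and for k < v respectively, and O_v is satisfiable iff w is in
    the language.

    Let H be the pigeonhole formula with K holes on fresh variables, K being larger than the number of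
    variables of the tableaux. Each search tree of H has size at least 2^K - 1, because the least number of
    open holes of an unmatched pigeon decreases by at most one at each branching. If h is the minimum size
    for H, then that of E_k and H together is h if E_k is satisfiable and much smaller otherwise.

    The formula (x or F) and (not x or G) has minimum size one plus the sum of those of F and G. So there are
    a formula P whose minimum size is that of all E_k and H, each taken twice, and a formula Q for all O_k
    and H, each taken twice, and one further H. The surplus of P over Q is about h if w is not in the
    language, and about -h if it is. Put P and Q, on disjoint variables, side by side: the topmost
    selector x of P is the root of a minimum-size tree iff P does not cost more than Q.

    Variables are numbered by 1^i 0 1^j 0 ... 1 in binary, so that the formula can be written by nested loops
    over unary counters. *)
Require Import Defs.
From Stdlib Require Import List Arith NArith ZArith Lia Bool FunctionalExtensionality Classical ClassicalEpsilon.
Import ListNotations.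

(** * Polynomially bounded functions *)

(** The doubling and the extra pigeonhole formula centre the comparison. The sizes of unsatisfiable
    items are only known to be small, so a tie between the satisfiable ones would leave the sign of
    the surplus open. With every item counted twice, [v + 1] satisfiable items stand against [v] or
    [v + 1], a surplus of [2 * h] or 0 up to small errors; the further [h] moves this to [h] or
    [- h], both far from 0. The value of [h] is never computed: the two halves use renamed copies of
    one formula, and only a lower bound for [h] matters.

    Putting a formula next to [H] acts as a minimum, because a search tree of a disjoint union
    contains one of a part. The sum formula needs no disjointness, so all thresholds share the
    variables of one tableau.

    As polynomial time means a concrete Turing machine here, the formulas are given by schemes, from
    which the printing program with its time bound, the clauses and their meaning are all derived.
    The same time bound limits the occurrences of variables, which [K] has to exceed. *)

Definition pbounded (f : nat -> nat) : Prop := exists a d, forall n, f n <= poly a d n.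

(** The [+ 1] covers [n = 0], where [0 ^ 0 = 1] may exceed the other power. *)
Lemma pow_le_add n d e : n ^ d <= n ^ (d + e) + 1.
Proof.
  destruct n as [|n].
  - destruct d; cbn; lia.
  - pose proof (Nat.pow_le_mono_r (S n) d (d + e)). lia.
Qed.

Lemma poly_mono a d n m : n <= m -> poly a d n <= poly a d m.
Proof.
  intros H. unfold poly. pose proof (Nat.pow_le_mono_l n m d H). nia.
Qed.

Lemma pbounded_le f g : (forall n, f n <= g n) -> pbounded g -> pbounded f.
Proof. intros H (a & d & Hg). exists a, d. intros n. specialize (H n). specialize (Hg n). lia. Qed.

Lemma pbounded_poly a d : pbounded (poly a d).
Proof. now exists a, d. Qed.

Lemma pbounded_const c : pbounded (fun _ => c).
Proof. exists c, 0. intros n. unfold poly. lia. Qed.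

Lemma pbounded_id : pbounded (fun n => n).
Proof. exists 1, 1. intros n. unfold poly. rewrite Nat.pow_1_r. lia. Qed.

Lemma pbounded_add f g : pbounded f -> pbounded g -> pbounded (fun n => f n + g n).
Proof.
  intros (a & d & Hf) (b & e & Hg). exists (2 * a + 2 * b), (d + e). intros n.
  specialize (Hf n). specialize (Hg n). unfold poly in *.
  pose proof (pow_le_add n d e). pose proof (pow_le_add n e d). rewrite (Nat.add_comm e d) in *. nia.
Qed.

Lemma pbounded_mul f g : pbounded f -> pbounded g -> pbounded (fun n => f n * g n).
Proof.
  intros (a & d & Hf) (b & e & Hg). exists (4 * (a * b)), (d + e). intros n.
  specialize (Hf n). specialize (Hg n). unfold poly in *.
  pose proof (pow_le_add n d e) as H1. pose proof (pow_le_add n e d) as H2. rewrite (Nat.add_comm e d) in *.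
  pose proof (Nat.mul_le_mono _ _ _ _ Hf Hg) as H. rewrite Nat.pow_add_r in *.
  set (x := n ^ d) in *. set (y := n ^ e) in *.
  assert (E : (a * x + a) * (b * y + b) = (a * b) * (x * y + x + y + 1)) by ring.
  rewrite E in H. eapply Nat.le_trans; [exact H|]. set (c := a * b). nia.
Qed.

Lemma pbounded_pow f d : pbounded f -> pbounded (fun n => f n ^ d).
Proof.
  intros H. induction d as [|d IH]; cbn; [apply pbounded_const|now apply pbounded_mul].
Qed.

Lemma pbounded_comp f g : pbounded f -> pbounded g -> pbounded (fun n => f (g n)).
Proof.
  intros (a & d & Hf) Hg. eapply pbounded_le; [intros n; apply Hf|]. unfold poly.
  apply pbounded_add; [apply pbounded_mul|]; auto using pbounded_const, pbounded_pow.
Qed.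

Ltac pbound :=
  repeat (assumption || match goal with
  | |- pbounded (fun _ => ?c) => apply (pbounded_const c)
  | |- pbounded (fun n => n) => apply pbounded_id
  | |- pbounded (fun n => poly ?a ?d n) => apply (pbounded_poly a d)
  | |- pbounded (fun n => poly ?a ?d (@?g n)) => apply (pbounded_comp (poly a d) g); [apply pbounded_poly|]
  | |- pbounded (fun n => S (@?f n)) => apply (pbounded_add (fun _ => 1) f)
  | |- pbounded (fun n => @?f n + @?g n) => apply (pbounded_add f g)
  | |- pbounded (fun n => @?f n * @?g n) => apply (pbounded_mul f g)
  | |- pbounded (fun n => @?f n ^ ?d) => apply (pbounded_pow f d)
  end).

(** * A stack language and its compilation to Turing machines *)

Definition upd {A} (s : nat -> A) (i : nat) (v : A) : nat -> A :=
  fun j => if j =? i then v else s j.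

Lemma upd_same {A} (s : nat -> A) i v : upd s i v i = v.
Proof. unfold upd. now rewrite Nat.eqb_refl. Qed.

Lemma upd_other {A} (s : nat -> A) i j v : j <> i -> upd s i v j = s j.
Proof. intros H. unfold upd. now rewrite (proj2 (Nat.eqb_neq _ _) H). Qed.

Definition store := nat -> list bool.

Inductive cmd : Type :=
| Skip
| Push (i : nat) (b : bool)
| Seq (c1 c2 : cmd)
| Loop (i : nat) (c1 c0 : cmd).

(** By [ex_weak] the number is only an upper bound for the cost, so every pass of a loop can be
    charged with the worst one. *)
Inductive exec : cmd -> store -> nat -> store -> Prop :=
| ex_skip (s : store) : exec Skip s 1 s
| ex_push i b (s : store) : exec (Push i b) s 1 (upd s i (b :: s i))
| ex_seq c1 c2 s s1 s2 n m : exec c1 s n s1 -> exec c2 s1 m s2 ->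
    exec (Seq c1 c2) s (S (n + m)) s2
| ex_nil i c1 c0 (s : store) : s i = [] -> exec (Loop i c1 c0) s 1 s
| ex_cons i c1 c0 (s : store) (b : bool) l s1 s2 n m : s i = b :: l ->
    exec (if b then c1 else c0) (upd s i l) n s1 ->
    exec (Loop i c1 c0) s1 m s2 ->
    exec (Loop i c1 c0) s (S (n + m)) s2
| ex_weak c s n m s' : exec c s n s' -> n <= m -> exec c s m s'.

Fixpoint below (k : nat) (c : cmd) : Prop :=
  match c with
  | Skip => True
  | Push i _ => i < k
  | Seq c1 c2 => below k c1 /\ below k c2
  | Loop i c1 c0 => i < k /\ below k c1 /\ below k c0
  end.

(* Stack [i] is the [i]-th block of the tape, each block being preceded by a blank. [Sk m] walks right
   over [m] blanks, [Ins] shifts the rest of the tape right by one cell, [Del] shifts it left, [Gr] walks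
   to the end of the tape and [Ret m] walks left over [m] blanks, back to the first cell. *)
Inductive phase : Type :=
| Go | At
| Sk (m : nat)
| Ins (r : nat) (c : sym)
| Ret (m : nat)
| Gr (r : nat)
| Del (r : nat) (c : sym).

(** The list is the continuation still to be executed; together with the phase it forms the control
    state. *)
Definition label := (list cmd * phase)%type.

Definition head_index (ks : list cmd) : nat :=
  match ks with Push i _ :: _ => i | Loop i _ _ :: _ => i | _ => 0 end.

(** The carried symbol [c] is exchanged with the one read, so the rest of the tape moves right in
    one wave. It ends with the head on the blank behind the last block, hence [Ret (S k)] for [k]
    blocks. *)
Definition row_ins (k : nat) (ks : list cmd) (r : nat) (c : sym) (a : sym) : option label * sym * move :=
  match a with
  | Some _ => (Some (ks, Ins r a), c, MRight)
  | None => match r with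
            | S (S r') => (Some (ks, Ins (S r') None), c, MRight)
            | _ => (Some (ks, Ret (S k)), c, MRight)
            end
  end.

(** [k] is the number of stacks and [o] the output stack: with no command left, the head walks to
    block [o] and the machine accepts there, a missing label standing for acceptance. *)
Definition row (k o : nat) (l : label) (a : sym) : option label * sym * move :=
  let '(ks, ph) := l in
  match ph with
  | Go => match ks with
          | [] => (Some ([], Sk (S o)), a, MStay)
          | Skip :: ks' => (Some (ks', Go), a, MStay)
          | Seq c1 c2 :: ks' => (Some (c1 :: c2 :: ks', Go), a, MStay)
          | Push i _ :: _ => (Some (ks, Sk (S i)), a, MStay)
          | Loop i _ _ :: _ => (Some (ks, Sk (S i)), a, MStay)
          end
  | Sk m => match a with
            | Some _ => (Some (ks, Sk m), a, MRight)
            | None => match m with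
                      | S (S m') => (Some (ks, Sk (S m')), None, MRight)
                      | _ => (Some (ks, At), None, MRight)
                      end
            end
  | At => match ks with
          | Push i b :: ks' => row_ins k ks' (k - i) (Some b) a
          | Loop i _ _ :: ks' => match a with
                                 | None => (Some (ks', Ret (S (S i))), None, MStay)
                                 | Some _ => (Some (ks, Gr (k - i)), a, MRight)
                                 end
          | _ => (None, a, MStay)
          end
  | Ins r c => row_ins k ks r c a
  | Ret m => match a with
             | Some _ => (Some (ks, Ret m), a, MLeft)
             | None => match m with
                       | S (S m') => (Some (ks, Ret (S m')), None, MLeft)
                       | _ => (Some (ks, Go), None, MStay)
                       end
             end
  | Gr r => match a with
            | Some _ => (Some (ks, Gr r), a, MRight)
            | None => match r with
                      | S (S r') => (Some (ks, Gr (S r')), None, MRight)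
                      | _ => (Some (ks, Del (k - head_index ks) None), None, MLeft)
                      end
            end
  | Del r c => match a with
               | Some _ => (Some (ks, Del r a), c, MLeft)
               | None => match r with
                         | S (S r') => (Some (ks, Del (S r') None), c, MLeft)
                         | _ => match ks with
                                | Loop i c1 c0 :: _ =>
                                    (Some ((match c with Some true => c1 | _ => c0 end) :: ks, Ret (S i)),
                                     None, MStay)
                                | _ => (None, None, MStay)
                                end
                         end
               end
  end.

Definition zipper := (list sym * list sym)%type.

Definition mv (m : move) (b : sym) (z : zipper) : zipper :=
  let '(L, R) := z in
  match m with
  | MStay => (L, b :: tl R)
  | MRight => (b :: L, tl R)
  | MLeft => match L with [] => ([], b :: tl R) | x :: L' => (L', x :: b :: tl R) end
  end.

Inductive lrun (k o : nat) : nat -> label * zipper -> label * zipper -> Prop :=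
| lr0 c : lrun k o 0 c c
| lrS n l l' b m z c : row k o l (hd None (snd z)) = (Some l', b, m) ->
    lrun k o n (l', mv m b z) c -> lrun k o (S n) (l, z) c.

Lemma lrun_trans k o n m c1 c2 c3 :
  lrun k o n c1 c2 -> lrun k o m c2 c3 -> lrun k o (n + m) c1 c3.
Proof.
  induction 1 as [|n l l' b mm z c Hr H IH]; intros H'; [exact H'|].
  cbn. eapply lrS; eauto.
Qed.

Lemma lrun_step k o l l' b m z : row k o l (hd None (snd z)) = (Some l', b, m) ->
  lrun k o 1 (l, z) (l', mv m b z).
Proof. intros H. eapply lrS; [exact H|apply lr0]. Qed.

Definition blk (s : list bool) : list sym := map Some s.
Definition tape (bs : list (list bool)) : list sym := flat_map (fun s => None :: blk s) bs.

(** The head stands on the last cell before [R], or on [R] itself at the left end of the tape. *)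
Definition lpos (L R : list sym) : zipper :=
  match L with [] => ([], R) | x :: L' => (L', x :: R) end.

Lemma mv_left L b R : mv MLeft b (L, R) = lpos L (b :: tl R).
Proof. destruct L; reflexivity. Qed.

Lemma tl_repeat (j : nat) : tl (repeat (None : sym) j) = repeat None (pred j).
Proof. destruct j; reflexivity. Qed.

Lemma hd_repeat (j : nat) : hd None (repeat (None : sym) j) = None.
Proof. destruct j; reflexivity. Qed.

Arguments tape : simpl never.
Arguments blk : simpl never.

Lemma tape_nil : tape [] = [].
Proof. reflexivity. Qed.

Lemma tape_cons s bs : tape (s :: bs) = None :: blk s ++ tape bs.
Proof. reflexivity. Qed.

Lemma blk_nil : blk [] = [].
Proof. reflexivity. Qed.

Lemma blk_cons b s : blk (b :: s) = Some b :: blk s.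
Proof. reflexivity. Qed.

Lemma length_blk s : length (blk s) = length s.
Proof. apply length_map. Qed.

Lemma tape_app bs1 bs2 : tape (bs1 ++ bs2) = tape bs1 ++ tape bs2.
Proof. unfold tape. apply flat_map_app. Qed.

Ltac tape_simpl := rewrite ?tape_cons, ?tape_nil, ?blk_cons, ?blk_nil; cbn [app length rev];
  rewrite <- ?app_assoc; cbn [app].

Ltac tape_exact H := let X := fresh in pose proof H as X; revert X; do 3 tape_simpl; intros X; exact X.

Lemma sk_word k o ks m s L R :
  lrun k o (length s) ((ks, Sk m), (L, blk s ++ R)) ((ks, Sk m), (rev (blk s) ++ L, R)).
Proof.
  revert L. induction s as [|b s IH]; intros L; [apply lr0|].
  tape_simpl. eapply lrS; [reflexivity|]. cbn [mv tl hd snd app]. apply IH.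
Qed.

Lemma sk_blocks k o ks bs L R : hd None R = None ->
  lrun k o (S (length (tape bs))) ((ks, Sk (S (length bs))), (L, tape bs ++ R))
    ((ks, At), (None :: rev (tape bs) ++ L, tl R)).
Proof.
  intros HR. revert L. induction bs as [|s bs IH]; intros L.
  - tape_simpl. eapply lrS; [cbn; rewrite HR; reflexivity|]. apply lr0.
  - tape_simpl. eapply lrS; [reflexivity|]. cbn [mv tl].
    rewrite length_app, <- Nat.add_succ_r, length_blk.
    eapply lrun_trans; [apply sk_word|]. rewrite rev_app_distr. tape_simpl. apply IH.
Qed.

(** The blanks [repeat None j] lie behind the last block and come from earlier sweeps; their number
    is arbitrary, and later only its existence is recorded. *)
Lemma ins_blocks k o ks bs s c L j :
  lrun k o (S (length (blk s ++ tape bs))) ((ks, Ins (S (length bs)) c), (L, blk s ++ tape bs ++ repeat None j))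
    ((ks, Ret (S k)), (rev (c :: blk s ++ tape bs) ++ L, repeat None (pred j))).
Proof.
  revert s c L. induction bs as [|s' bs IH]; intros s; induction s as [|b s IHs]; intros c L.
  - tape_simpl. eapply lrS; [cbn; rewrite hd_repeat; reflexivity|]. cbn [mv]. rewrite tl_repeat. apply lr0.
  - tape_simpl. eapply lrS; [reflexivity|]. cbn [mv tl hd snd]. tape_exact (IHs (Some b) (c :: L)).
  - tape_simpl. eapply lrS; [reflexivity|]. cbn [mv tl hd snd]. tape_exact (IH s' None (c :: L)).
  - tape_simpl. eapply lrS; [reflexivity|]. cbn [mv tl hd snd]. tape_exact (IHs (Some b) (c :: L)).
Qed.

Lemma ret_word k o ks m s L R :
  lrun k o (length s) ((ks, Ret m), lpos (rev (blk s) ++ L) R) ((ks, Ret m), lpos L (blk s ++ R)).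
Proof.
  revert L R. induction s as [|b s IH] using rev_ind; intros L R; [apply lr0|].
  unfold blk. rewrite map_app, rev_app_distr, length_app, Nat.add_1_r. cbn.
  eapply lrS; [reflexivity|]. rewrite mv_left. cbn [tl hd snd].
  rewrite <- app_assoc. apply IH.
Qed.

Lemma ret_blocks k o ks bs s R :
  lrun k o (length (tape (s :: bs))) ((ks, Ret (S (length bs))), lpos (rev (tape (s :: bs))) R)
    ((ks, Go), ([], tape (s :: bs) ++ R)).
Proof.
  revert R. induction bs as [|s' bs IH] using rev_ind; intros R.
  - tape_simpl. rewrite app_nil_r, length_blk, <- Nat.add_1_r.
    eapply lrun_trans; [apply ret_word|]. eapply lrS; [reflexivity|apply lr0].
  - rewrite app_comm_cons, tape_app, rev_app_distr, !length_app, <- app_assoc.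
    replace (length (tape (s :: bs)) + length (tape [s'])) with (length s' + S (length (tape (s :: bs))))
      by (rewrite tape_cons with (bs := []), tape_nil; cbn; rewrite length_app, length_blk; cbn; lia).
    change (tape [s']) with (None :: blk s' ++ []). rewrite app_nil_r. cbn [rev length].
    rewrite Nat.add_1_r, <- !app_assoc.
    eapply lrun_trans; [apply ret_word|].
    eapply lrS; [reflexivity|]. cbn [app lpos]. rewrite mv_left. cbn [tl hd snd]. apply IH.
Qed.

Lemma gr_blocks k o ks bs s L j :
  lrun k o (S (length (blk s ++ tape bs))) ((ks, Gr (S (length bs))), (L, blk s ++ tape bs ++ repeat None j))
    ((ks, Del (k - head_index ks) None),
      lpos (rev (blk s ++ tape bs) ++ L) (None :: repeat None (pred j))).
Proof.
  revert s L. induction bs as [|s' bs IH]; intros s; induction s as [|b s IHs]; intros L.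
  - tape_simpl. eapply lrS; [cbn; rewrite hd_repeat; reflexivity|]. rewrite mv_left, tl_repeat. apply lr0.
  - tape_simpl. eapply lrS; [reflexivity|]. cbn [mv tl hd snd]. tape_exact (IHs (Some b :: L)).
  - tape_simpl. eapply lrS; [reflexivity|]. cbn [mv tl hd snd]. tape_exact (IH s' (None :: L)).
  - tape_simpl. eapply lrS; [reflexivity|]. cbn [mv tl hd snd]. tape_exact (IHs (Some b :: L)).
Qed.

Lemma del_word k o ks r s L c R :
  lrun k o (length s) ((ks, Del r c), lpos (rev (blk s) ++ L) R)
    ((ks, Del r (hd None (blk s ++ c :: R))), lpos L (tl (blk s ++ c :: R))).
Proof.
  revert L c R. induction s as [|b s IH] using rev_ind; intros L c R; [apply lr0|].
  unfold blk. rewrite map_app, rev_app_distr, length_app, Nat.add_1_r, <- !app_assoc. cbn.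
  eapply lrS; [reflexivity|]. rewrite mv_left. cbn [tl].
  apply (IH L (Some b) (c :: R)).
Qed.

(** When the leftward wave that closes the gap reaches the blank in front of the block, the symbol
    it carries is the popped bit, so the branch is chosen without a second visit. *)
Lemma del_blocks k o ks i c1 c0 bs b s L c R :
  lrun k o (S (length (Some b :: blk s ++ tape bs)))
    ((Loop i c1 c0 :: ks, Del (S (length bs)) c), lpos (rev (Some b :: blk s ++ tape bs) ++ None :: L) R)
    (((if b then c1 else c0) :: Loop i c1 c0 :: ks, Ret (S i)),
     (L, None :: blk s ++ tape bs ++ c :: R)).
Proof.
  revert c R. induction bs as [|s' bs IH] using rev_ind; intros c R.
  - rewrite tape_nil, app_nil_r. change (Some b :: blk s) with (blk (b :: s)).
    rewrite length_blk, <- Nat.add_1_r.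
    eapply lrun_trans; [apply del_word|]. tape_simpl. cbn [hd tl lpos].
    eapply lrS; [reflexivity|]. destruct b; apply lr0.
  - rewrite tape_app, app_assoc, app_comm_cons, rev_app_distr, length_app.
    lazymatch goal with |- lrun _ _ ?n _ _ =>
      replace n with (length s' + S (S (length (Some b :: blk s ++ tape bs)))) end.
    2: (rewrite tape_cons with (bs := []), tape_nil; cbn; rewrite !length_app, !length_blk; cbn; lia).
    replace (length (bs ++ [s'])) with (S (length bs)) by (rewrite length_app; cbn; lia).
    change (tape [s']) with (None :: blk s' ++ []). rewrite app_nil_r. cbn [rev]. rewrite <- !app_assoc.
    eapply lrun_trans; [apply del_word|].
    eapply lrS; [reflexivity|]. cbn [app lpos]. rewrite mv_left. cbn [tl].
    specialize (IH None (blk s' ++ c :: R)).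
    replace (hd None (blk s' ++ c :: R) :: _) with (blk s' ++ c :: R) by (destruct s'; reflexivity).
    tape_exact IH.
Qed.

Definition blocks (k : nat) (s : store) : list (list bool) := map s (seq 0 k).
Definition weight (k : nat) (s : store) : nat := length (tape (blocks k s)).

Lemma blocks_split k i s : i < k ->
  blocks k s = map s (seq 0 i) ++ s i :: map s (seq (S i) (k - S i)).
Proof.
  intros H. unfold blocks. replace k with (i + S (k - S i)) at 1 by lia.
  now rewrite seq_app, map_app.
Qed.

Lemma map_upd_out (s : store) i v a n : i < a \/ a + n <= i ->
  map (upd s i v) (seq a n) = map s (seq a n).
Proof.
  intros H. apply map_ext_in. intros j Hj. apply in_seq in Hj. apply upd_other. lia.
Qed.

Lemma blocks_upd k i s v : i < k ->
  blocks k (upd s i v) = map s (seq 0 i) ++ v :: map s (seq (S i) (k - S i)).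
Proof.
  intros H. rewrite (blocks_split k i _ H), upd_same, !map_upd_out by lia. reflexivity.
Qed.

Lemma weight_upd k i s v : i < k -> weight k (upd s i v) + length (s i) = weight k s + length v.
Proof.
  intros H. unfold weight. rewrite blocks_upd, (blocks_split k i s) by exact H.
  rewrite !tape_app. rewrite ?tape_cons, ?tape_nil. rewrite !length_app. cbn [length].
  rewrite !length_app, !length_blk. lia.
Qed.

Lemma mv_home bs1 s bs2 R :
  mv MStay (hd None (tape (bs1 ++ s :: bs2) ++ R)) ([], tape (bs1 ++ s :: bs2) ++ R) =
  ([], tape bs1 ++ None :: blk s ++ tape bs2 ++ R).
Proof.
  rewrite tape_app, tape_cons, <- !app_assoc. cbn [app]. rewrite <- app_assoc.
  destruct bs1; rewrite ?tape_nil, ?tape_cons; reflexivity.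
Qed.

Lemma at_push k o i b ks n z c :
  lrun k o (S n) ((ks, Ins (k - i) (Some b)), z) c -> lrun k o (S n) ((Push i b :: ks, At), z) c.
Proof. intros H. inversion H; subst. eapply lrS; eassumption. Qed.

Lemma push_run k o i b ks s j : i < k ->
  exists t j', t <= 4 * (weight k s + 2) /\
    lrun k o t ((Push i b :: ks, Go), ([], tape (blocks k s) ++ repeat None j))
      ((ks, Go), ([], tape (blocks k (upd s i (b :: s i))) ++ repeat None j')).
Proof.
  intros H.
  set (bs1 := map s (seq 0 i)). set (bs2 := map s (seq (S i) (k - S i))).
  assert (L1 : length bs1 = i) by (unfold bs1; now rewrite length_map, length_seq).
  assert (L2 : k - i = S (length bs2)) by (unfold bs2; rewrite length_map, length_seq; lia).
  assert (W : weight k s = length (tape bs1) + S (length (blk (s i) ++ tape bs2))).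
  { unfold weight. rewrite (blocks_split k i s H), tape_app, length_app. reflexivity. }
  rewrite (blocks_upd k i s _ H), (blocks_split k i s H). fold bs1 bs2. clearbody bs1 bs2.
  assert (LK : k = length (bs1 ++ (b :: s i) :: bs2)) by (rewrite length_app; cbn; lia).
  exists (1 + (S (length (tape bs1)) + (S (length (blk (s i) ++ tape bs2)) +
       (1 + length (tape (bs1 ++ (b :: s i) :: bs2)))))).
  eexists (S (pred (pred j))). split.
  { rewrite tape_app, tape_cons, blk_cons, W. do 2 (rewrite ?length_app; cbn [length app]). lia. }
  eapply lrun_trans; [apply lrun_step; reflexivity|].
  cbn [snd]. rewrite mv_home.
  eapply lrun_trans.
  { pose proof (sk_blocks k o (Push i b :: ks) bs1 [] (None :: blk (s i) ++ tape bs2 ++ repeat None j) eq_refl) as X.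
    rewrite L1 in X. exact X. }
  cbn [tl]. eapply lrun_trans.
  { pose proof (ins_blocks k o ks bs2 (s i) (Some b) (None :: rev (tape bs1) ++ []) j) as X.
    rewrite <- L2 in X. apply at_push, X. }
  rewrite app_nil_r.
  lazymatch goal with |- lrun _ _ _ (_, (?l, _)) _ =>
    replace l with (rev (tape (bs1 ++ (b :: s i) :: bs2))) end.
  2:{ rewrite tape_app, rev_app_distr. tape_simpl. reflexivity. }
  assert (NE : exists s0 bs0, bs1 ++ (b :: s i) :: bs2 = s0 :: bs0)
    by (destruct bs1; cbn; eauto).
  destruct NE as (s0 & bs0 & NE). rewrite NE in *. cbn [length] in LK.
  eapply lrS.
  { cbn [snd]. rewrite hd_repeat. cbn. rewrite LK. reflexivity. }
  rewrite mv_left, tl_repeat.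
  pose proof (ret_blocks k o ks bs0 s0 (None :: repeat None (pred (pred j)))) as X.
  rewrite <- LK in X. exact X.
Qed.

Lemma loop_nil_run k o i c1 c0 ks s j : i < k -> s i = [] ->
  exists t j', t <= 4 * (weight k s + 2) /\
    lrun k o t ((Loop i c1 c0 :: ks, Go), ([], tape (blocks k s) ++ repeat None j))
      ((ks, Go), ([], tape (blocks k s) ++ repeat None j')).
Proof.
  intros H Hs.
  set (bs1 := map s (seq 0 i)). set (bs2 := map s (seq (S i) (k - S i))).
  assert (L1 : length bs1 = i) by (unfold bs1; now rewrite length_map, length_seq).
  assert (W : weight k s = length (tape bs1) + S (length (tape bs2))).
  { unfold weight. rewrite (blocks_split k i s H), tape_app, length_app, Hs. reflexivity. }
  rewrite (blocks_split k i s H), Hs. fold bs1 bs2. clearbody bs1 bs2.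
  exists (1 + (S (length (tape bs1)) + (1 + (1 + length (tape (bs1 ++ [[]])))))).
  (* If no block follows, the test for emptiness reads the first trailing blank and makes it
     explicit. *)
  eexists (if bs2 then S (pred j) else j). split.
  { rewrite tape_app, length_app. change (length (tape [[]])) with 1. lia. }
  eapply lrun_trans; [apply lrun_step; reflexivity|].
  cbn [snd]. rewrite mv_home, blk_nil. cbn [app].
  eapply lrun_trans.
  { pose proof (sk_blocks k o (Loop i c1 c0 :: ks) bs1 [] (None :: tape bs2 ++ repeat None j) eq_refl) as X.
    rewrite L1 in X. exact X. }
  cbn [tl]. rewrite app_nil_r.
  assert (HN : hd None (tape bs2 ++ repeat None j) = None)
    by (destruct bs2; [apply hd_repeat|reflexivity]).
  eapply lrS; [cbn [snd]; rewrite HN; reflexivity|]. cbn [mv].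
  eapply lrS; [reflexivity|]. rewrite mv_left. cbn [tl].
  lazymatch goal with |- lrun _ _ _ (_, lpos ?l _) _ =>
    replace l with (rev (tape (bs1 ++ [[]]))) by (rewrite tape_app, rev_app_distr; reflexivity) end.
  assert (NE : exists s0 bs0, bs1 ++ [[]] = s0 :: bs0 /\ length bs0 = i)
    by (destruct bs1; cbn in *; [exists [], []|eexists _, _; split; [reflexivity|rewrite length_app; cbn; lia]]; auto).
  destruct NE as (s0 & bs0 & NE & LE).
  lazymatch goal with |- lrun _ _ _ _ (_, (_, ?l)) =>
    replace l with (tape (bs1 ++ [[]]) ++ None :: tl (tape bs2 ++ repeat None j)) end.
  2:{ rewrite !tape_app, <- !app_assoc, tape_cons. f_equal. cbn [app]. f_equal.
      destruct bs2; [rewrite tape_nil; cbn [app]; now rewrite tl_repeat|reflexivity]. }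
  rewrite NE. rewrite <- LE. apply ret_blocks.
Qed.

Lemma loop_cons_run k o i c1 c0 ks s b l j : i < k -> s i = b :: l ->
  exists t j', t <= 8 * (weight k s + 2) /\
    lrun k o t ((Loop i c1 c0 :: ks, Go), ([], tape (blocks k s) ++ repeat None j))
      (((if b then c1 else c0) :: Loop i c1 c0 :: ks, Go), ([], tape (blocks k (upd s i l)) ++ repeat None j')).
Proof.
  intros H Hs.
  set (bs1 := map s (seq 0 i)). set (bs2 := map s (seq (S i) (k - S i))).
  assert (L1 : length bs1 = i) by (unfold bs1; now rewrite length_map, length_seq).
  assert (L2 : k - i = S (length bs2)) by (unfold bs2; rewrite length_map, length_seq; lia).
  assert (W : weight k s = length (tape bs1) + S (length (blk (s i) ++ tape bs2))).
  { unfold weight. rewrite (blocks_split k i s H), tape_app, length_app. reflexivity. }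
  rewrite (blocks_upd k i s _ H), (blocks_split k i s H), Hs in *. fold bs1 bs2. clearbody bs1 bs2.
  exists (1 + (S (length (tape bs1)) + (1 + (S (length (blk l ++ tape bs2)) +
       (S (length (Some b :: blk l ++ tape bs2)) + length (tape (bs1 ++ [[]]))))))).
  eexists (S (S (pred j))). split.
  { rewrite tape_app, W, blk_cons. do 2 (rewrite ?length_app; cbn [length app]).
    change (length (tape [[]])) with 1. lia. }
  eapply lrun_trans; [apply lrun_step; reflexivity|].
  cbn [snd]. rewrite mv_home, blk_cons. cbn [app].
  eapply lrun_trans.
  { pose proof (sk_blocks k o (Loop i c1 c0 :: ks) bs1 [] (None :: Some b :: blk l ++ tape bs2 ++ repeat None j) eq_refl) as X.
    rewrite L1 in X. exact X. }
  cbn [tl]. rewrite app_nil_r.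
  eapply lrS; [reflexivity|]. cbn [mv tl]. rewrite L2.
  eapply lrun_trans; [apply gr_blocks|]. cbn [head_index]. rewrite L2.
  eapply lrun_trans.
  { pose proof (del_blocks k o ks i c1 c0 bs2 b l (rev (tape bs1)) None (None :: repeat None (pred j))) as X.
    cbn [rev] in X. rewrite <- app_assoc in X. cbn [app hd snd] in X |- *. exact X. }
  lazymatch goal with |- lrun _ _ _ (_, (rev _, None :: ?r)) _ =>
    change (rev (tape bs1), None :: r) with (lpos (None :: rev (tape bs1)) r);
    replace (None :: rev (tape bs1)) with (rev (tape (bs1 ++ [[]])))
      by (rewrite tape_app, rev_app_distr; reflexivity) end.
  assert (NE : exists s0 bs0, bs1 ++ [[]] = s0 :: bs0 /\ length bs0 = i)
    by (destruct bs1; cbn in *; [exists [], []|eexists _, _; split; [reflexivity|rewrite length_app; cbn; lia]]; auto).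
  destruct NE as (s0 & bs0 & NE & LE).
  lazymatch goal with |- lrun _ _ _ (_, lpos _ ?r) (_, (_, ?l)) =>
    replace l with (tape (bs1 ++ [[]]) ++ r) end.
  2:{ rewrite !tape_app, <- !app_assoc, tape_cons, tape_nil, tape_cons. cbn [app]. rewrite <- !app_assoc. reflexivity. }
  rewrite NE. rewrite <- LE. apply ret_blocks.
Qed.

Lemma exec_length c s n s' : exec c s n s' -> forall k, below k c -> weight k s' <= weight k s + n.
Proof.
  induction 1 as [s|i b s|c1 c2 s s1 s2 n m H1 IH1 H2 IH2|i c1 c0 s E
    |i c1 c0 s b l s1 s2 n m E H1 IH1 H2 IH2|c s n m s0 H IH Hnm]; intros k Hb; cbn in Hb.
  - lia.
  - pose proof (weight_upd k i s (b :: s i) Hb). cbn in *. lia.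
  - destruct Hb as [Hb1 Hb2]. specialize (IH1 k Hb1). specialize (IH2 k Hb2). lia.
  - lia.
  - destruct Hb as (Hi & Hb1 & Hb0). specialize (IH2 k (conj Hi (conj Hb1 Hb0))).
    specialize (IH1 k). assert (below k (if b then c1 else c0)) by (destruct b; assumption).
    pose proof (weight_upd k i s l Hi). rewrite E in *. cbn in *. specialize (IH1 H). lia.
  - specialize (IH k Hb). lia.
Qed.

(** Each elementary command costs a bounded number of sweeps over a tape whose length never exceeds
    the initial weight plus the cost so far. The price [e] of one unit of cost is quantified inside,
    so that it stays fixed while weight and remaining cost change along the induction. *)
Lemma exec_run k o c s n s' : exec c s n s' -> below k c ->
  forall ks j e, 8 * (weight k s + n + 2) <= e -> exists t j', t <= n * e /\
    lrun k o t ((c :: ks, Go), ([], tape (blocks k s) ++ repeat None j))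
      ((ks, Go), ([], tape (blocks k s') ++ repeat None j')).
Proof.
  intros H. induction H as [s|i b s|c1 c2 s s1 s2 n m H1 IH1 H2 IH2|i c1 c0 s E
    |i c1 c0 s b l s1 s2 n m E H1 IH1 H2 IH2|c s n m s0 H IH Hnm]; intros Hb ks j e He; cbn in Hb.
  (* Staying on an empty tape writes one explicit blank, which concerns only [k = 0] and [j = 0]. *)
  - exists 1, (match k, j with 0, 0 => 1 | _, _ => j end). split; [lia|]. eapply lrS; [reflexivity|].
    cbn [mv]. lazymatch goal with |- lrun _ _ _ (_, (_, ?l)) (_, (_, ?l')) => replace l with l' end;
      [apply lr0|].
    destruct k; [destruct j; reflexivity|]. cbn [blocks seq map]. rewrite tape_cons. reflexivity.
  - destruct (push_run k o i b ks s j Hb) as (t & j' & Ht & Hr). exists t, j'. split; [lia|exact Hr].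
  - destruct Hb as [Hb1 Hb2].
    pose proof (exec_length _ _ _ _ H1 k Hb1).
    assert (EJ : exists j1, mv MStay (hd None (tape (blocks k s) ++ repeat None j)) ([], tape (blocks k s) ++ repeat None j)
       = ([], tape (blocks k s) ++ repeat None j1)).
    { exists (match k, j with 0, 0 => 1 | _, _ => j end). cbn [mv]. f_equal.
      destruct k; [destruct j; reflexivity|]. cbn [blocks seq map]. rewrite tape_cons. reflexivity. }
    destruct EJ as [j1 EJ].
    destruct (IH1 Hb1 (c2 :: ks) j1 e) as (t1 & j2 & Ht1 & Hr1); [lia|].
    destruct (IH2 Hb2 ks j2 e) as (t2 & j3 & Ht2 & Hr2); [lia|].
    exists (S (t1 + t2)), j3. split; [nia|]. eapply lrS; [reflexivity|]. cbn [snd]. rewrite EJ.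
    eapply lrun_trans; eassumption.
  - destruct Hb as (Hi & Hb1 & Hb0). destruct (loop_nil_run k o i c1 c0 ks s j Hi E) as (t & j' & Ht & Hr).
    exists t, j'. split; [lia|exact Hr].
  - pose proof Hb as (Hi & Hb1 & Hb0).
    assert (Hbb : below k (if b then c1 else c0)) by (destruct b; assumption).
    pose proof (weight_upd k i s l Hi) as Hw. rewrite E in Hw. cbn in Hw.
    pose proof (exec_length _ _ _ _ H1 k Hbb).
    destruct (loop_cons_run k o i c1 c0 ks s b l j Hi E) as (t0 & j0 & Ht0 & Hr0).
    destruct (IH1 Hbb (Loop i c1 c0 :: ks) j0 e) as (t1 & j1 & Ht1 & Hr1); [lia|].
    destruct (IH2 Hb ks j1 e) as (t2 & j2 & Ht2 & Hr2); [lia|].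
    exists (t0 + (t1 + t2)), j2. split; [nia|].
    eapply lrun_trans; [exact Hr0|]. eapply lrun_trans; eassumption.
  - destruct (IH Hb ks j e) as (t & j' & Ht & Hr); [lia|]. exists t, j'. split; [nia|exact Hr].
Qed.

(** * Layout of the input on the tape *)

Lemma ins_word k o ks r s L c R :
  lrun k o (length s) ((ks, Ins r c), (L, blk s ++ R))
    ((ks, Ins r (hd None (rev (blk s) ++ c :: L))), (tl (rev (blk s) ++ c :: L), R)).
Proof.
  revert c L. induction s as [|b s IH]; intros c L; [apply lr0|].
  tape_simpl. eapply lrS; [reflexivity|]. cbn [mv tl snd hd]. apply IH.
Qed.

Lemma ins_end k o ks r c L :
  lrun k o (S r) ((ks, Ins (S r) c), (L, [])) ((ks, Ret (S k)), (repeat None r ++ c :: L, [])).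
Proof.
  revert c L. induction r as [|r IH]; intros c L.
  - eapply lrS; [reflexivity|]. apply lr0.
  - eapply lrS; [reflexivity|]. specialize (IH None (c :: L)).
    replace (repeat None (S r) ++ c :: L) with (repeat (None : sym) r ++ None :: c :: L); [exact IH|].
    change (None :: c :: L) with ([None] ++ c :: L). rewrite app_assoc, <- repeat_cons. reflexivity.
Qed.

Definition input_store (w : list bool) : store := upd (fun _ => []) 0 w.

Lemma map_nil_seq (n : nat) : forall a, map (fun _ => []) (seq a n) = repeat ([] : list bool) n.
Proof. induction n as [|n IH]; intros a; cbn; [reflexivity|]. now rewrite IH. Qed.

Lemma blocks_input k w : blocks (S k) (input_store w) = w :: repeat [] k.
Proof.
  unfold blocks, input_store. cbn [seq map]. rewrite upd_same, map_upd_out by lia.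
  now rewrite map_nil_seq.
Qed.

Lemma tape_repeat_nil k : tape (repeat [] k) = repeat None k.
Proof. induction k as [|k IH]; cbn [repeat]; [reflexivity|]. rewrite tape_cons, IH. reflexivity. Qed.

Lemma rev_repeat {A} (a : A) n : rev (repeat a n) = repeat a n.
Proof.
  induction n as [|n IH]; [reflexivity|]. cbn [repeat rev]. rewrite IH. symmetry.
  change (a :: repeat a n) with (repeat a (S n)). rewrite <- repeat_cons. reflexivity.
Qed.

(** Inserting a blank in front of the input with counter [S k] builds the whole layout at once: the
    leading blank, the shifted input, and one further blank for each of the [k] empty blocks. *)
Lemma init_run k o c w :
  lrun (S k) o (2 * weight (S k) (input_store w) + 1) (([c], Ins (S k) None), ([], blk w))
    (([c], Go), ([], tape (blocks (S k) (input_store w)) ++ [None])).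
Proof.
  unfold weight. rewrite blocks_input. set (W := length (tape (w :: repeat [] k))).
  assert (EW : W = S (length w + k)).
  { unfold W. rewrite tape_cons, tape_repeat_nil. cbn. now rewrite length_app, length_blk, repeat_length. }
  replace (2 * W + 1) with (length w + (S k + S W)) by lia.
  eapply lrun_trans.
  { pose proof (ins_word (S k) o [c] (S k) w [] None []) as X. rewrite app_nil_r in X. exact X. }
  eapply lrun_trans; [apply ins_end|].
  lazymatch goal with |- lrun _ _ _ (_, (repeat None k ++ ?l, _)) _ =>
    replace l with (rev (blk w) ++ [None]) by (destruct (rev (blk w)); reflexivity) end.
  eapply lrS; [reflexivity|]. rewrite mv_left. cbn [tl snd hd].
  lazymatch goal with |- lrun _ _ _ (_, lpos ?l _) _ =>
    replace l with (rev (tape (w :: repeat [] k))) end.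
  2:{ rewrite tape_cons, tape_repeat_nil. cbn [rev]. now rewrite rev_app_distr, rev_repeat, <- app_assoc. }
  pose proof (ret_blocks (S k) o [c] (repeat [] k) w [None]) as X.
  rewrite repeat_length in X. exact X.
Qed.

(** * Finiteness of the control *)

Definition cmd_eq_dec (c1 c2 : cmd) : {c1 = c2} + {c1 <> c2}.
Proof. decide equality; auto using Nat.eq_dec, bool_dec. Defined.

Definition label_eq_dec (l1 l2 : label) : {l1 = l2} + {l1 <> l2}.
Proof.
  assert (Hs : forall a b : sym, {a = b} + {a <> b}) by (decide equality; apply bool_dec).
  decide equality; [decide equality; apply Nat.eq_dec|apply (list_eq_dec cmd_eq_dec)].
Defined.

(** These are the continuations that arise while [c] is executed in front of [ks]. A loop puts
    itself behind its body, so no new lists appear after one pass and the set of states is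
    finite. *)
Fixpoint conts (c : cmd) (ks : list cmd) : list (list cmd) :=
  (c :: ks) :: match c with
               | Seq c1 c2 => conts c1 (c2 :: ks) ++ conts c2 ks
               | Loop _ c1 c0 => conts c1 (c :: ks) ++ conts c0 (c :: ks)
               | _ => []
               end.

Definition succ_in (P : list cmd -> Prop) (e : list cmd) : Prop :=
  match e with
  | [] => True
  | c :: ks => P ks /\ match c with
                       | Seq c1 c2 => P (c1 :: c2 :: ks)
                       | Loop _ c1 c0 => P (c1 :: e) /\ P (c0 :: e)
                       | _ => True
                       end
  end.

Lemma conts_head c ks : In (c :: ks) (conts c ks).
Proof. destruct c; now left. Qed.

Lemma conts_closed (P : list cmd -> Prop) c : forall ks, P ks -> (forall e, In e (conts c ks) -> P e) ->
  forall e, In e (conts c ks) -> succ_in P e.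
Proof.
  induction c as [|i b|c1 IH1 c2 IH2|i c1 IH1 c0 IH0]; intros ks Hks H e He; cbn in He.
  - destruct He as [<-|[]]. now cbn.
  - destruct He as [<-|[]]. now cbn.
  - assert (Ha : forall e, In e (conts c1 (c2 :: ks)) -> P e)
      by (intros; apply H; right; apply in_or_app; now left).
    assert (Hb : forall e, In e (conts c2 ks) -> P e)
      by (intros; apply H; right; apply in_or_app; now right).
    destruct He as [<-|He]; [split; [exact Hks|apply Ha, conts_head]|].
    apply in_app_or in He as [He|He].
    + eapply IH1; [apply Hb, conts_head|exact Ha|exact He].
    + eapply IH2; [exact Hks|exact Hb|exact He].
  - set (c := Loop i c1 c0) in *.
    assert (Ha : forall e, In e (conts c1 (c :: ks)) -> P e)
      by (intros; apply H; right; apply in_or_app; now left).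
    assert (Hb : forall e, In e (conts c0 (c :: ks)) -> P e)
      by (intros; apply H; right; apply in_or_app; now right).
    assert (Hc : P (c :: ks)) by (apply H; now left).
    destruct He as [<-|He]; [split; [exact Hks|split; [apply Ha, conts_head|apply Hb, conts_head]]|].
    apply in_app_or in He as [He|He].
    + eapply IH1; [exact Hc|exact Ha|exact He].
    + eapply IH0; [exact Hc|exact Hb|exact He].
Qed.

Lemma conts_below k c : forall ks, below k c -> Forall (below k) ks ->
  forall e, In e (conts c ks) -> Forall (below k) e.
Proof.
  induction c as [|i b|c1 IH1 c2 IH2|i c1 IH1 c0 IH0]; intros ks Hc Hks e He; cbn in He.
  - destruct He as [<-|[]]; auto.
  - destruct He as [<-|[]]; auto.
  - destruct He as [<-|He]; [auto|]. destruct Hc as [H1 H2].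
    apply in_app_or in He as [He|He]; [eapply IH1|eapply IH2]; [| |exact He| | |exact He]; auto.
  - destruct He as [<-|He]; [auto|]. pose proof Hc as (Hi & H1 & H0).
    apply in_app_or in He as [He|He]; [eapply IH1|eapply IH0]; [| |exact He| | |exact He]; auto.
Qed.

Definition all_conts (c : cmd) : list (list cmd) := [] :: conts c [].

Lemma all_conts_succ c e : In e (all_conts c) -> succ_in (fun e => In e (all_conts c)) e.
Proof.
  intros [<-|He]; [exact I|].
  apply (conts_closed (fun e => In e (all_conts c)) c []); [now left|intros; now right|exact He].
Qed.

Definition phase_ok (k : nat) (p : phase) : Prop :=
  match p with Go | At => True | Sk m | Ins m _ | Ret m | Gr m | Del m _ => m < k + 3 end.

Definition phases (k : nat) : list phase :=
  [Go; At] ++ flat_map (fun m => [Sk m; Ret m; Gr m; Ins m None; Ins m (Some true); Ins m (Some false);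
                                  Del m None; Del m (Some true); Del m (Some false)]) (seq 0 (k + 3)).

Lemma in_phases k p : phase_ok k p -> In p (phases k).
Proof.
  assert (H : forall m, m < k + 3 -> In m (seq 0 (k + 3))) by (intros; apply in_seq; lia).
  destruct p as [| |m|m c|m|m|m c]; cbn; auto; intros Hm; right; right; apply in_flat_map; exists m;
    (split; [now apply H|]); cbn; auto 10; destruct c as [[]|]; auto 12.
Qed.

Definition labels (k : nat) (c : cmd) : list label := list_prod (all_conts c) (phases k).

Lemma row_closed k o c ks p a ks' p' b m : below k c -> o < k ->
  In ks (all_conts c) -> phase_ok k p -> row k o (ks, p) a = (Some (ks', p'), b, m) ->
  In ks' (all_conts c) /\ phase_ok k p'.
Proof.
  intros Hc Ho Hks Hp Hr.
  assert (Hb : Forall (below k) ks).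
  { destruct Hks as [<-|Hks]; [constructor|]. eapply conts_below; eauto. }
  pose proof (all_conts_succ c ks Hks) as Hs.
  destruct p as [| |n|n x|n|n|n x]; cbn in Hr, Hp.
  - destruct ks as [|[|i y|c1 c2|i c1 c0] ks1]; cbn in Hs; inversion Hr; subst; split; cbn; try tauto; try lia;
      inversion Hb; subst; cbn in *; lia.
  - destruct ks as [|[|i y|c1 c2|i c1 c0] ks1]; try discriminate; inversion Hb; subst; cbn in *.
    + unfold row_ins in Hr. destruct a; [inversion Hr; subst; cbn; split; [tauto|lia]|].
      destruct (k - i) as [|[|r]] eqn:E; inversion Hr; subst; cbn; (split; [tauto|lia]).
    + destruct a; inversion Hr; subst; cbn; (split; [tauto|lia]).
  - destruct a; [inversion Hr; subst; auto|].
    destruct n as [|[|n]]; inversion Hr; subst; cbn; (split; [auto|lia]).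
  - unfold row_ins in Hr. destruct a; [inversion Hr; subst; auto|].
    destruct n as [|[|n]]; inversion Hr; subst; cbn; (split; [auto|lia]).
  - destruct a; [inversion Hr; subst; auto|].
    destruct n as [|[|n]]; inversion Hr; subst; cbn; (split; [auto|lia]).
  - destruct a; [inversion Hr; subst; auto|].
    destruct n as [|[|n]]; inversion Hr; subst; cbn; (split; [auto|lia]).
  - destruct a; [inversion Hr; subst; auto|].
    destruct n as [|[|n]]; [destruct ks as [|[|i y|c1 c2|i c1 c0] ks1]; try discriminate..|].
    1,2: inversion Hr; subst; inversion Hb; subst; cbn in *; destruct x as [[]|]; (split; [tauto|lia]).
    inversion Hr; subst; cbn; (split; [auto|lia]).
Qed.

Fixpoint index (l : label) (ls : list label) : nat :=
  match ls with
  | [] => 0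
  | x :: ls' => if label_eq_dec x l then 0 else S (index l ls')
  end.

Lemma index_le l ls : index l ls <= length ls.
Proof. induction ls as [|x ls IH]; cbn; [lia|]. destruct (label_eq_dec x l); lia. Qed.

Lemma index_nth l ls : In l ls -> nth_error ls (index l ls) = Some l.
Proof.
  induction ls as [|x ls IH]; intros H; [destruct H|]. cbn.
  destruct (label_eq_dec x l) as [->|Hn]; [reflexivity|]. cbn. apply IH. destruct H; [contradiction|assumption].
Qed.

(** The offset keeps all labels apart from the six reserved states, so no label is a query state. *)
Definition state_of (k : nat) (c : cmd) (l : label) : nat := 6 + index l (labels k c).

Definition cmd_delta (k o : nat) (c : cmd) (q : nat) (a : sym) : nat * sym * move :=
  if q =? 0 then (state_of k c ([c], Ins k None), a, MStay)
  else match nth_error (labels k c) (q - 6) with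
       | Some l => let '(t, b, m) := row k o l a in
                   (match t with Some l' => state_of k c l' | None => q_acc end, b, m)
       | None => (0, a, MStay)
       end.

Definition cmd_TM (k o : nat) (c : cmd) : TM.
Proof.
  refine {| nst := 7 + length (labels k c); delta := cmd_delta k o c |}; [lia|].
  intros q a _. unfold cmd_delta.
  assert (H : forall l, state_of k c l < 7 + length (labels k c))
    by (intros l; unfold state_of; pose proof (index_le l (labels k c)); lia).
  destruct (q =? 0); [apply H|]. destruct (nth_error _ _) as [l|]; [|cbn; lia].
  destruct (row k o l a) as [[[l'|] b] m]; cbn; [apply H|unfold q_acc; lia].
Defined.

Lemma cmd_delta_state k o c l a : In (fst l) (all_conts c) -> phase_ok k (snd l) ->
  delta (cmd_TM k o c) (state_of k c l) a =
  let '(t, b, m) := row k o l a in (match t with Some l' => state_of k c l' | None => q_acc end, b, m).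
Proof.
  intros H1 H2. cbn [delta cmd_TM]. unfold cmd_delta.
  replace (state_of k c l =? 0) with false by reflexivity.
  replace (state_of k c l - 6) with (index l (labels k c)) by (unfold state_of; lia).
  rewrite index_nth; [reflexivity|]. destruct l. apply in_prod; [exact H1|now apply in_phases].
Qed.

Definition conf (q : nat) (z : zipper) : config := mkconf q (fst z) (hd None (snd z)) (tl (snd z)).

Lemma delta_step_conf M q z q' b m : delta M q (hd None (snd z)) = (q', b, m) ->
  delta_step M (conf q z) = conf q' (mv m b z).
Proof.
  intros H. destruct z as [L R]. unfold delta_step, conf. cbn in *. rewrite H.
  destruct m; cbn; [destruct L; reflexivity|destruct R as [|? [|]]; reflexivity|reflexivity].
Qed.

Lemma reaches_trans M O n k c1 c2 : reaches M O n k c1 c2 -> forall m j c3,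
  reaches M O m j c2 c3 -> reaches M O (n + m) (k + j) c1 c3.
Proof.
  induction 1 as [c|n k c c' c'' b Hs H IH]; intros m j c3 H'; [exact H'|].
  specialize (IH m j c3 H'). cbn.
  destruct b; [change (S k + j) with (if true then S (k + j) else k + j)
              |change (k + j) with (if false then S (k + j) else k + j) at 1]; eapply reachS; eauto.
Qed.

Lemma lrun_reaches k o c : below k c -> o < k -> forall n l z l' z',
  lrun k o n (l, z) (l', z') -> In (fst l) (all_conts c) -> phase_ok k (snd l) ->
  reaches (cmd_TM k o c) no_oracle n 0 (conf (state_of k c l) z) (conf (state_of k c l') z') /\
  In (fst l') (all_conts c) /\ phase_ok k (snd l').
Proof.
  intros Hc Ho n l z l' z' H.
  remember (l, z) as u eqn:Eu. remember (l', z') as v eqn:Ev.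
  revert l z Eu Ev. induction H as [x|n l1 l2 b m z1 x Hr H IH]; intros l z Eu Ev H1 H2.
  - subst. inversion Ev; subst. split; [apply reach0|auto].
  - inversion Eu; subst. destruct l as [ks p], l2 as [ks2 p2]. cbn in H1, H2.
    destruct (row_closed k o c ks p _ ks2 p2 b m Hc Ho H1 H2 Hr) as [H3 H4].
    destruct (IH (ks2, p2) (mv m b z) eq_refl eq_refl H3 H4) as [H5 H6]. split; [|exact H6].
    change 0 with (if false then 1 else 0).
    apply reachS with (conf (state_of k c (ks2, p2)) (mv m b z)); [|exact H5].
    rewrite <- (delta_step_conf (cmd_TM k o c) (state_of k c (ks, p)) z (state_of k c (ks2, p2)) b m).
    + apply st_delta; cbn; unfold state_of, q_acc, q_rej, q_query; cbn; lia.
    + rewrite cmd_delta_state, Hr by assumption. reflexivity.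
Qed.

Lemma take_nonblank_blk s R : hd None R = None -> take_nonblank (blk s ++ R) = s.
Proof.
  intros H. induction s as [|b s IH]; [destruct R as [|[]]; [reflexivity|discriminate|reflexivity]|].
  rewrite blk_cons. cbn. now rewrite IH.
Qed.

Lemma cmd_computable k o c f : below (S k) c -> o <= k ->
  (exists g, pbounded g /\ forall w, exists s', exec c (input_store w) (g (length w)) s' /\ s' o = f w) ->
  fp_computable f.
Proof.
  intros Hc Ho (g & Hg & H).
  assert (HT : pbounded (fun x => 2 + 2 * (S k + x) + 1 + g x * (8 * (S k + x + g x + 2)) + 2 + (S k + x + g x)))
    by pbound.
  destruct HT as (a & d & HT).
  exists (cmd_TM (S k) o c), a, d. intros w. specialize (HT (length w)).
  destruct (H w) as (s' & He & Hs'). set (n := g (length w)) in *.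
  set (s := input_store w) in *.
  assert (Ew : weight (S k) s = S k + length w).
  { unfold weight, s. rewrite blocks_input, tape_cons, tape_repeat_nil. cbn.
    rewrite length_app, length_blk, repeat_length. lia. }
  pose proof (exec_length _ _ _ _ He (S k) Hc) as El.
  destruct (exec_run (S k) o c s n s' He Hc [] 1 _ (le_n _)) as (t & j' & Ht & Hr).
  pose proof (init_run k o c w) as Hi. fold s in Hi.
  set (bs1 := map s' (seq 0 o)). set (bs2 := map s' (seq (S o) (S k - S o))).
  assert (L1 : length bs1 = o) by (unfold bs1; now rewrite length_map, length_seq).
  assert (W : weight (S k) s' = length (tape bs1) + S (length (blk (s' o) ++ tape bs2))).
  { unfold weight. rewrite (blocks_split (S k) o s'), tape_app, length_app by lia. reflexivity. }
  rewrite (blocks_split (S k) o s') in Hr by lia. fold bs1 bs2 in Hr. clearbody bs1 bs2.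
  assert (Hf : lrun (S k) o (1 + S (length (tape bs1)))
      (([], Go), ([], tape (bs1 ++ s' o :: bs2) ++ repeat None j'))
      (([], At), (None :: rev (tape bs1), blk (s' o) ++ tape bs2 ++ repeat None j'))).
  { eapply lrun_trans; [apply lrun_step; reflexivity|]. cbn [snd]. rewrite mv_home.
    pose proof (sk_blocks (S k) o [] bs1 [] (None :: blk (s' o) ++ tape bs2 ++ repeat None j') eq_refl) as X.
    rewrite L1, app_nil_r in X. exact X. }
  pose proof (lrun_trans _ _ _ _ _ _ _ Hi (lrun_trans _ _ _ _ _ _ _ Hr Hf)) as HR.
  destruct (lrun_reaches (S k) o c Hc ltac:(lia) _ _ _ _ _ HR) as (R1 & R2 & R3).
  { right. apply conts_head. }
  { cbn. lia. }
  set (z := (None :: rev (tape bs1), blk (s' o) ++ tape bs2 ++ repeat None j') : zipper) in *.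
  exists (1 + (2 * weight (S k) s + 1 + (t + (1 + S (length (tape bs1)))) + 1)), 0,
    (conf q_acc (mv MStay (hd None (snd z)) z)).
  split; [|split; [rewrite Ew in *; lia|split; [reflexivity|]]].
  - change 0 with (0 + (0 + 0)). eapply reaches_trans.
    { change 0 with (if false then 1 else 0). eapply reachS; [|apply reach0].
      apply st_delta; unfold init; destruct w; discriminate. }
    eapply reaches_trans.
    { replace (delta_step (cmd_TM (S k) o c) (init w)) with
        (conf (state_of (S k) c ([c], Ins (S k) None)) ([], blk w)); [exact R1|].
      symmetry. replace (init w) with (conf 0 ([], blk w)) by (destruct w; reflexivity).
      erewrite delta_step_conf; [|reflexivity]. destruct w; reflexivity. }
    change 0 with (if false then 1 else 0). eapply reachS; [|apply reach0].
    erewrite <- delta_step_conf.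
    { apply st_delta; cbn; unfold state_of, q_acc, q_rej, q_query; cbn; lia. }
    rewrite cmd_delta_state by assumption. reflexivity.
  - rewrite <- Hs'. unfold conf, read_from, z. cbn [mv fst snd ccur cright hd tl].
    replace (take_nonblank (_ :: _)) with (take_nonblank (blk (s' o) ++ tape bs2 ++ repeat None j'))
      by (destruct (blk (s' o) ++ tape bs2 ++ repeat None j'); reflexivity).
    apply take_nonblank_blk. destruct bs2; [apply hd_repeat|reflexivity].
Qed.

(** * Generators of bit strings *)

Definition lin := (list nat * nat)%type.
Definition leval (r : nat -> nat) (l : lin) : nat := list_sum (map r (fst l)) + snd l.

Definition unary (n : nat) : list bool := repeat true n ++ [false].

(** Polynomial time is built in: a loop is bounded by a register or by the input, and a new register
    can only receive a loop index, the input length or a polynomial of another register. *)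
Inductive gen : Type :=
| GEmit (bs : list bool)
| GLin (l : lin)
| GSeq (g1 g2 : gen)
| GFor (x y : nat) (g : gen)
| GInput (x : nat) (g1 g0 : gen)
| GLen (x : nat) (g : gen)
| GPoly (x a d y : nat) (g : gen).

Fixpoint gden (w : list bool) (g : gen) (r : nat -> nat) : list bool :=
  match g with
  | GEmit bs => bs
  | GLin l => flat_map tok_digit (unary (leval r l))
  | GSeq g1 g2 => gden w g1 r ++ gden w g2 r
  | GFor x y g => flat_map (fun v => gden w g (upd r x v)) (seq 0 (r y))
  | GInput x g1 g0 =>
      flat_map (fun v => gden w (if nth v w false then g1 else g0) (upd r x v)) (seq 0 (length w))
  | GLen x g => gden w g (upd r x (length w))
  | GPoly x a d y g => gden w g (upd r x (poly a d (r y)))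
  end.

Notation iA := 0 (only parsing).
Notation iB := 1 (only parsing).
Notation iO := 2 (only parsing).
Notation iF := 3 (only parsing).
Notation iZ := 4 (only parsing).
Definition reg (x : nat) : nat := 5 + 2 * x.
Definition prv (x : nat) : nat := 6 + 2 * x.

(* Register [x] has a private counter [prv x], which controls the loop that runs through [x]. *)
Definition mkst (A B o : list bool) (z : nat) (r p : nat -> nat) : store := fun j =>
  match j with
  | 0 => A | 1 => B | 2 => o | 3 => [] | 4 => repeat true z
  | S (S (S (S (S m)))) => repeat true (if Nat.even m then r (Nat.div2 m) else p (Nat.div2 m))
  end.

Lemma mkst_reg A B o z r p x : mkst A B o z r p (reg x) = repeat true (r x).
Proof.
  unfold reg, mkst. cbn [Nat.add]. replace (Nat.even (2 * x)) with true.
  - now rewrite Nat.div2_double.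
  - symmetry. apply Nat.even_spec. now exists x.
Qed.

Lemma mkst_prv A B o z r p x : mkst A B o z r p (prv x) = repeat true (p x).
Proof.
  unfold prv, mkst. change (6 + 2 * x) with (S (S (S (S (S (S (2 * x))))))). cbn iota.
  replace (Nat.even (S (2 * x))) with false.
  - rewrite Nat.div2_succ_double. reflexivity.
  - symmetry. rewrite Nat.even_succ, <- Nat.negb_even.
    replace (Nat.even (2 * x)) with true; [reflexivity|]. symmetry. apply Nat.even_spec. now exists x.
Qed.

Lemma store_ext (s t : store) : s 0 = t 0 -> s 1 = t 1 -> s 2 = t 2 -> s 3 = t 3 -> s 4 = t 4 ->
  (forall x, s (reg x) = t (reg x)) -> (forall x, s (prv x) = t (prv x)) -> s = t.
Proof.
  intros H0 H1 H2 H3 H4 Hr Hp. extensionality j.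
  destruct j as [|[|[|[|[|m]]]]]; try assumption.
  pose proof (Nat.div2_odd m) as E. destruct (Nat.odd m); cbn [Nat.b2n] in E.
  - specialize (Hp (Nat.div2 m)). unfold prv in Hp.
    replace (6 + 2 * Nat.div2 m) with (S (S (S (S (S m))))) in Hp by lia. exact Hp.
  - specialize (Hr (Nat.div2 m)). unfold reg in Hr.
    replace (5 + 2 * Nat.div2 m) with (S (S (S (S (S m))))) in Hr by lia. exact Hr.
Qed.

Ltac upd_cases := unfold upd; repeat (match goal with |- context [?a =? ?b] =>
  destruct (Nat.eqb_spec a b) end); subst; try reflexivity; try congruence; try (unfold reg, prv in *; lia).

Lemma mkst_ext A B o z r p A' B' o' z' r' p' : A = A' -> B = B' -> o = o' -> z = z' ->
  (forall v, r v = r' v) -> (forall v, p v = p' v) -> mkst A B o z r p = mkst A' B' o' z' r' p'.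
Proof.
  intros -> -> -> -> Hr Hp. f_equal; extensionality v; auto.
Qed.

Lemma upd_A A B o z r p v : upd (mkst A B o z r p) iA v = mkst v B o z r p.
Proof. apply store_ext; try reflexivity; intros x; upd_cases. Qed.

Lemma upd_B A B o z r p v : upd (mkst A B o z r p) iB v = mkst A v o z r p.
Proof. apply store_ext; try reflexivity; intros x; upd_cases. Qed.

Lemma upd_O A B o z r p v : upd (mkst A B o z r p) iO v = mkst A B v z r p.
Proof. apply store_ext; try reflexivity; intros x; upd_cases. Qed.

Lemma upd_Z A B o z r p n : upd (mkst A B o z r p) iZ (repeat true n) = mkst A B o n r p.
Proof. apply store_ext; try reflexivity; intros x; upd_cases. Qed.

Lemma upd_reg A B o z r p x n :
  upd (mkst A B o z r p) (reg x) (repeat true n) = mkst A B o z (upd r x n) p.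
Proof.
  apply store_ext; try reflexivity; intros y; rewrite ?mkst_reg, ?mkst_prv.
  - destruct (Nat.eq_dec y x) as [->|H]; [now rewrite !upd_same|].
    rewrite !upd_other, mkst_reg; [reflexivity|exact H|unfold reg; lia].
  - rewrite upd_other, mkst_prv; [reflexivity|unfold reg, prv; lia].
Qed.

Lemma upd_prv A B o z r p x n :
  upd (mkst A B o z r p) (prv x) (repeat true n) = mkst A B o z r (upd p x n).
Proof.
  apply store_ext; try reflexivity; intros y; rewrite ?mkst_reg, ?mkst_prv.
  - rewrite upd_other, mkst_reg; [reflexivity|unfold reg, prv; lia].
  - destruct (Nat.eq_dec y x) as [->|H]; [now rewrite !upd_same|].
    rewrite !upd_other, mkst_prv; [reflexivity|exact H|unfold prv; lia].
Qed.

Lemma push_reg A B o z r p x :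
  exec (Push (reg x) true) (mkst A B o z r p) 1 (mkst A B o z (upd r x (S (r x))) p).
Proof. rewrite <- upd_reg. cbn [repeat]. rewrite <- (mkst_reg A B o z r p x). apply ex_push. Qed.

Lemma push_prv A B o z r p x :
  exec (Push (prv x) true) (mkst A B o z r p) 1 (mkst A B o z r (upd p x (S (p x)))).
Proof. rewrite <- upd_prv. cbn [repeat]. rewrite <- (mkst_prv A B o z r p x). apply ex_push. Qed.

Lemma push_Z A B o z r p : exec (Push iZ true) (mkst A B o z r p) 1 (mkst A B o (S z) r p).
Proof. rewrite <- (upd_Z A B o z r p (S z)). apply ex_push. Qed.

Lemma push_A A B o z r p b : exec (Push iA b) (mkst A B o z r p) 1 (mkst (b :: A) B o z r p).
Proof. rewrite <- (upd_A A B o z r p (b :: A)). apply ex_push. Qed.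

Lemma push_B A B o z r p b : exec (Push iB b) (mkst A B o z r p) 1 (mkst A (b :: B) o z r p).
Proof. rewrite <- (upd_B A B o z r p (b :: B)). apply ex_push. Qed.

Lemma push_O A B o z r p b : exec (Push iO b) (mkst A B o z r p) 1 (mkst A B (b :: o) z r p).
Proof. rewrite <- (upd_O A B o z r p (b :: o)). apply ex_push. Qed.

(** [F j] is the store after [j] passes. Giving the invariant as a family of stores reduces every
    later loop to the check of a single pass. *)
Lemma exec_loop i c1 c0 (F : nat -> store) (l : list bool) N :
  (forall j, j <= length l -> F j i = skipn j l) ->
  (forall j, j < length l ->
     exec (if nth j l false then c1 else c0) (upd (F j) i (skipn (S j) l)) N (F (S j))) ->
  exec (Loop i c1 c0) (F 0) (length l * S N + 1) (F (length l)).
Proof.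
  revert F. induction l as [|b l IH]; intros F HF HS.
  - apply ex_nil. apply (HF 0). lia.
  - cbn [length]. replace (S (length l) * S N + 1) with (S (N + (length l * S N + 1))) by lia.
    eapply ex_cons.
    + apply (HF 0). lia.
    + apply (HS 0). cbn. lia.
    + apply (IH (fun j => F (S j))).
      * intros j Hj. rewrite HF by (cbn; lia). reflexivity.
      * intros j Hj. apply (HS (S j)). cbn. lia.
Qed.

Lemma skipn_repeat {A} (a : A) j n : skipn j (repeat a n) = repeat a (n - j).
Proof.
  revert n. induction j as [|j IH]; intros [|n]; cbn; auto.
Qed.

Lemma nth_repeat_true n j : j < n -> nth j (repeat true n) false = true.
Proof. revert j. induction n as [|n IH]; intros [|j] H; cbn; try lia; auto. apply IH. lia. Qed.

Lemma exec_loop_unary i c1 c0 (F : nat -> store) m N :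
  (forall j, j <= m -> F j i = repeat true (m - j)) ->
  (forall j, j < m -> exec c1 (upd (F j) i (repeat true (m - S j))) N (F (S j))) ->
  exec (Loop i c1 c0) (F 0) (m * S N + 1) (F m).
Proof.
  intros HF HS. pose proof (exec_loop i c1 c0 F (repeat true m) N) as H.
  rewrite repeat_length in H. apply H.
  - intros j Hj. rewrite skipn_repeat. now apply HF.
  - intros j Hj. rewrite nth_repeat_true, skipn_repeat by exact Hj. now apply HS.
Qed.

Lemma exec_eq c s n s' t t' : exec c s n s' -> s = t -> s' = t' -> exec c t n t'.
Proof. now intros H <- <-. Qed.

Ltac mk_eq := first [reflexivity | apply mkst_ext; try reflexivity; try lia; intros ?; upd_cases].

(** * Programs for the generators *)

Definition clear_reg (x : nat) : cmd := Loop (reg x) Skip Skip.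

Lemma clear_reg_exec A B o z r p x :
  exec (clear_reg x) (mkst A B o z r p) (r x * 2 + 1) (mkst A B o z (upd r x 0) p).
Proof.
  eapply exec_eq.
  - apply (exec_loop_unary (reg x) Skip Skip (fun j => mkst A B o z (upd r x (r x - j)) p) (r x) 1).
    + intros j Hj. rewrite mkst_reg, upd_same. reflexivity.
    + intros j Hj. rewrite upd_reg. eapply exec_eq; [apply ex_skip|reflexivity|]. mk_eq.
  - mk_eq.
  - mk_eq.
Qed.

(* The auxiliary stack [iZ] remembers [y], which is put back afterwards. *)
Definition restoring (y : nat) (c : cmd) : cmd :=
  Seq (Loop (reg y) (Seq (Push iZ true) c) Skip) (Loop iZ (Push (reg y) true) Skip).

(** The families [o], [q] and [s] describe what the body does to output, registers and counters; the
    countdown of [y] overrides [q] at [y]. *)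
Lemma restoring_exec y c A B m (o : nat -> list bool) (q s : nat -> nat -> nat) N :
  (forall j z, j < m -> exec c (mkst A B (o j) z (upd (q j) y (m - S j)) (s j)) N
      (mkst A B (o (S j)) z (upd (q (S j)) y (m - S j)) (s (S j)))) ->
  exec (restoring y c) (mkst A B (o 0) 0 (upd (q 0) y m) (s 0)) (m * (N + 5) + 3)
    (mkst A B (o m) 0 (upd (q m) y m) (s m)).
Proof.
  intros Hc.
  assert (H1 : exec (Loop (reg y) (Seq (Push iZ true) c) Skip)
      (mkst A B (o 0) 0 (upd (q 0) y m) (s 0)) (m * S (S (1 + N)) + 1)
      (mkst A B (o m) m (upd (q m) y 0) (s m))).
  { eapply exec_eq.
    - apply (exec_loop_unary (reg y) (Seq (Push iZ true) c) Skip
        (fun j => mkst A B (o j) j (upd (q j) y (m - j)) (s j)) m).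
      + intros j Hj. rewrite mkst_reg, upd_same. reflexivity.
      + intros j Hj. rewrite upd_reg. eapply ex_seq; [apply push_Z|].
        eapply exec_eq; [apply (Hc j (S j) Hj)| |reflexivity]. mk_eq.
    - mk_eq.
    - mk_eq. }
  assert (H2 : exec (Loop iZ (Push (reg y) true) Skip) (mkst A B (o m) m (upd (q m) y 0) (s m)) (m * 2 + 1)
      (mkst A B (o m) 0 (upd (q m) y m) (s m))).
  { eapply exec_eq.
    - apply (exec_loop_unary iZ (Push (reg y) true) Skip
        (fun j => mkst A B (o m) (m - j) (upd (q m) y j) (s m)) m 1).
      + intros j Hj. reflexivity.
      + intros j Hj. rewrite upd_Z. eapply exec_eq; [apply push_reg|reflexivity|]. mk_eq.
    - mk_eq.
    - mk_eq. }
  eapply ex_weak; [eapply ex_seq; eassumption|lia].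
Qed.

Definition emit (bs : list bool) : cmd := fold_right (fun b c => Seq (Push iO b) c) Skip bs.

Lemma emit_exec A B o z r p bs :
  exec (emit bs) (mkst A B o z r p) (2 * length bs + 1) (mkst A B (rev bs ++ o) z r p).
Proof.
  revert o. induction bs as [|b bs IH]; intros o; [apply ex_skip|].
  cbn [emit fold_right]. eapply ex_weak with (n := S (1 + (2 * length bs + 1))); [|cbn; lia].
  eapply ex_seq; [apply push_O|]. cbn [rev]. rewrite <- app_assoc. apply IH.
Qed.

Fixpoint lin_cmd (xs : list nat) (c : nat) : cmd :=
  match xs with
  | [] => emit (flat_map tok_digit (unary c))
  | x :: xs => Seq (restoring x (emit [false; true])) (lin_cmd xs c)
  end.

Lemma tok_digits_app n m : flat_map tok_digit (unary (n + m)) =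
  flat_map tok_digit (repeat true n) ++ flat_map tok_digit (unary m).
Proof. unfold unary. rewrite repeat_app, <- app_assoc, flat_map_app. reflexivity. Qed.

Lemma length_tok_digits l : length (flat_map tok_digit l) = 2 * length l.
Proof. induction l as [|b l IH]; cbn; [|rewrite IH]; lia. Qed.

Lemma lin_cmd_exec A B o r p xs c N : (forall x, r x <= N) ->
  exec (lin_cmd xs c) (mkst A B o 0 r p) (length xs * (N * 10 + 4) + 4 * c + 5)
    (mkst A B (rev (flat_map tok_digit (unary (list_sum (map r xs) + c))) ++ o) 0 r p).
Proof.
  intros HN. revert o. induction xs as [|x xs IH]; intros o; cbn [lin_cmd].
  - eapply ex_weak; [apply emit_exec|]. rewrite length_tok_digits. unfold unary.
    rewrite length_app, repeat_length. cbn. lia.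
  - cbn [map list_sum fold_right]. fold (list_sum (map r xs)).
    rewrite <- (Nat.add_assoc (r x)), tok_digits_app, rev_app_distr, <- app_assoc.
    eapply ex_weak.
    + eapply ex_seq with (s1 := mkst A B (rev (flat_map tok_digit (repeat true (r x))) ++ o) 0 r p).
      * pose proof (restoring_exec x (emit [false; true]) A B (r x)
          (fun j => rev (flat_map tok_digit (repeat true j)) ++ o) (fun _ => r) (fun _ => p) 5) as H.
        eapply exec_eq; [apply H| |].
        -- intros j z Hj. eapply exec_eq; [apply emit_exec|reflexivity|].
           apply mkst_ext; try reflexivity.
           change (S j) with (1 + j). rewrite Nat.add_comm, repeat_app, flat_map_app, rev_app_distr, <- app_assoc.
           reflexivity.
        -- mk_eq.
        -- mk_eq.
      * apply IH.
    + cbn [length]. specialize (HN x). nia.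
Qed.

Definition mul_cmd (x y : nat) : cmd :=
  Seq (Loop (reg x) (Push (prv x) true) Skip) (Loop (prv x) (restoring y (Push (reg x) true)) Skip).

Lemma move_exec A B o r p x : p x = 0 ->
  exec (Loop (reg x) (Push (prv x) true) Skip) (mkst A B o 0 r p) (r x * 2 + 1)
    (mkst A B o 0 (upd r x 0) (upd p x (r x))).
Proof.
  intros Hp. eapply exec_eq.
  - apply (exec_loop_unary (reg x) (Push (prv x) true) Skip
      (fun j => mkst A B o 0 (upd r x (r x - j)) (upd p x j)) (r x) 1).
    + intros j Hj. now rewrite mkst_reg, upd_same.
    + intros j Hj. rewrite upd_reg. eapply exec_eq; [apply push_prv|reflexivity|]. mk_eq.
  - mk_eq.
  - mk_eq.
Qed.

Lemma mul_exec A B o r p x y : p x = 0 -> x <> y ->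
  exec (mul_cmd x y) (mkst A B o 0 r p) (r x * (r y * 6 + 6) + 3) (mkst A B o 0 (upd r x (r x * r y)) p).
Proof.
  intros Hp Hxy. eapply ex_weak.
  - eapply ex_seq; [apply move_exec, Hp|]. eapply exec_eq.
    + apply (exec_loop_unary (prv x) (restoring y (Push (reg x) true)) Skip
        (fun j => mkst A B o 0 (upd r x (j * r y)) (upd p x (r x - j))) (r x) (r y * 6 + 3)).
      * intros j Hj. now rewrite mkst_prv, upd_same.
      * intros j Hj. rewrite upd_prv. eapply exec_eq.
        -- apply (restoring_exec y (Push (reg x) true) A B (r y) (fun _ => o)
             (fun i => upd r x (i + j * r y)) (fun _ => upd p x (r x - S j)) 1).
           intros i z Hi. eapply exec_eq; [apply push_reg| |]; mk_eq.
        -- mk_eq.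
        -- mk_eq.
    + mk_eq.
    + mk_eq.
  - nia.
Qed.

Fixpoint iter_cmd (n : nat) (c : cmd) : cmd :=
  match n with 0 => Skip | S n => Seq c (iter_cmd n c) end.

(** [V] bounds all intermediate products. It is stated with [S (r y)] because for [r y = 0] the
    final product does not bound the initial value [r x]. *)
Lemma pow_exec A B o p x y d : p x = 0 -> x <> y -> forall r V, r x * (S (r y)) ^ d <= V ->
  exec (iter_cmd d (mul_cmd x y)) (mkst A B o 0 r p) (d * (V * (r y * 6 + 6) + 4) + 1)
    (mkst A B o 0 (upd r x (r x * r y ^ d)) p).
Proof.
  intros Hp Hxy. induction d as [|d IH]; intros r V HV; cbn [iter_cmd].
  - eapply exec_eq; [apply ex_skip|reflexivity|]. cbn. mk_eq.
  - eapply ex_weak.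
    + eapply ex_seq; [now apply mul_exec|]. eapply exec_eq; [apply (IH (upd r x (r x * r y)) V)|reflexivity|].
      * rewrite upd_same, upd_other by congruence. cbn in HV. nia.
      * rewrite upd_same, upd_other by congruence. apply mkst_ext; try reflexivity. intros v. cbn.
        unfold upd. destruct (v =? x); [ring|reflexivity].
    + rewrite upd_other by congruence. cbn in HV.
      assert (r x <= V) by (pose proof (Nat.pow_nonzero (S (r y)) d); nia). nia.
Qed.

Lemma pushes_exec A B o p x a r :
  exec (iter_cmd a (Push (reg x) true)) (mkst A B o 0 r p) (2 * a + 1) (mkst A B o 0 (upd r x (a + r x)) p).
Proof.
  revert r. induction a as [|a IH]; intros r; cbn [iter_cmd].
  - eapply exec_eq; [apply ex_skip|reflexivity|]. mk_eq.
  - eapply ex_weak.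
    + eapply ex_seq; [apply push_reg|]. eapply exec_eq; [apply IH|reflexivity|]. rewrite upd_same. mk_eq.
    + lia.
Qed.

Definition poly_cmd (x a d y : nat) : cmd :=
  Seq (Push (reg x) true) (Seq (iter_cmd d (mul_cmd x y)) (Seq (Loop (reg x) (Push (prv x) true) Skip)
    (Seq (Loop (prv x) (iter_cmd a (Push (reg x) true)) Skip) (iter_cmd a (Push (reg x) true))))).

Lemma poly_exec a d : exists f, pbounded f /\ forall A B o p x y r N, r x = 0 -> p x = 0 -> x <> y -> r y <= N ->
  exec (poly_cmd x a d y) (mkst A B o 0 r p) (f N) (mkst A B o 0 (upd r x (poly a d (r y))) p).
Proof.
  exists (fun N => (d * ((S N) ^ d * (N * 6 + 6) + 4) + 1) + (S N ^ d * (2 * a + 4) + (2 * a + 10))).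
  split; [pbound|]. intros A B o p x y r N Hx Hp Hxy HN.
  assert (Hle : r y ^ d <= S N ^ d) by (apply Nat.pow_le_mono_l; lia).
  assert (Hle' : S (r y) ^ d <= S N ^ d) by (apply Nat.pow_le_mono_l; lia).
  eapply ex_weak.
  - unfold poly_cmd. eapply ex_seq; [apply push_reg|].
    eapply ex_seq; [apply (pow_exec A B o p x y d Hp Hxy _ (S N ^ d))|].
    { rewrite upd_same, upd_other, Hx by congruence. lia. }
    eapply ex_seq; [now apply move_exec|].
    rewrite !upd_same, !(upd_other _ _ y), Hx, Nat.mul_1_l by congruence.
    eapply ex_seq.
    + eapply exec_eq.
      * apply (exec_loop_unary (prv x) (iter_cmd a (Push (reg x) true)) Skip
          (fun j => mkst A B o 0 (upd r x (j * a)) (upd p x (r y ^ d - j))) (r y ^ d) (2 * a + 1)).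
        -- intros j Hj. now rewrite mkst_prv, upd_same.
        -- intros j Hj. rewrite upd_prv. eapply exec_eq; [apply pushes_exec|reflexivity|].
           rewrite upd_same. mk_eq.
      * mk_eq.
      * reflexivity.
    + eapply exec_eq; [apply pushes_exec| |].
      * mk_eq.
      * rewrite upd_same. unfold poly. rewrite (Nat.mul_comm a). mk_eq.
  - rewrite !upd_same, !(upd_other _ _ y), Hx by congruence. rewrite Nat.mul_1_l.
    set (V := S N ^ d) in *. set (v := r y ^ d) in *.
    assert (d * (V * (r y * 6 + 6) + 4) <= d * (V * (N * 6 + 6) + 4)).
    { apply Nat.mul_le_mono_l, Nat.add_le_mono_r, Nat.mul_le_mono_l. lia. }
    assert (v * (2 * a + 4) <= V * (2 * a + 4)) by (apply Nat.mul_le_mono_r; exact Hle).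
    assert (v * S (2 * a + 1) + v * 2 = v * (2 * a + 4)) by ring. lia.
Qed.

Definition restore_input : cmd := Loop iB (Push iA true) (Push iA false).

Fixpoint comp (g : gen) : cmd :=
  match g with
  | GEmit bs => emit bs
  | GLin l => lin_cmd (fst l) (snd l)
  | GSeq g1 g2 => Seq (comp g1) (comp g2)
  | GFor x y g =>
      Seq (restoring y (Push (prv x) true))
        (Seq (Loop (prv x) (Seq (comp g) (Push (reg x) true)) Skip) (clear_reg x))
  | GInput x g1 g0 =>
      Seq (Loop iA (Seq (Push iB true) (Seq (comp g1) (Push (reg x) true)))
                   (Seq (Push iB false) (Seq (comp g0) (Push (reg x) true))))
        (Seq restore_input (clear_reg x))
  | GLen x g =>
      Seq (Loop iA (Seq (Push iB true) (Push (reg x) true)) (Seq (Push iB false) (Push (reg x) true)))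
        (Seq restore_input (Seq (comp g) (clear_reg x)))
  | GPoly x a d y g => Seq (poly_cmd x a d y) (Seq (comp g) (clear_reg x))
  end.

(* [act] lists the registers in use; [top] tells that the input stack is intact, which is not the case
   in the body of [GInput]. *)
Fixpoint gwf (act : list nat) (top : bool) (g : gen) : Prop :=
  match g with
  | GEmit _ | GLin _ => True
  | GSeq g1 g2 => gwf act top g1 /\ gwf act top g2
  | GFor x y g => ~ In x act /\ x <> y /\ gwf (x :: act) top g
  | GInput x g1 g0 => ~ In x act /\ top = true /\ gwf (x :: act) false g1 /\ gwf (x :: act) false g0
  | GLen x g => ~ In x act /\ top = true /\ gwf (x :: act) top g
  | GPoly x _ _ y g => ~ In x act /\ x <> y /\ gwf (x :: act) top g
  end.

Lemma firstn_S_nth {A} (l : list A) j d : j < length l -> firstn (S j) l = firstn j l ++ [nth j l d].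
Proof.
  revert j. induction l as [|b l IH]; intros [|j] Hj; cbn in *; try lia; [reflexivity|].
  f_equal. apply IH. lia.
Qed.

Lemma restore_input_exec o r p w :
  exec restore_input (mkst [] (rev w) o 0 r p) (length w * 2 + 1) (mkst w [] o 0 r p).
Proof.
  rewrite <- length_rev.
  assert (H : forall l A, exec restore_input (mkst A l o 0 r p) (length l * 2 + 1) (mkst (rev l ++ A) [] o 0 r p)).
  { intros l A. eapply exec_eq.
    - apply (exec_loop iB (Push iA true) (Push iA false)
        (fun j => mkst (rev (firstn j l) ++ A) (skipn j l) o 0 r p) l 1).
      + reflexivity.
      + intros j Hj. rewrite upd_B.
        replace (if nth j l false then Push iA true else Push iA false) with (Push iA (nth j l false))
          by (now destruct (nth j l false)).
        eapply exec_eq; [apply push_A|reflexivity|]. apply mkst_ext; try reflexivity.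
        rewrite app_comm_cons. f_equal.
        rewrite (firstn_S_nth l j false Hj), rev_app_distr. reflexivity.
    - reflexivity.
    - rewrite firstn_all, skipn_all. reflexivity. }
  eapply exec_eq; [apply H|reflexivity|]. now rewrite rev_involutive, app_nil_r.
Qed.

Lemma seq_S_map {A} (f : nat -> list A) j :
  flat_map f (seq 0 (S j)) = flat_map f (seq 0 j) ++ f j.
Proof. rewrite seq_S, flat_map_app. cbn. now rewrite app_nil_r. Qed.

(** The time bound depends only on a common bound [N] for registers and input length. For [GPoly]
    the body is run with [N + poly a d N], and polynomial bounds are closed under this
    composition. *)
Lemma comp_exec g : exists f, pbounded f /\ forall act top w A B o r p N,
  gwf act top g -> (top = true -> A = w /\ B = []) ->
  (forall v, ~ In v act -> r v = 0 /\ p v = 0) -> (forall v, r v <= N) -> length w <= N ->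
  exec (comp g) (mkst A B o 0 r p) (f N) (mkst A B (rev (gden w g r) ++ o) 0 r p).
Proof.
  induction g as [bs|l|g1 [f1 [P1 IH1]] g2 [f2 [P2 IH2]]|x y g [f [P IH]]|x g1 [f1 [P1 IH1]] g0 [f0 [P0 IH0]]
    |x g [f [P IH]]|x a d y g [f [P IH]]].
  - exists (fun _ => 2 * length bs + 1). split; [pbound|]. intros. apply emit_exec.
  - exists (fun N => length (fst l) * (N * 10 + 4) + 4 * snd l + 5). split; [pbound|].
    intros. now apply lin_cmd_exec.
  - exists (fun N => S (f1 N + f2 N)). split; [pbound|]. intros act top w A B o r p N [W1 W2] Ht Ha HN Hw.
    cbn. rewrite rev_app_distr, <- app_assoc. eapply ex_seq; [eapply IH1|eapply IH2]; eauto.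
  - exists (fun N => N * (f N + 20) + 20). split; [pbound|]. intros act top w A B o r p N (Wx & Wy & W) Ht Ha HN Hw.
    destruct (Ha x Wx) as [Hrx Hpx]. cbn [comp].
    eapply ex_weak.
    + eapply ex_seq.
      { eapply exec_eq.
        - apply (restoring_exec y (Push (prv x) true) A B (r y) (fun _ => o) (fun _ => r)
            (fun j => upd p x j) 1).
          intros j z Hj. eapply exec_eq; [apply push_prv|reflexivity|]. rewrite upd_same. mk_eq.
        - mk_eq.
        - reflexivity. }
      eapply ex_seq.
      { eapply exec_eq.
        - apply (exec_loop_unary (prv x) (Seq (comp g) (Push (reg x) true)) Skip
            (fun j => mkst A B (rev (flat_map (fun v => gden w g (upd r x v)) (seq 0 j)) ++ o) 0
                       (upd r x j) (upd p x (r y - j))) (r y) (S (f N + 1))).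
          + intros j Hj. now rewrite mkst_prv, upd_same.
          + intros j Hj. rewrite upd_prv. eapply ex_seq.
            * eapply exec_eq.
              -- apply (IH (x :: act) top w A B (rev (flat_map (fun v => gden w g (upd r x v)) (seq 0 j)) ++ o)
                    (upd r x j) (upd p x (r y - S j)) N W Ht).
                 ++ intros v Hv. rewrite !upd_other by (intros ->; apply Hv; now left).
                    apply Ha. intros Hi. apply Hv. now right.
                 ++ intros v. unfold upd. destruct (v =? x); [|apply HN]. pose proof (HN y). lia.
                 ++ exact Hw.
              -- mk_eq.
              -- reflexivity.
            * eapply exec_eq; [apply push_reg|reflexivity|]. rewrite upd_same, seq_S_map, rev_app_distr, <- app_assoc.
              mk_eq.
        - mk_eq.
        - reflexivity. }
      eapply exec_eq; [apply clear_reg_exec|reflexivity|]. cbn [gden]. mk_eq.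
    + rewrite upd_same. pose proof (HN y). nia.
  - exists (fun N => N * (f1 N + f0 N + 20) + 20). split; [pbound|].
    intros act top w A B o r p N (Wx & -> & W1 & W0) Ht Ha HN Hw.
    destruct (Ha x Wx) as [Hrx Hpx]. destruct (Ht eq_refl) as [-> ->]. cbn [comp].
    eapply ex_weak.
    + eapply ex_seq.
      { eapply exec_eq.
        - apply (exec_loop iA (Seq (Push iB true) (Seq (comp g1) (Push (reg x) true)))
                   (Seq (Push iB false) (Seq (comp g0) (Push (reg x) true)))
            (fun j => mkst (skipn j w) (rev (firstn j w))
                (rev (flat_map (fun v => gden w (if nth v w false then g1 else g0) (upd r x v)) (seq 0 j)) ++ o) 0
                       (upd r x j) p) w (f1 N + f0 N + 4)).
          + reflexivity.
          + intros j Hj. rewrite upd_A.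
            assert (Hu : forall v, upd r x j v <= N).
            { intros v. unfold upd. destruct (v =? x); [|apply HN]. lia. }
            assert (Hv : forall v, ~ In v (x :: act) -> upd r x j v = 0 /\ p v = 0).
            { intros v Hv. rewrite !upd_other by (intros ->; apply Hv; now left).
              apply Ha. intros Hi. apply Hv. now right. }
            assert (E : nth j w false :: rev (firstn j w) = rev (firstn (S j) w)).
            { rewrite (firstn_S_nth w j false Hj), rev_app_distr. reflexivity. }
            rewrite seq_S_map, rev_app_distr, <- E.
            destruct (nth j w false).
            * eapply ex_weak with (n := S (1 + S (f1 N + 1))); [|lia].
              eapply ex_seq; [apply push_B|].
              eapply ex_seq; [apply (IH1 (x :: act) false w _ _ _ _ _ N W1); auto; discriminate|].
              eapply exec_eq; [apply push_reg|reflexivity|]. rewrite upd_same, <- app_assoc. mk_eq.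
            * eapply ex_weak with (n := S (1 + S (f0 N + 1))); [|lia].
              eapply ex_seq; [apply push_B|].
              eapply ex_seq; [apply (IH0 (x :: act) false w _ _ _ _ _ N W0); auto; discriminate|].
              eapply exec_eq; [apply push_reg|reflexivity|]. rewrite upd_same, <- app_assoc. mk_eq.
        - mk_eq.
        - reflexivity. }
      rewrite skipn_all, firstn_all.
      eapply ex_seq; [apply restore_input_exec|].
      eapply exec_eq; [apply clear_reg_exec|reflexivity|]. cbn [gden]. mk_eq.
    + rewrite upd_same. nia.
  - exists (fun N => N * 20 + f N + 20). split; [pbound|].
    intros act top w A B o r p N (Wx & -> & W) Ht Ha HN Hw.
    destruct (Ha x Wx) as [Hrx Hpx]. destruct (Ht eq_refl) as [-> ->]. cbn [comp].
    eapply ex_weak.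
    + eapply ex_seq.
      { eapply exec_eq.
        - apply (exec_loop iA (Seq (Push iB true) (Push (reg x) true)) (Seq (Push iB false) (Push (reg x) true))
            (fun j => mkst (skipn j w) (rev (firstn j w)) o 0 (upd r x j) p) w 3).
          + reflexivity.
          + intros j Hj. rewrite upd_A.
            assert (E : nth j w false :: rev (firstn j w) = rev (firstn (S j) w)).
            { rewrite (firstn_S_nth w j false Hj), rev_app_distr. reflexivity. }
            rewrite <- E.
            destruct (nth j w false);
              (eapply ex_weak with (n := S (1 + 1)); [|lia]; eapply ex_seq; [apply push_B|]; eapply exec_eq; [apply push_reg|reflexivity|];
               rewrite upd_same; mk_eq).
        - mk_eq.
        - reflexivity. }
      rewrite skipn_all, firstn_all.
      eapply ex_seq; [apply restore_input_exec|].
      eapply ex_seq; [apply (IH (x :: act) true w _ _ _ _ _ N W)|].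
      * auto.
      * intros v Hv. rewrite !upd_other by (intros ->; apply Hv; now left).
        apply Ha. intros Hi. apply Hv. now right.
      * intros v. unfold upd. destruct (v =? x); [|apply HN]. lia.
      * exact Hw.
      * eapply exec_eq; [apply clear_reg_exec|reflexivity|]. cbn [gden]. mk_eq.
    + rewrite upd_same. nia.
  - destruct (poly_exec a d) as (f1 & P1 & E1).
    exists (fun N => f1 N + f (N + poly a d N) + 2 * poly a d N + 3). split.
    { assert (pbounded (fun N => f (N + poly a d N))) by (apply (pbounded_comp f); [assumption|pbound]). pbound. }
    intros act top w A B o r p N (Wx & Wy & W) Ht Ha HN Hw.
    destruct (Ha x Wx) as [Hrx Hpx]. cbn [comp].
    pose proof (poly_mono a d _ _ (HN y)) as HM.
    eapply ex_weak.
    + eapply ex_seq; [apply E1; auto; apply HN|].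
      eapply ex_seq; [apply (IH (x :: act) top w _ _ _ _ _ (N + poly a d N) W Ht)|].
      * intros v Hv. rewrite !upd_other by (intros ->; apply Hv; now left).
        apply Ha. intros Hi. apply Hv. now right.
      * intros v. unfold upd. destruct (v =? x); [lia|]. specialize (HN v). lia.
      * lia.
      * eapply exec_eq; [apply clear_reg_exec|reflexivity|]. cbn [gden]. mk_eq.
    + rewrite upd_same. lia.
Qed.

Lemma below_mono k k' c : k <= k' -> below k c -> below k' c.
Proof. intros H. induction c; cbn; intuition lia. Qed.

Lemma below_exists c : exists k, below k c.
Proof.
  induction c as [|i b|c1 [k1 H1] c2 [k2 H2]|i c1 [k1 H1] c0 [k0 H0]].
  - now exists 0.
  - exists (S i). cbn. lia.
  - exists (k1 + k2). split; eapply below_mono; try eassumption; lia.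
  - exists (S i + k1 + k0). split; [lia|split; eapply below_mono; try eassumption; lia].
Qed.

(* The output is written backwards on stack [iO] and reversed onto stack [iF]. *)
Lemma gen_computable g : gwf [] true g -> fp_computable (fun w => gden w g (fun _ => 0)).
Proof.
  intros W. destruct (comp_exec g) as (f & P & H).
  set (c := Seq (comp g) (Loop iO (Push iF true) (Push iF false))).
  destruct (below_exists c) as [k Hk].
  apply (cmd_computable (k + 3) iF c); [eapply below_mono; [|exact Hk]; lia|lia|].
  assert (HW : forall w, exec (comp g) (input_store w) (f (length w)) (mkst w [] (rev (gden w g (fun _ => 0))) 0 (fun _ => 0) (fun _ => 0))).
  { intros w. eapply exec_eq; [apply (H [] true w w [] [] (fun _ => 0) (fun _ => 0) (length w) W); auto; lia| |].
    - apply store_ext; try reflexivity; intros x; rewrite ?mkst_reg, ?mkst_prv; reflexivity.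
    - now rewrite app_nil_r. }
  exists (fun n => S (f n + ((S (5 + k + 3) + n + f n) * 2 + 1))). split; [pbound|].
  intros w. specialize (HW w). set (out := gden w g (fun _ => 0)) in *.
  (* The tape grows by at most one cell per unit of cost, so the output length, and with it the cost
     of reversing, is polynomial. *)
  assert (HL : length out <= S (5 + k + 3) + length w + f (length w)).
  { pose proof (exec_length _ _ _ _ HW (S (k + 3))) as HL.
    assert (Hb : below (S (k + 3)) (comp g)) by (eapply below_mono; [|exact (proj1 Hk)]; lia).
    specialize (HL Hb). unfold weight in HL. rewrite blocks_input in HL.
    rewrite tape_cons, tape_repeat_nil in HL. cbn [length] in HL. rewrite length_app, length_blk, repeat_length in HL.
    rewrite (blocks_split (S (k + 3)) 2) in HL by lia. rewrite tape_app, tape_cons in HL.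
    rewrite length_app in HL. cbn [length] in HL. rewrite length_app, length_blk in HL.
    cbn [mkst] in HL. rewrite length_rev in HL. lia. }
  set (s0 := mkst w [] (rev out) 0 (fun _ => 0) (fun _ => 0)) in *.
  exists (upd (upd s0 iO []) iF out). split; [|apply upd_same].
  eapply ex_weak with (n := S (f (length w) + (length out * 2 + 1))); [|lia].
  eapply ex_seq; [exact HW|]. rewrite <- length_rev. eapply exec_eq.
  - apply (exec_loop iO (Push iF true) (Push iF false)
      (fun j => upd (upd s0 iO (skipn j (rev out))) iF (rev (firstn j (rev out)))) (rev out) 1).
    + intros j Hj. rewrite upd_other by lia. apply upd_same.
    + intros j Hj.
      replace (if nth j (rev out) false then Push iF true else Push iF false) with (Push iF (nth j (rev out) false))
        by (now destruct (nth j (rev out) false)).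
      eapply exec_eq; [apply ex_push|reflexivity|].
      rewrite (firstn_S_nth (rev out) j false Hj), rev_app_distr. extensionality i. unfold upd.
      destruct (i =? 3) eqn:E3; [|destruct (i =? 2) eqn:E2; reflexivity]. reflexivity.
  - extensionality i. unfold upd, s0. destruct i as [|[|[|[|i]]]]; reflexivity.
  - rewrite skipn_all, firstn_all, rev_involutive. reflexivity.
Qed.

(** * Schemes of CNF formulas *)

Fixpoint pos_of_bits (bs : list bool) : positive :=
  match bs with
  | [] => xH
  | true :: bs => xI (pos_of_bits bs)
  | false :: bs => xO (pos_of_bits bs)
  end.

Definition code (l : list nat) : nat := Pos.to_nat (pos_of_bits (flat_map unary l)).

Lemma nat_bits_code l : nat_bits (code l) = flat_map unary l ++ [true].
Proof.
  unfold nat_bits, code. rewrite positive_nat_N.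
  induction (flat_map unary l) as [|[] bs IH]; cbn; [reflexivity|now rewrite IH..].
Qed.

Fixpoint decode_bits (bs : list bool) (n : nat) : list nat :=
  match bs with
  | [] => []
  | true :: bs => decode_bits bs (S n)
  | false :: bs => n :: decode_bits bs 0
  end.

Definition decode (n : nat) : list nat := decode_bits (nat_bits n) 0.

Lemma decode_code l : decode (code l) = l.
Proof.
  unfold decode. rewrite nat_bits_code. induction l as [|x l IH]; [reflexivity|].
  cbn [flat_map]. rewrite <- app_assoc. set (rest := flat_map unary l ++ [true]) in *.
  assert (H : forall n, decode_bits (unary x ++ rest) n = (n + x) :: decode_bits rest 0).
  { unfold unary. induction x as [|x IHx]; intros n; cbn; [now rewrite Nat.add_0_r|].
    rewrite IHx. f_equal. lia. }
  rewrite H, IH. reflexivity.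
Qed.

Lemma code_inj l l' : code l = code l' -> l = l'.
Proof. intros H. rewrite <- (decode_code l), H. apply decode_code. Qed.

Inductive pt : Type :=
| PNil
| PLit (b : bool) (a : list lin)
| PSeq (p q : pt)
| PFor (x y : nat) (p : pt).

(** One syntax with three readings: [sgen] prints it, [sden] is the formula, and [ssem] is its truth
    condition under a predicate on atoms. [SPre], which puts the same literals in front of all
    clauses, is how [branch] is expressed. *)
Inductive sch : Type :=
| SNil
| SClause (p : pt)
| SSeq (s1 s2 : sch)
| SFor (x y : nat) (s : sch)
| SInput (x : nat) (s1 s0 : sch)
| SLen (x : nat) (s : sch)
| SPoly (x a d y : nat) (s : sch)
| SPre (p : pt) (s : sch).

Definition atom (r : nat -> nat) (a : list lin) : list nat := map (leval r) a.

Fixpoint pden (p : pt) (r : nat -> nat) : clause :=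
  match p with
  | PNil => []
  | PLit b a => [(code (atom r a), b)]
  | PSeq p q => pden p r ++ pden q r
  | PFor x y p => flat_map (fun v => pden p (upd r x v)) (seq 0 (r y))
  end.

Fixpoint sden (w : list bool) (s : sch) (r : nat -> nat) : cnf :=
  match s with
  | SNil => []
  | SClause p => [pden p r]
  | SSeq s1 s2 => sden w s1 r ++ sden w s2 r
  | SFor x y s => flat_map (fun v => sden w s (upd r x v)) (seq 0 (r y))
  | SInput x s1 s0 =>
      flat_map (fun v => sden w (if nth v w false then s1 else s0) (upd r x v)) (seq 0 (length w))
  | SLen x s => sden w s (upd r x (length w))
  | SPoly x a d y s => sden w s (upd r x (poly a d (r y)))
  | SPre p s => map (app (pden p r)) (sden w s r)
  end.

Definition gcode (a : list lin) : gen :=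
  fold_right (fun l g => GSeq (GLin l) g) (GEmit (tok_digit true)) a.

Fixpoint pgen (p : pt) : gen :=
  match p with
  | PNil => GEmit []
  | PLit b a => GSeq (GEmit (tok_digit b)) (GSeq (gcode a) (GEmit tok_end_lit))
  | PSeq p q => GSeq (pgen p) (pgen q)
  | PFor x y p => GFor x y (pgen p)
  end.

Fixpoint sgen (pre : pt) (s : sch) : gen :=
  match s with
  | SNil => GEmit []
  | SClause p => GSeq (pgen pre) (GSeq (pgen p) (GEmit tok_end_clause))
  | SSeq s1 s2 => GSeq (sgen pre s1) (sgen pre s2)
  | SFor x y s => GFor x y (sgen pre s)
  | SInput x s1 s0 => GInput x (sgen pre s1) (sgen pre s0)
  | SLen x s => GLen x (sgen pre s)
  | SPoly x a d y s => GPoly x a d y (sgen pre s)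
  | SPre p s => sgen (PSeq pre p) s
  end.

Fixpoint pfv (p : pt) : list nat :=
  match p with
  | PNil => []
  | PLit _ a => flat_map fst a
  | PSeq p q => pfv p ++ pfv q
  | PFor x y p => y :: pfv p
  end.

(** Since [sgen] prints a prefix anew in front of each clause, inside the loops that produce the
    clauses, no loop may rebind a register of a prefix. *)
Fixpoint fresh (l : list nat) (s : sch) : Prop :=
  match s with
  | SNil | SClause _ => True
  | SSeq s1 s2 => fresh l s1 /\ fresh l s2
  | SFor x _ s => ~ In x l /\ fresh l s
  | SInput x s1 s0 => ~ In x l /\ fresh l s1 /\ fresh l s0
  | SLen x s => ~ In x l /\ fresh l s
  | SPoly x _ _ _ s => ~ In x l /\ fresh l s
  | SPre p s => fresh (l ++ pfv p) s
  end.

Lemma gden_gcode w a r : gden w (gcode a) r = enc_nat (code (atom r a)).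
Proof.
  unfold enc_nat. rewrite nat_bits_code. unfold atom.
  induction a as [|l a IH]; [reflexivity|].
  cbn [gcode fold_right gden map flat_map]. rewrite <- app_assoc, flat_map_app.
  f_equal. exact IH.
Qed.

Lemma flat_map_flat_map {A B C} (f : B -> list C) (g : A -> list B) l :
  flat_map f (flat_map g l) = flat_map (fun x => flat_map f (g x)) l.
Proof. induction l as [|a l IH]; cbn; [reflexivity|]. now rewrite flat_map_app, IH. Qed.

Lemma gden_pgen w p : forall r, gden w (pgen p) r = flat_map enc_lit (pden p r).
Proof.
  induction p as [|b a|p IHp q IHq|x y p IH]; intros r.
  - reflexivity.
  - cbn [pgen gden pden flat_map]. rewrite gden_gcode, app_nil_r. reflexivity.
  - cbn. now rewrite IHp, IHq, flat_map_app.
  - cbn. rewrite flat_map_flat_map. apply flat_map_ext. intros v. apply IH.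
Qed.

Lemma leval_ext r r' l : (forall x, In x (fst l) -> r x = r' x) -> leval r l = leval r' l.
Proof. intros H. unfold leval. f_equal. f_equal. now apply map_ext_in. Qed.

Lemma pden_ext p : forall r r', (forall x, In x (pfv p) -> r x = r' x) -> pden p r = pden p r'.
Proof.
  induction p as [|b a|p IHp q IHq|x y p IH]; intros r r' H; cbn in *.
  - reflexivity.
  - f_equal. f_equal. f_equal. apply map_ext_in. intros l Hl. apply leval_ext. intros x Hx.
    apply H. apply in_flat_map. eauto.
  - f_equal; [apply IHp|apply IHq]; intros; apply H, in_or_app; auto.
  - rewrite (H y) by now left. apply flat_map_ext. intros v. apply IH. intros z Hz.
    unfold upd. destruct (z =? x); [reflexivity|]. apply H. now right.
Qed.

Lemma map_flat_map {A B C} (f : B -> C) (g : A -> list B) l :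
  map f (flat_map g l) = flat_map (fun x => map f (g x)) l.
Proof. induction l as [|a l IH]; cbn; [reflexivity|]. now rewrite map_app, IH. Qed.

Lemma gden_sgen w s : forall pre r, fresh (pfv pre) s ->
  gden w (sgen pre s) r = enc_cnf (map (app (pden pre r)) (sden w s r)).
Proof.
  assert (HU : forall pre r x v, ~ In x (pfv pre) -> pden pre (upd r x v) = pden pre r).
  { intros pre r x v H. apply pden_ext. intros z Hz. apply upd_other. intros ->. contradiction. }
  induction s as [|p|s1 IH1 s2 IH2|x y s IH|x s1 IH1 s0 IH0|x s IH|x a d y s IH|p s IH]; intros pre r F; cbn in *.
  - reflexivity.
  - rewrite !gden_pgen. unfold enc_cnf. cbn. unfold enc_clause.
    now rewrite flat_map_app, <- !app_assoc, app_nil_r.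
  - destruct F as [F1 F2]. unfold enc_cnf in *. now rewrite IH1, IH2, map_app, flat_map_app.
  - destruct F as [Fx F]. unfold enc_cnf in *. rewrite map_flat_map, flat_map_flat_map.
    apply flat_map_ext. intros v. now rewrite IH, HU.
  - destruct F as (Fx & F1 & F0). unfold enc_cnf in *. rewrite map_flat_map, flat_map_flat_map.
    apply flat_map_ext. intros v. destruct (nth v w false); [rewrite IH1|rewrite IH0]; auto; now rewrite HU.
  - destruct F as [Fx F]. now rewrite IH, HU.
  - destruct F as [Fx F]. now rewrite IH, HU.
  - rewrite IH by exact F. rewrite map_map. unfold enc_cnf. f_equal. apply map_ext. intros C. cbn. now rewrite app_assoc.
Qed.

Fixpoint psem (A : list nat -> Prop) (p : pt) (r : nat -> nat) : Prop :=
  match p with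
  | PNil => False
  | PLit b a => if b then A (atom r a) else ~ A (atom r a)
  | PSeq p q => psem A p r \/ psem A q r
  | PFor x y p => exists v, v < r y /\ psem A p (upd r x v)
  end.

Fixpoint ssem (A : list nat -> Prop) (w : list bool) (s : sch) (r : nat -> nat) : Prop :=
  match s with
  | SNil => True
  | SClause p => psem A p r
  | SSeq s1 s2 => ssem A w s1 r /\ ssem A w s2 r
  | SFor x y s => forall v, v < r y -> ssem A w s (upd r x v)
  | SInput x s1 s0 =>
      forall v, v < length w -> ssem A w (if nth v w false then s1 else s0) (upd r x v)
  | SLen x s => ssem A w s (upd r x (length w))
  | SPoly x a d y s => ssem A w s (upd r x (poly a d (r y)))
  | SPre p s => psem A p r \/ ssem A w s r
  end.

Definition ltrue (A : nat -> Prop) (l : lit) : Prop := if snd l then A (fst l) else ~ A (fst l).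
Definition csat (A : nat -> Prop) (C : clause) : Prop := exists l, In l C /\ ltrue A l.
Definition sat (A : nat -> Prop) (F : cnf) : Prop := forall C, In C F -> csat A C.

Lemma csat_app A C D : csat A (C ++ D) <-> csat A C \/ csat A D.
Proof.
  unfold csat. split.
  - intros (l & H & T). apply in_app_or in H as [H|H]; eauto.
  - intros [(l & H & T)|(l & H & T)]; exists l; rewrite in_app_iff; auto.
Qed.

Lemma sat_app A F G : sat A (F ++ G) <-> sat A F /\ sat A G.
Proof.
  unfold sat. split.
  - intros H. split; intros C HC; apply H, in_or_app; auto.
  - intros [H1 H2] C HC. apply in_app_or in HC as [HC|HC]; auto.
Qed.

Lemma pden_sem A A' p : (forall a, A' a <-> A (code a)) -> forall r, csat A (pden p r) <-> psem A' p r.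
Proof.
  intros HA. induction p as [|b a|p IHp q IHq|x y p IH]; intros r; cbn.
  - unfold csat. cbn. firstorder.
  - unfold csat, ltrue. cbn. destruct b; rewrite HA; (split; [intros (l & [<-|[]] & T); exact T|]);
      intros T; eexists; (split; [left; reflexivity|exact T]).
  - now rewrite csat_app, IHp, IHq.
  - split.
    + intros (l & H & T). apply in_flat_map in H as (v & Hv & Hl). apply in_seq in Hv.
      exists v. split; [lia|]. apply IH. exists l. auto.
    + intros (v & Hv & H). apply IH in H as (l & Hl & T). exists l. split; [|exact T].
      apply in_flat_map. exists v. split; [apply in_seq; lia|exact Hl].
Qed.

Lemma sden_sem A A' w s : (forall a, A' a <-> A (code a)) -> forall r, sat A (sden w s r) <-> ssem A' w s r.
Proof.
  intros HA.
  assert (HF : forall n (f : nat -> cnf), sat A (flat_map f (seq 0 n)) <-> forall v, v < n -> sat A (f v)).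
  { intros n f. unfold sat. split.
    - intros H v Hv C HC. apply H, in_flat_map. exists v. split; [apply in_seq; lia|exact HC].
    - intros H C HC. apply in_flat_map in HC as (v & Hv & HC). apply in_seq in Hv. apply (H v); [lia|exact HC]. }
  induction s as [|p|s1 IH1 s2 IH2|x y s IH|x s1 IH1 s0 IH0|x s IH|x a d y s IH|p s IH]; intros r; cbn.
  - split; [trivial|intros _ C []].
  - rewrite <- (pden_sem A A' p HA). split; [intros H; apply H; now left|intros H C [<-|[]]; exact H].
  - now rewrite sat_app, IH1, IH2.
  - rewrite HF. split; intros H v Hv; apply IH; auto.
  - rewrite HF. split; intros H v Hv; specialize (H v Hv);
      (destruct (nth v w false); [apply IH1|apply IH0]; exact H).
  - apply IH.
  - apply IH.
  - rewrite <- (pden_sem A A' p HA), <- IH. unfold sat. split.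
    + intros H. destruct (classic (csat A (pden p r))) as [|N]; [now left|right].
      intros C HC. assert (HC' : csat A (pden p r ++ C)) by (apply H, in_map, HC).
      apply csat_app in HC' as [|]; [contradiction|assumption].
    + intros H C HC. apply in_map_iff in HC as (D & <- & HD). apply csat_app. destruct H as [H|H]; [now left|right; now apply H].
Qed.

Fixpoint pall (Q : list lin -> Prop) (p : pt) : Prop :=
  match p with
  | PNil => True
  | PLit _ a => Q a
  | PSeq p q => pall Q p /\ pall Q q
  | PFor _ _ p => pall Q p
  end.

Fixpoint sall (Q : list lin -> Prop) (s : sch) : Prop :=
  match s with
  | SNil => True
  | SClause p => pall Q p
  | SSeq s1 s2 | SInput _ s1 s2 => sall Q s1 /\ sall Q s2
  | SFor _ _ s | SLen _ s | SPoly _ _ _ _ s => sall Q s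
  | SPre p s => pall Q p /\ sall Q s
  end.

Lemma pall_vars Q p n : pall Q p -> forall r, In n (map fst (pden p r)) ->
  exists a r', Q a /\ n = code (atom r' a).
Proof.
  induction p as [|b a|p IHp q IHq|x y p IH]; intros H r Hn; cbn in *.
  - destruct Hn.
  - destruct Hn as [<-|[]]. eauto.
  - destruct H as [H1 H2]. rewrite map_app in Hn. apply in_app_or in Hn as [Hn|Hn]; [eapply IHp|eapply IHq]; eauto.
  - rewrite map_flat_map in Hn. apply in_flat_map in Hn as (v & Hv & Hn). eapply IH; eauto.
Qed.

Lemma vars_app F G : vars (F ++ G) = vars F ++ vars G.
Proof. apply flat_map_app. Qed.

Lemma vars_flat_map (f : nat -> cnf) l n : In n (vars (flat_map f l)) -> exists v, In v l /\ In n (vars (f v)).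
Proof.
  unfold vars. rewrite flat_map_flat_map. intros H. now apply in_flat_map in H.
Qed.

Lemma sall_vars Q w s n : sall Q s -> forall r, In n (vars (sden w s r)) ->
  exists a r', Q a /\ n = code (atom r' a).
Proof.
  induction s as [|p|s1 IH1 s2 IH2|x y s IH|x s1 IH1 s0 IH0|x s IH|x a d y s IH|p s IH]; intros H r Hn; cbn [sden sall] in *.
  - destruct Hn.
  - unfold vars in Hn. cbn in Hn. rewrite app_nil_r in Hn. eapply pall_vars; eauto.
  - destruct H as [H1 H2]. rewrite vars_app in Hn. apply in_app_or in Hn as [Hn|Hn]; [eapply IH1|eapply IH2]; eauto.
  - apply vars_flat_map in Hn as (v & _ & Hn). eapply IH; eauto.
  - destruct H as [H1 H2]. apply vars_flat_map in Hn as (v & _ & Hn).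
    destruct (nth v w false); [eapply IH1|eapply IH0]; eauto.
  - eapply IH; eauto.
  - eapply IH; eauto.
  - destruct H as [H1 H2]. unfold vars in Hn. apply in_flat_map in Hn as (C & HC & Hn).
    apply in_map_iff in HC as (D & <- & HD). rewrite map_app in Hn. apply in_app_or in Hn as [Hn|Hn].
    + eapply pall_vars; eauto.
    + eapply IH; [exact H2|]. unfold vars. apply in_flat_map. eauto.
Qed.

(** * Number of occurrences of variables *)

Lemma length_enc_clause C : length C <= length (enc_clause C).
Proof.
  unfold enc_clause. rewrite length_app.
  induction C as [|l C IH]; cbn [flat_map length] in *; [lia|].
  rewrite length_app.
  assert (1 <= length (enc_lit l)) by (unfold enc_lit; rewrite length_app; cbn; lia). lia.
Qed.

Lemma length_vars_enc F : length (vars F) <= length (enc_cnf F).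
Proof.
  unfold vars, enc_cnf. induction F as [|C F IH]; cbn [flat_map]; [apply Nat.le_refl|].
  rewrite !length_app, length_map. exact (Nat.add_le_mono _ _ _ _ (length_enc_clause C) IH).
Qed.

Lemma weight_le k (s : store) M : (forall i, length (s i) <= M) -> weight k s <= k * S M.
Proof.
  intros H. unfold weight, blocks. generalize 0 as a. induction k as [|k IH]; intros a; [apply Nat.le_refl|].
  cbn [seq map]. rewrite tape_cons. cbn [length]. rewrite length_app, length_blk.
  specialize (H a). specialize (IH (S a)). lia.
Qed.

(* The formula is written in polynomial time, so it has polynomially many occurrences of variables. *)
Lemma vars_bound s : exists f, pbounded f /\ forall act w r N, gwf act true (sgen PNil s) -> fresh [] s ->
  (forall v, ~ In v act -> r v = 0) -> (forall v, r v <= N) -> length w <= N ->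
  length (vars (sden w s r)) <= f N.
Proof.
  destruct (comp_exec (sgen PNil s)) as (f & P & H).
  destruct (below_exists (comp (sgen PNil s))) as [k Hk].
  exists (fun N => (k + 3) * S N + f N). split; [pbound|].
  intros act w r N W F Ha HN Hw.
  assert (He := H act true w w [] [] r (fun _ => 0) N W (fun _ => conj eq_refl eq_refl)
                  (fun v Hv => conj (Ha v Hv) eq_refl) HN Hw).
  rewrite gden_sgen, app_nil_r in He by exact F. cbn [pden] in He.
  rewrite (map_ext _ (fun C => C)), map_id in He by reflexivity.
  pose proof (length_vars_enc (sden w s r)) as HV. rewrite <- (length_rev (enc_cnf _)) in HV.
  pose proof (exec_length _ _ _ _ He (k + 3) (below_mono k (k + 3) _ (Nat.le_add_r k 3) Hk)) as HL.
  assert (HO : length (rev (enc_cnf (sden w s r))) <=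
    weight (k + 3) (mkst w [] (rev (enc_cnf (sden w s r))) 0 r (fun _ => 0))).
  { unfold weight. rewrite (blocks_split (k + 3) 2), tape_app, tape_cons, length_app by lia.
    cbn [length]. rewrite length_app, length_blk. cbn [mkst]. lia. }
  assert (HI : weight (k + 3) (mkst w [] [] 0 r (fun _ => 0)) <= (k + 3) * S N).
  { apply weight_le. intros [|[|[|[|[|m]]]]]; cbn; try lia.
    destruct (Nat.even m); rewrite repeat_length; [apply HN|lia]. }
  lia.
Qed.

(** * Minimum-size search trees *)

Lemma lit_eqb_eq l m : lit_eqb l m = true <-> l = m.
Proof.
  unfold lit_eqb. destruct l as [x b], m as [y c]. cbn. rewrite andb_true_iff, Nat.eqb_eq, eqb_true_iff.
  split; [intros [-> ->]; reflexivity|intros E; inversion E; auto].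
Qed.

Definition red (x : nat) (b : bool) (C : clause) : clause :=
  filter (fun l => negb (lit_eqb (neg_lit l) (x, b))) C.

Lemma neg_lit_eqb l x b : lit_eqb (neg_lit l) (x, b) = true <-> l = (x, negb b).
Proof.
  rewrite lit_eqb_eq. destruct l as [y c]. unfold neg_lit. cbn. split; intros E; inversion E; subst.
  - now rewrite negb_involutive.
  - now rewrite negb_involutive.
Qed.

Lemma in_red x b C l : In l (red x b C) <-> In l C /\ l <> (x, negb b).
Proof.
  unfold red. rewrite filter_In, negb_true_iff, <- not_true_iff_false, neg_lit_eqb. reflexivity.
Qed.

Lemma restrict_cons1 C F x b : restrict (C :: F) [(x, b)] =
  if existsb (fun l => lit_eqb l (x, b)) C then restrict F [(x, b)] else red x b C :: restrict F [(x, b)].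
Proof.
  unfold restrict. cbn [filter].
  replace (existsb (fun l => existsb (lit_eqb l) [(x, b)]) C) with (existsb (fun l => lit_eqb l (x, b)) C).
  2:{ induction C as [|l C IH]; [reflexivity|]. cbn in *. now rewrite orb_false_r, IH. }
  destruct (existsb (fun l => lit_eqb l (x, b)) C); [reflexivity|]. cbn [negb map]. f_equal.
  unfold red. apply filter_ext. intros l. cbn. now rewrite orb_false_r.
Qed.

Lemma existsb_lit C l : existsb (fun m => lit_eqb m l) C = true <-> In l C.
Proof.
  rewrite existsb_exists. split.
  - intros (m & Hm & E). apply lit_eqb_eq in E. now subst.
  - intros H. exists l. split; [exact H|now apply lit_eqb_eq].
Qed.

Lemma in_restrict F x b D : In D (restrict F [(x, b)]) <->
  exists C, In C F /\ ~ In (x, b) C /\ D = red x b C.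
Proof.
  induction F as [|C F IH]; [cbn; firstorder|]. rewrite restrict_cons1.
  destruct (existsb (fun l => lit_eqb l (x, b)) C) eqn:E.
  - apply existsb_lit in E. rewrite IH. split.
    + intros (C' & H1 & H2 & H3). exists C'. cbn. auto.
    + intros (C' & [<-|H1] & H2 & H3); [contradiction|eauto].
  - cbn [In]. rewrite IH. apply not_true_iff_false in E. rewrite existsb_lit in E. split.
    + intros [<-|(C' & H1 & H2 & H3)]; [exists C; cbn; auto|exists C'; cbn; auto].
    + intros (C' & [<-|H1] & H2 & H3); [left; auto|right; eauto].
Qed.

Lemma restrict_app F G I : restrict (F ++ G) I = restrict F I ++ restrict G I.
Proof. unfold restrict. now rewrite filter_app, map_app. Qed.

Lemma in_vars F x : In x (vars F) <-> exists C b, In C F /\ In (x, b) C.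
Proof.
  unfold vars. rewrite in_flat_map. split.
  - intros (C & HC & H). apply in_map_iff in H as ([y b] & E & H). cbn in E. subst. eauto.
  - intros (C & b & HC & H). exists C. split; [exact HC|]. apply in_map_iff. now exists (x, b).
Qed.

Lemma red_notin x b C : (forall c, ~ In (x, c) C) -> red x b C = C.
Proof.
  intros H. unfold red. induction C as [|l C IH]; [reflexivity|]. cbn [filter].
  destruct (lit_eqb (neg_lit l) (x, b)) eqn:E.
  - apply neg_lit_eqb in E. subst. exfalso. eapply H. now left.
  - cbn. f_equal. apply IH. intros c Hc. apply (H c). now right.
Qed.

Lemma restrict_notin F x b : ~ In x (vars F) -> restrict F [(x, b)] = F.
Proof.
  intros H. induction F as [|C F IH]; [reflexivity|]. rewrite restrict_cons1.
  assert (HC : forall c, ~ In (x, c) C) by (intros c Hc; apply H, in_vars; exists C, c; split; [now left|exact Hc]).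
  destruct (existsb (fun l => lit_eqb l (x, b)) C) eqn:E; [apply existsb_lit in E; now apply HC in E|].
  rewrite red_notin by exact HC. f_equal. apply IH. intros Hx. apply H.
  cbn. apply in_or_app. now right.
Qed.

Lemma vars_restrict F x b v : In v (vars (restrict F [(x, b)])) -> In v (vars F) /\ v <> x.
Proof.
  intros H. apply in_vars in H as (D & c & HD & Hv). apply in_restrict in HD as (C & HC & Hn & ->).
  apply in_red in Hv as [Hv Hv']. split; [apply in_vars; eauto|]. intros ->.
  destruct (bool_dec c b) as [->|Hb]; [contradiction|]. apply Hv'. f_equal. destruct c, b; cbn; congruence.
Qed.

Lemma restrict_map_other F x b y c : x <> y ->
  restrict (map (cons (y, c)) F) [(x, b)] = map (cons (y, c)) (restrict F [(x, b)]).
Proof.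
  intros H. induction F as [|C F IH]; [reflexivity|]. cbn [map]. rewrite !restrict_cons1.
  cbn [existsb]. replace (lit_eqb (y, c) (x, b)) with false.
  2:{ symmetry. apply not_true_iff_false. rewrite lit_eqb_eq. congruence. }
  cbn [orb]. destruct (existsb (fun l => lit_eqb l (x, b)) C); [exact IH|]. cbn [map]. rewrite <- IH. f_equal.
  unfold red. cbn [filter]. replace (lit_eqb (neg_lit (y, c)) (x, b)) with false; [reflexivity|].
  symmetry. apply not_true_iff_false. rewrite neg_lit_eqb. congruence.
Qed.

Lemma restrict_map_true F x b : restrict (map (cons (x, b)) F) [(x, b)] = [].
Proof.
  induction F as [|C F IH]; [reflexivity|]. cbn [map]. rewrite restrict_cons1. cbn [existsb].
  replace (lit_eqb (x, b) (x, b)) with true by (symmetry; now apply lit_eqb_eq). exact IH.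
Qed.

Lemma restrict_map_false F x b : ~ In x (vars F) -> restrict (map (cons (x, negb b)) F) [(x, b)] = F.
Proof.
  intros H. rewrite <- (restrict_notin F x b H) at 2. clear H.
  induction F as [|C F IH]; [reflexivity|]. cbn [map]. rewrite !restrict_cons1. cbn [existsb].
  replace (lit_eqb (x, negb b) (x, b)) with false.
  2:{ symmetry. apply not_true_iff_false. rewrite lit_eqb_eq. destruct b; cbn; congruence. }
  cbn [orb]. destruct (existsb (fun l => lit_eqb l (x, b)) C); [exact IH|]. rewrite IH. f_equal.
  unfold red. cbn [filter]. replace (lit_eqb (neg_lit (x, negb b)) (x, b)) with true; [reflexivity|].
  symmetry. now apply neg_lit_eqb.
Qed.

Lemma length_filter_lt {A} (f : A -> bool) l x : In x l -> f x = false -> length (filter f l) < length l.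
Proof.
  intros H Hf. induction l as [|a l IH]; [destruct H|]. cbn.
  pose proof (filter_length_le f l). destruct H as [->|H].
  - rewrite Hf. lia.
  - specialize (IH H). destruct (f a); cbn; lia.
Qed.

Lemma length_vars_cons C F : length (vars (C :: F)) = length C + length (vars F).
Proof. cbn. now rewrite length_app, length_map. Qed.

Lemma length_vars_restrict_le F x b : length (vars (restrict F [(x, b)])) <= length (vars F).
Proof.
  induction F as [|C F IH]; [apply Nat.le_refl|]. rewrite restrict_cons1, length_vars_cons.
  destruct (existsb (fun l => lit_eqb l (x, b)) C); [lia|]. rewrite length_vars_cons.
  pose proof (filter_length_le (fun l => negb (lit_eqb (neg_lit l) (x, b))) C). unfold red. lia.
Qed.

Lemma length_vars_restrict F x b : In x (vars F) -> length (vars (restrict F [(x, b)])) < length (vars F).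
Proof.
  intros H. induction F as [|C F IH]; [destruct H|]. rewrite restrict_cons1, length_vars_cons.
  pose proof (length_vars_restrict_le F x b) as HL.
  apply in_vars in H as (D & c & [<-|HD] & Hx).
  - destruct (existsb (fun l => lit_eqb l (x, b)) C) eqn:E.
    + destruct C; [destruct Hx|]. cbn. lia.
    + rewrite length_vars_cons. apply not_true_iff_false in E. rewrite existsb_lit in E.
      assert (c = negb b) as -> by (destruct c, b; try reflexivity; contradiction).
      assert (length (red x b C) < length C); [|lia].
      apply length_filter_lt with (x, negb b); [exact Hx|]. apply negb_false_iff. now apply neg_lit_eqb.
  - assert (Hx' : In x (vars F)) by (apply in_vars; eauto). specialize (IH Hx').
    destruct (existsb (fun l => lit_eqb l (x, b)) C); [lia|]. rewrite length_vars_cons.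
    pose proof (filter_length_le (fun l => negb (lit_eqb (neg_lit l) (x, b))) C). unfold red. lia.
Qed.

Lemma sat_restrict A F x (b : bool) : sat A F -> (if b then A x else ~ A x) -> sat A (restrict F [(x, b)]).
Proof.
  intros H Hx D HD. apply in_restrict in HD as (C & HC & Hn & ->).
  destruct (H C HC) as (l & Hl & Tl). exists l. split; [|exact Tl]. apply in_red. split; [exact Hl|].
  intros ->. unfold ltrue in Tl. cbn in Tl. destruct b; cbn in Tl; contradiction.
Qed.

Lemma restrict_sat A F x b : sat A (restrict F [(x, b)]) ->
  sat (fun v => if v =? x then b = true else A v) F.
Proof.
  intros H C HC. destruct (classic (In (x, b) C)) as [Hx|Hx].
  - exists (x, b). split; [exact Hx|]. unfold ltrue. cbn. rewrite Nat.eqb_refl. destruct b; congruence.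
  - destruct (H (red x b C)) as ([v c] & Hl & Tl); [apply in_restrict; eauto|].
    apply in_red in Hl as [Hl Hl']. exists (v, c). split; [exact Hl|]. unfold ltrue in *. cbn in *.
    destruct (Nat.eqb_spec v x) as [->|]; [|exact Tl].
    exfalso. destruct (bool_dec c b) as [->|Hb]; [contradiction|]. apply Hl'. f_equal. destruct c, b; cbn; congruence.
Qed.

Lemma bst_unsat F T : is_bst F T -> forall A, ~ sat A F.
Proof.
  induction 1 as [F H|F x T1 T2 Hn Hx H1 IH1 H2 IH2]; intros A HA.
  - destruct (HA [] H) as (l & [] & _).
  - destruct (classic (A x)) as [Ax|Ax].
    + apply (IH2 A). now apply sat_restrict.
    + apply (IH1 A). now apply sat_restrict.
Qed.

(** Branching on any occurring variable removes at least one literal occurrence, so the depth is at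
    most [length (vars F)], which counts occurrences and not distinct variables. *)
Lemma unsat_bst F : (forall A, ~ sat A F) -> exists T, is_bst F T /\ S (tree_size T) <= 2 ^ length (vars F).
Proof.
  remember (length (vars F)) as n eqn:En. revert F En.
  induction n as [n IH] using lt_wf_ind. intros F -> HF.
  destruct (classic (In [] F)) as [Hn|Hn].
  - exists Leaf. split; [now constructor|]. cbn. pose proof (Nat.pow_nonzero 2 (length (vars F))). lia.
  - destruct (vars F) as [|x vs] eqn:Ev.
    + exfalso. destruct F as [|C F]; [apply (HF (fun _ => True)); intros C []|].
      destruct C as [|l C]; [apply Hn; now left|discriminate].
    + assert (Hx : In x (vars F)) by (rewrite Ev; now left).
      rewrite <- Ev in *.
      assert (HR : forall b, exists T, is_bst (restrict F [(x, b)]) T /\ S (tree_size T) <= 2 ^ pred (length (vars F))).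
      { intros b. pose proof (length_vars_restrict F x b Hx) as HL.
        destruct (IH _ HL (restrict F [(x, b)]) eq_refl) as (T & HT & HS).
        - intros A HA. eapply HF, restrict_sat, HA.
        - exists T. split; [exact HT|]. eapply Nat.le_trans; [exact HS|].
          apply Nat.pow_le_mono_r; lia. }
      destruct (HR false) as (T1 & H1 & S1). destruct (HR true) as (T2 & H2 & S2).
      exists (Node x T1 T2). split; [now constructor|]. cbn.
      destruct (length (vars F)) as [|m] eqn:Em; [rewrite Ev in Em; discriminate|]. cbn in *. lia.
Qed.

Definition minbst (F : cnf) (n : nat) : Prop :=
  (exists T, is_bst F T /\ tree_size T = n) /\ forall T, is_bst F T -> n <= tree_size T.

Lemma minbst_exists F T : is_bst F T -> exists n, n <= tree_size T /\ minbst F n.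
Proof.
  remember (tree_size T) as n eqn:En. revert T En. induction n as [n IH] using lt_wf_ind. intros T -> HT.
  destruct (classic (exists T', is_bst F T' /\ tree_size T' < tree_size T)) as [(T' & H1 & H2)|N].
  - destruct (IH _ H2 T' eq_refl H1) as (m & Hm & M). exists m. split; [lia|exact M].
  - exists (tree_size T). split; [lia|]. split; [eauto|]. intros T' HT'.
    destruct (Nat.le_gt_cases (tree_size T) (tree_size T')) as [|L]; [assumption|]. exfalso. eauto.
Qed.

(** A node on [x] is illegal if the empty clause is present or [x] does not occur. In these cases a
    leaf takes its place, or [T1] itself, because restriction changes nothing. *)
Lemma bst_merge F x T1 T2 : is_bst (restrict F [(x, false)]) T1 -> is_bst (restrict F [(x, true)]) T2 ->
  exists T, is_bst F T /\ tree_size T <= S (tree_size T1 + tree_size T2).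
Proof.
  intros H1 H2. destruct (classic (In [] F)) as [Hn|Hn].
  - exists Leaf. split; [now constructor|cbn; lia].
  - destruct (classic (In x (vars F))) as [Hx|Hx].
    + exists (Node x T1 T2). split; [now constructor|cbn; lia].
    + rewrite restrict_notin in H1 by exact Hx. exists T1. split; [exact H1|lia].
Qed.

(** * Sums and disjoint unions *)

Definition branch (x : nat) (F G : cnf) : cnf := map (cons (x, true)) F ++ map (cons (x, false)) G.

Lemma vars_map_cons x b F v : In v (vars (map (cons (x, b)) F)) -> v = x \/ In v (vars F).
Proof.
  intros H. apply in_vars in H as (C & c & HC & Hv). apply in_map_iff in HC as (D & <- & HD).
  destruct Hv as [E|Hv]; [left; congruence|right; apply in_vars; eauto].
Qed.

Lemma vars_branch x F G v : In v (vars (branch x F G)) -> v = x \/ In v (vars F) \/ In v (vars G).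
Proof.
  unfold branch. rewrite vars_app. intros H.
  apply in_app_or in H as [H|H]; apply vars_map_cons in H; tauto.
Qed.

Lemma nil_branch x F G : ~ In [] (branch x F G).
Proof.
  unfold branch. intros H. apply in_app_or in H as [H|H]; apply in_map_iff in H as (C & E & _); discriminate.
Qed.

Lemma branch_restrict_other x F G y b : y <> x ->
  restrict (branch x F G) [(y, b)] = branch x (restrict F [(y, b)]) (restrict G [(y, b)]).
Proof. intros H. unfold branch. now rewrite restrict_app, !restrict_map_other. Qed.

Lemma branch_restrict_false x F G : ~ In x (vars F) -> restrict (branch x F G) [(x, false)] = F.
Proof.
  intros H. unfold branch. rewrite restrict_app, restrict_map_true, app_nil_r.
  apply (restrict_map_false F x false H).
Qed.

Lemma branch_restrict_true x F G : ~ In x (vars G) -> restrict (branch x F G) [(x, true)] = G.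
Proof.
  intros H. unfold branch. rewrite restrict_app, restrict_map_true. apply (restrict_map_false G x true H).
Qed.

(* No disjointness is needed: branching on a variable of both [F] and [G] splits both of them, and each can
   be put together again by [bst_merge]. *)
Lemma branch_lower x F G T : ~ In x (vars F) -> ~ In x (vars G) -> is_bst (branch x F G) T ->
  exists T1 T2, is_bst F T1 /\ is_bst G T2 /\ S (tree_size T1 + tree_size T2) <= tree_size T.
Proof.
  revert F G. induction T as [|y Ta IHa Tb IHb]; intros F G HF HG H; inversion H; subst.
  - exfalso. eapply nil_branch; eauto.
  - destruct (Nat.eq_dec y x) as [->|Hy].
    + rewrite branch_restrict_false in * by assumption. rewrite branch_restrict_true in * by assumption.
      exists Ta, Tb. split; [assumption|split; [assumption|cbn; lia]].
    + rewrite branch_restrict_other in * by assumption.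
      assert (HR : forall E b, ~ In x (vars E) -> ~ In x (vars (restrict E [(y, b)])))
        by (intros E b HE Hx; apply HE; now apply vars_restrict in Hx).
      destruct (IHa _ _ (HR F false HF) (HR G false HG) ltac:(eassumption)) as (A1 & A2 & HA1 & HA2 & SA).
      destruct (IHb _ _ (HR F true HF) (HR G true HG) ltac:(eassumption)) as (B1 & B2 & HB1 & HB2 & SB).
      destruct (bst_merge F y A1 B1 HA1 HB1) as (T1 & H1 & S1).
      destruct (bst_merge G y A2 B2 HA2 HB2) as (T2 & H2 & S2).
      exists T1, T2. split; [assumption|split; [assumption|cbn; lia]].
Qed.

Lemma branch_var x F G T : is_bst F T -> In x (vars (branch x F G)).
Proof.
  intros H. destruct F as [|C F].
  - exfalso. apply (bst_unsat _ _ H (fun _ => True)). intros C [].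
  - cbn. now left.
Qed.

Lemma branch_upper x F G T1 T2 : ~ In x (vars F) -> ~ In x (vars G) -> is_bst F T1 -> is_bst G T2 ->
  is_bst (branch x F G) (Node x T1 T2).
Proof.
  intros HF HG H1 H2. constructor.
  - apply nil_branch.
  - eapply branch_var; eauto.
  - now rewrite branch_restrict_false.
  - now rewrite branch_restrict_true.
Qed.

Lemma branch_minbst x F G n m : ~ In x (vars F) -> ~ In x (vars G) -> minbst F n -> minbst G m ->
  minbst (branch x F G) (S (n + m)).
Proof.
  intros HF HG [(T1 & H1 & S1) L1] [(T2 & H2 & S2) L2]. split.
  - exists (Node x T1 T2). split; [now apply branch_upper|cbn; lia].
  - intros T HT. destruct (branch_lower x F G T HF HG HT) as (A & B & HA & HB & HS).
    specialize (L1 A HA). specialize (L2 B HB). lia.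
Qed.

(** A node branching on a variable of [F] leaves [G] unchanged. If one of its subtrees yields a tree
    for [G], that tree is taken; otherwise both yield trees for the restrictions of [F], and the
    node joins them. *)
Lemma union_lower F G T : (forall v, In v (vars F) -> In v (vars G) -> False) -> is_bst (F ++ G) T ->
  exists T', tree_size T' <= tree_size T /\ (is_bst F T' \/ is_bst G T').
Proof.
  revert F G. induction T as [|x T1 IH1 T2 IH2]; intros F G D H; inversion H as [F0 Hn|F0 x0 T10 T20 Hn Hx H1 H2]; subst.
  - exists Leaf. split; [lia|]. apply in_app_or in Hn as [Hn|Hn]; [left|right]; now constructor.
  - rewrite restrict_app in H1, H2.
    assert (DR : forall b v, In v (vars (restrict F [(x, b)])) -> In v (vars (restrict G [(x, b)])) -> False)
      by (intros b v Hv1 Hv2; apply vars_restrict in Hv1, Hv2; now apply (D v)).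
    destruct (IH1 _ _ (DR false) H1) as (A & SA & HA). destruct (IH2 _ _ (DR true) H2) as (B & SB & HB).
    assert (HnF : ~ In [] F) by (intros Hi; apply Hn, in_or_app; now left).
    assert (HnG : ~ In [] G) by (intros Hi; apply Hn, in_or_app; now right).
    rewrite vars_app in Hx. apply in_app_or in Hx as [Hx|Hx].
    + assert (HxG : ~ In x (vars G)) by (intros Hi; now apply (D x)).
      rewrite !(restrict_notin G) in * by exact HxG.
      destruct HA as [HA|HA]; [|exists A; cbn; split; [lia|now right]].
      destruct HB as [HB|HB]; [|exists B; cbn; split; [lia|now right]].
      exists (Node x A B). cbn. split; [lia|]. left. now constructor.
    + assert (HxF : ~ In x (vars F)) by (intros Hi; now apply (D x)).
      rewrite !(restrict_notin F) in * by exact HxF.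
      destruct HA as [HA|HA]; [exists A; cbn; split; [lia|now left]|].
      destruct HB as [HB|HB]; [exists B; cbn; split; [lia|now left]|].
      exists (Node x A B). cbn. split; [lia|]. right. now constructor.
Qed.

(** The condition on [G] keeps inner nodes legal: the empty clause must not be present where the
    tree for [F] still branches. *)
Lemma union_upper F G T : (forall v, In v (vars F) -> In v (vars G) -> False) -> ~ In [] G ->
  is_bst F T -> is_bst (F ++ G) T.
Proof.
  intros D HG H. revert D. induction H as [F H|F x T1 T2 Hn Hx H1 IH1 H2 IH2]; intros D.
  - constructor. apply in_or_app. now left.
  - assert (HxG : ~ In x (vars G)) by (intros Hi; now apply (D x)).
    constructor.
    + intros Hi. apply in_app_or in Hi as [Hi|Hi]; contradiction.
    + rewrite vars_app. apply in_or_app. now left.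
    + rewrite restrict_app, (restrict_notin G) by exact HxG. apply IH1.
      intros v Hv. apply vars_restrict in Hv. now apply D.
    + rewrite restrict_app, (restrict_notin G) by exact HxG. apply IH2.
      intros v Hv. apply vars_restrict in Hv. now apply D.
Qed.

Lemma union_upper_r F G T : (forall v, In v (vars F) -> In v (vars G) -> False) -> ~ In [] F ->
  is_bst G T -> is_bst (F ++ G) T.
Proof.
  intros D HF H. revert D. induction H as [G H|G x T1 T2 Hn Hx H1 IH1 H2 IH2]; intros D.
  - constructor. apply in_or_app. now right.
  - assert (HxF : ~ In x (vars F)) by (intros Hi; now apply (D x)).
    constructor.
    + intros Hi. apply in_app_or in Hi as [Hi|Hi]; contradiction.
    + rewrite vars_app. apply in_or_app. now right.
    + rewrite restrict_app, (restrict_notin F) by exact HxF. apply IH1.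
      intros v Hv Hv'. apply vars_restrict in Hv'. now apply (D v).
    + rewrite restrict_app, (restrict_notin F) by exact HxF. apply IH2.
      intros v Hv Hv'. apply vars_restrict in Hv'. now apply (D v).
Qed.

(** A satisfiable [F] has no search tree, so [union_lower] can only return a tree for [H]. For an
    unsatisfiable [F], branching on [F] alone gives the small bound. *)
Lemma union_minbst F H h : (forall v, In v (vars F) -> In v (vars H) -> False) -> ~ In [] H ->
  minbst H h -> exists n, minbst (F ++ H) n /\ ((exists A, sat A F) -> n = h) /\
    ((forall A, ~ sat A F) -> S n <= 2 ^ length (vars F)).
Proof.
  intros D HH M0. pose proof M0 as [(T & HT & ST) L].
  assert (HT' : exists T', is_bst (F ++ H) T').
  { destruct (classic (In [] F)) as [HF|HF].
    - exists Leaf. constructor. apply in_or_app. now left.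
    - exists T. now apply union_upper_r. }
  destruct HT' as [T' HT'].
  destruct (minbst_exists _ _ HT') as (n & _ & M). exists n. split; [exact M|]. split.
  - intros (A & HA). destruct M as [(T0 & H0 & S0) M].
    destruct (union_lower F H T0 D H0) as (T1 & S1 & [H1|H1]).
    + exfalso. eapply bst_unsat; eauto.
    + specialize (L T1 H1).
      assert (HF : ~ In [] F) by (intros Hi; destruct (HA [] Hi) as (l & [] & _)).
      specialize (M T (union_upper_r F H T D HF HT)). lia.
  - intros HU. destruct (unsat_bst F HU) as (T1 & H1 & S1). destruct M as [_ M].
    specialize (M T1 (union_upper F H T1 D HH H1)). lia.
Qed.

Fixpoint chain (x : nat -> nat) (k : nat) (l : list cnf) (base : cnf) : cnf :=
  match l with
  | [] => base
  | F :: l => branch (x k) F (chain x (S k) l base)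
  end.

Lemma vars_chain x l base v : forall k, In v (vars (chain x k l base)) ->
  (exists j, k <= j /\ v = x j) \/ (exists F, In F l /\ In v (vars F)) \/ In v (vars base).
Proof.
  induction l as [|F l IH]; intros k H; [auto|]. cbn [chain] in H.
  apply vars_branch in H as [->|[H|H]]; [left; now exists k|right; left; exists F; cbn; auto|].
  apply IH in H as [(j & Hj & ->)|[(G & HG & H)|H]].
  - left. exists j. split; [lia|reflexivity].
  - right. left. exists G. cbn. auto.
  - auto.
Qed.

(** Only the selectors have to be fresh: the items may share variables among each other and with the
    base. *)
Lemma chain_minbst x l base b : (forall i j, x i = x j -> i = j) ->
  (forall F k, In F l -> ~ In (x k) (vars F)) -> (forall k, ~ In (x k) (vars base)) ->
  minbst base b -> forall k ns, Forall2 minbst l ns ->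
  minbst (chain x k l base) (list_sum (map S ns) + b).
Proof.
  intros Hx HF HB Hb. induction l as [|F l IH]; intros k ns H; inversion H as [|F0 n l0 ns0 Hn Hns]; subst; [exact Hb|].
  cbn. rewrite <- Nat.add_assoc. apply branch_minbst; [apply HF; now left| |exact Hn|].
  - intros Hk. apply vars_chain in Hk as [(j & Hj & E)|[(G & HG & Hv)|Hv]].
    + apply Hx in E. lia.
    + eapply HF; [right; exact HG|exact Hv].
    + now apply HB in Hv.
  - apply IH; [|exact Hns]. intros G j HG. apply HF. now right.
Qed.

(* With root [x], a tree that falls back on [G] in one of its subtrees is larger than a tree for [G] alone. *)
Lemma obv_union x F1 F2 G n1 n2 m : ~ In x (vars F1) -> ~ In x (vars F2) ->
  (forall v, In v (vars (branch x F1 F2)) -> In v (vars G) -> False) -> ~ In [] G ->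
  minbst F1 n1 -> minbst F2 n2 -> minbst G m ->
  (OBV (branch x F1 F2 ++ G) x <-> S (n1 + n2) <= m).
Proof.
  intros H1 H2 D HG M1 M2 MG.
  pose proof (branch_minbst x F1 F2 n1 n2 H1 H2 M1 M2) as MB.
  destruct M1 as [(T1 & HT1 & S1) L1]. destruct M2 as [(T2 & HT2 & S2) L2]. destruct MG as [(TG & HTG & SG) LG].
  split.
  - intros (U1 & U2 & HU & LU).
    pose proof (LU TG (union_upper_r _ _ TG D (nil_branch _ _ _) HTG)) as LT.
    inversion HU as [|F0 x0 A B Hn Hx HA HB]; subst.
    rewrite restrict_app in HA, HB.
    assert (HxB : In x (vars (branch x F1 F2))) by (eapply branch_var; eauto).
    assert (HxG : ~ In x (vars G)) by (intros Hi; now apply (D x)).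
    rewrite branch_restrict_false, (restrict_notin G) in HA by assumption.
    rewrite branch_restrict_true, (restrict_notin G) in HB by assumption.
    assert (DV : forall F v, (forall v, In v (vars F) -> v <> x -> In v (vars (branch x F1 F2))) -> ~ In x (vars F) ->
              In v (vars F) -> In v (vars G) -> False).
    { intros F v HF HxF Hv HvG. apply (D v); [apply HF; [exact Hv|congruence]|exact HvG]. }
    destruct (union_lower F1 G U1) as (V1 & SV1 & HV1); [|exact HA|].
    { intros v. apply DV; [|exact H1]. intros u Hu _. unfold branch. rewrite vars_app. apply in_or_app. left.
      apply in_vars in Hu as (C & b & HC & Hu). apply in_vars. exists ((x, true) :: C), b.
      split; [now apply in_map|now right]. }
    destruct (union_lower F2 G U2) as (V2 & SV2 & HV2); [|exact HB|].
    { intros v. apply DV; [|exact H2]. intros u Hu _. unfold branch. rewrite vars_app. apply in_or_app. right.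
      apply in_vars in Hu as (C & b & HC & Hu). apply in_vars. exists ((x, false) :: C), b.
      split; [now apply in_map|now right]. }
    cbn in LT. destruct HV1 as [HV1|HV1]; [|specialize (LG V1 HV1); lia].
    destruct HV2 as [HV2|HV2]; [|specialize (LG V2 HV2); lia].
    specialize (L1 V1 HV1). specialize (L2 V2 HV2). lia.
  - intros Hle. exists T1, T2. split.
    + apply union_upper; auto. now apply branch_upper.
    + intros T HT. destruct (union_lower _ _ T D HT) as (V & SV & [HV|HV]); cbn.
      * pose proof (proj2 MB V HV). lia.
      * specialize (LG V HV). lia.
Qed.

(** * The pigeonhole principle *)

(* [p i j] says that pigeon [i] sits in hole [j]. *)
Inductive php_clause (p : nat -> nat -> nat) (K : nat) : clause -> Prop :=
| php_wide i C : (forall l, In l C <-> exists j, j < K /\ l = (p i j, true)) -> php_clause p K C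
| php_pair i i' j : i <> i' -> php_clause p K [(p i j, false); (p i' j, false)].

Lemma NoDup_remove_length (js : list nat) r j : NoDup js -> length js = S r ->
  exists js', NoDup js' /\ length js' = r /\ incl js' js /\ ~ In j js'.
Proof.
  intros N L. destruct (in_dec Nat.eq_dec j js) as [H|H].
  - apply in_split in H as (l1 & l2 & ->). exists (l1 ++ l2).
    split; [eapply NoDup_remove_1; eauto|]. split.
    + rewrite length_app in *. cbn in L. lia.
    + split; [|now apply NoDup_remove_2]. intros x Hx. apply in_app_or in Hx. apply in_or_app. cbn. tauto.
  - destruct js as [|a js]; [discriminate|]. exists js. inversion N; subst. cbn in L.
    split; [assumption|split; [lia|split; [intros x; now right|]]]. intros Hj. apply H. now right.
Qed.

Definition taken (rho : nat -> nat -> option bool) (j : nat) : Prop := exists i, rho i j = Some true.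

(* [G] is the restriction by the partial assignment [rho] of pigeonhole clauses; every unmatched pigeon has [r]
   open holes. *)
Record php_state (p : nat -> nat -> nat) (K r : nat) (rho : nat -> nat -> option bool) (G : cnf) : Prop := {
  ps_clause : forall C, In C G -> exists C0, php_clause p K C0 /\
    (forall l, In l C -> In l C0) /\
    (forall i j b, In (p i j, b) C0 -> (rho i j = None -> In (p i j, b) C) /\ rho i j <> Some b);
  ps_none : forall C i j b, In C G -> In (p i j, b) C -> rho i j = None;
  ps_hole : forall i i' j, rho i j = Some true -> rho i' j = Some true -> i = i';
  ps_open : forall i, (exists j, j < K /\ rho i j = Some true) \/
    exists js, NoDup js /\ length js = r /\ forall j, In j js -> j < K /\ ~ taken rho j /\ rho i j = None
}.

Definition assign (rho : nat -> nat -> option bool) i0 j0 b : nat -> nat -> option bool :=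
  fun i j => if (i =? i0) && (j =? j0) then Some b else rho i j.

Lemma assign_cases rho i0 j0 b i j :
  (i = i0 /\ j = j0 /\ assign rho i0 j0 b i j = Some b) \/
  ((i <> i0 \/ j <> j0) /\ assign rho i0 j0 b i j = rho i j).
Proof.
  unfold assign. destruct (Nat.eqb_spec i i0); destruct (Nat.eqb_spec j j0); cbn; tauto.
Qed.

Lemma php_clause_var p K C v b : php_clause p K C -> In (v, b) C -> exists i j, v = p i j.
Proof.
  intros [i D H|i i' j Hi] Hv.
  - apply H in Hv as (j & _ & E). inversion E. eauto.
  - destruct Hv as [E|[E|[]]]; inversion E; eauto.
Qed.

Section php_lower.
Variables (p : nat -> nat -> nat) (K : nat).
Hypothesis p_inj : forall i j i' j', p i j = p i' j' -> i = i' /\ j = j'.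

(** The new value only has to respect occupied holes. The count of open holes is left to the caller,
    because it is the part in which the two kinds of branching differ. *)
Lemma php_step r r' rho G i0 j0 b : php_state p K r rho G -> rho i0 j0 = None ->
  (b = true -> ~ taken rho j0) ->
  (forall i, (exists j, j < K /\ assign rho i0 j0 b i j = Some true) \/
     exists js, NoDup js /\ length js = r' /\
       forall j, In j js -> j < K /\ ~ taken (assign rho i0 j0 b) j /\ assign rho i0 j0 b i j = None) ->
  php_state p K r' (assign rho i0 j0 b) (restrict G [(p i0 j0, b)]).
Proof.
  intros [PC PN PH PO] Hn Ht Ho. split; [| | |exact Ho].
  - intros D HD. apply in_restrict in HD as (C & HC & Hx & ->).
    destruct (PC C HC) as (C0 & H0 & H1 & H2). exists C0. split; [exact H0|]. split.
    + intros l Hl. apply in_red in Hl as [Hl _]. auto.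
    + intros i j c Hc. destruct (H2 i j c Hc) as [H3 H4].
      destruct (assign_cases rho i0 j0 b i j) as [(-> & -> & ->)|[Hij ->]].
      * split; [discriminate|]. intros E. inversion E; subst. apply Hx. auto.
      * split; [|exact H4]. intros N. apply in_red. split; [auto|]. intros E. inversion E.
        destruct (p_inj i j i0 j0); [congruence|]. tauto.
  - intros D i j c HD Hc. apply in_restrict in HD as (C & HC & Hx & ->). apply in_red in Hc as [Hc Hc'].
    destruct (assign_cases rho i0 j0 b i j) as [(-> & -> & ->)|[Hij ->]]; [|eapply PN; eauto].
    exfalso. destruct (bool_dec c b) as [->|Hb]; [contradiction|]. apply Hc'. f_equal.
    destruct c, b; cbn; congruence.
  - intros i i' j H1 H2.
    destruct (assign_cases rho i0 j0 b i j) as [(E3 & E4 & E1)|[Hij E1]];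
      destruct (assign_cases rho i0 j0 b i' j) as [(E5 & E6 & E2)|[Hij' E2]]; rewrite E1 in H1; rewrite E2 in H2.
    + congruence.
    + exfalso. subst. inversion H1. apply Ht; [assumption|]. now exists i'.
    + exfalso. subst. inversion H2. apply Ht; [assumption|]. now exists i.
    + eapply PH; eauto.
Qed.

Lemma taken_assign rho i0 j0 b j : taken (assign rho i0 j0 b) j -> taken rho j \/ (j = j0 /\ b = true).
Proof.
  intros (i & H). destruct (assign_cases rho i0 j0 b i j) as [(-> & -> & E)|[_ E]]; rewrite E in H.
  - right. split; congruence.
  - left. now exists i.
Qed.

Lemma php_lower_state T : forall r rho G, php_state p K r rho G -> is_bst G T -> 2 ^ r <= S (tree_size T).
Proof.
  induction T as [|x T1 IH1 T2 IH2]; intros r rho G HS HT; inversion HT as [F0 Hn|F0 x0 A B Hn Hx HA HB]; subst.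
  (* With [r > 0] no clause can be empty: the clause of a matched pigeon is satisfied, that of
     another pigeon keeps an open hole, and an empty pair clause would mean two pigeons in one
     hole. *)
  - destruct r as [|r]; [cbn; lia|]. exfalso. destruct HS as [PC PN PH PO].
    destruct (PC [] Hn) as (C0 & [i D HD|i i' j Hi] & _ & H2).
    + destruct (PO i) as [(j & Hj & E)|(js & N & L & Hjs)].
      * destruct (H2 i j true) as [_ H3]; [apply HD; eauto|]. contradiction.
      * destruct js as [|j js]; [discriminate|]. destruct (Hjs j) as (Hj & _ & E); [now left|].
        destruct (H2 i j true) as [H3 _]; [apply HD; eauto|]. destruct (H3 E).
    + assert (E1 : rho i j = Some true).
      { destruct (H2 i j false) as [H3 H4]; [now left|]. destruct (rho i j) as [[]|]; [reflexivity|congruence|].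
        destruct (H3 eq_refl). }
      assert (E2 : rho i' j = Some true).
      { destruct (H2 i' j false) as [H3 H4]; [right; now left|]. destruct (rho i' j) as [[]|]; [reflexivity|congruence|].
        destruct (H3 eq_refl). }
      apply Hi. eapply PH; eauto.
  - pose proof HS as [PC PN PH PO].
    apply in_vars in Hx as (C & b & HC & Hb).
    assert (exists i0 j0, x = p i0 j0) as (i0 & j0 & ->).
    { destruct (PC C HC) as (C0 & H0 & H1 & _). eapply php_clause_var; eauto. }
    assert (Hn0 : rho i0 j0 = None) by (eapply PN; eauto).
    destruct (classic ((exists j, j < K /\ rho i0 j = Some true) \/ taken rho j0)) as [HM|HM].
    (* Pigeon [i0] is matched or hole [j0] is occupied, so the false branch closes no open hole of
       an unmatched pigeon. It keeps [r], and the other subtree is dropped. *)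
    + assert (HS' : php_state p K r (assign rho i0 j0 false) (restrict G [(p i0 j0, false)])).
      { eapply php_step; [exact HS|exact Hn0|discriminate|]. intros i.
        destruct (PO i) as [(j & Hj & E)|(js & N & L & Hjs)].
        - left. exists j. split; [exact Hj|]. destruct (assign_cases rho i0 j0 false i j) as [(-> & -> & _)|[_ ->]]; congruence.
        - destruct (classic (exists j, j < K /\ assign rho i0 j0 false i j = Some true)) as [|NM]; [now left|right].
          exists js. split; [exact N|split; [exact L|]]. intros j Hj. destruct (Hjs j Hj) as (Hj1 & Hj2 & Hj3).
          split; [exact Hj1|split].
          + intros HT'. apply taken_assign in HT' as [|[_ E]]; [contradiction|discriminate].
          + destruct (assign_cases rho i0 j0 false i j) as [(-> & -> & _)|[_ ->]]; [|exact Hj3].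
            exfalso. destruct HM as [(j & Hj' & E)|HM]; [|contradiction]. apply NM. exists j.
            split; [exact Hj'|]. destruct (assign_cases rho i0 j0 false i0 j) as [(_ & -> & _)|[_ ->]]; congruence. }
      specialize (IH1 _ _ _ HS' HA). cbn. lia.
    (* Now both values are consistent, and either one can take only [j0] away from the open holes of
       a pigeon; both subtrees count, with [r] reduced by one. *)
    + destruct r as [|r]; [cbn; lia|].
      assert (HS' : forall b, php_state p K r (assign rho i0 j0 b) (restrict G [(p i0 j0, b)])).
      { intros c. eapply php_step; [exact HS|exact Hn0|tauto|]. intros i.
        destruct (PO i) as [(j & Hj & E)|(js & N & L & Hjs)].
        - left. exists j. split; [exact Hj|]. destruct (assign_cases rho i0 j0 c i j) as [(-> & -> & _)|[_ ->]]; congruence.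
        - right. destruct (NoDup_remove_length js r j0 N L) as (js' & N' & L' & I' & J').
          exists js'. split; [exact N'|split; [exact L'|]]. intros j Hj. destruct (Hjs j (I' j Hj)) as (Hj1 & Hj2 & Hj3).
          split; [exact Hj1|split].
          + intros HT'. apply taken_assign in HT' as [|[-> _]]; contradiction.
          + destruct (assign_cases rho i0 j0 c i j) as [(-> & -> & _)|[_ ->]]; [contradiction|exact Hj3]. }
      specialize (IH1 _ _ _ (HS' false) HA). specialize (IH2 _ _ _ (HS' true) HB). cbn. lia.
Qed.

Lemma php_lower F T : (forall C, In C F -> php_clause p K C) -> is_bst F T -> 2 ^ K <= S (tree_size T).
Proof.
  intros HF HT. apply (php_lower_state T K (fun _ _ => None) F); [|exact HT]. split.
  - intros C HC. exists C. split; [auto|split; [auto|]]. split; [auto|discriminate].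
  - reflexivity.
  - discriminate.
  - intros i. right. exists (seq 0 K). split; [apply seq_NoDup|split; [apply length_seq|]].
    intros j Hj. apply in_seq in Hj. split; [lia|split; [|reflexivity]]. intros (i' & E). discriminate.
Qed.

End php_lower.

Lemma pigeonhole (R : nat -> nat -> Prop) K :
  (forall i, i <= K -> exists j, j < K /\ R i j) ->
  (forall i i' j, i < i' <= K -> j < K -> R i j -> R i' j -> False) -> False.
Proof.
  intros H1 H2.
  assert (H : forall n, n <= S K -> exists js, length js = n /\ NoDup js /\
     forall j, In j js -> j < K /\ exists i, i < n /\ R i j).
  { induction n as [|n IH]; intros Hn; [exists []; split; [reflexivity|split; [constructor|intros j []]]|].
    destruct IH as (js & L & N & Hjs); [lia|]. destruct (H1 n) as (j & Hj & Rj); [lia|].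
    exists (j :: js). split; [cbn; lia|split].
    - constructor; [|exact N]. intros Hi. destruct (Hjs j Hi) as (_ & i & Hi' & Ri). apply (H2 i n j); auto; lia.
    - intros j' [<-|Hj']; [split; [exact Hj|exists n; auto]|].
      destruct (Hjs j' Hj') as (Hk & i & Hi & Ri). split; [exact Hk|exists i; split; [lia|exact Ri]]. }
  destruct (H (S K) (le_n _)) as (js & L & N & Hjs).
  assert (HL : length js <= length (seq 0 K)).
  { apply NoDup_incl_length; [exact N|]. intros j Hj. apply in_seq. destruct (Hjs j Hj). lia. }
  rewrite length_seq in HL. lia.
Qed.

(** * Tableaux *)

(* Input length, running times of the oracle machine and of the verifiers, size of the pigeonhole formula,
   threshold; the other registers are loop variables. *)
Notation rn := 0 (only parsing).
Notation rT := 1 (only parsing).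
Notation rN := 2 (only parsing).
Notation rK := 3 (only parsing).
Notation rk := 4 (only parsing).
Notation rj := 5 (only parsing).
Notation r0 := 6 (only parsing).
Notation rt := 7 (only parsing).
Notation ri := 8 (only parsing).
Notation rd := 9 (only parsing).
Notation rv := 10 (only parsing).
Notation ru := 11 (only parsing).
Notation rl := 12 (only parsing).
Notation rp := 13 (only parsing).
Notation rx := 14 (only parsing).

Definition con (c : nat) : lin := ([], c).
Definition var (x : nat) : lin := ([x], 0).
Definition var1 (x : nat) : lin := ([x], 1).

(* [s] tells apart the two halves of the final formula, [p] is the number of a run, [t] a time, [i] and [j]
   are tape positions. [aVal] holds the interval [v, v + u) of [value] below, [aAns] a guessed answer,
   [aBit] and [aEnd] a guessed certificate. *)
Definition aHead (s : nat) (p t i : lin) (q : nat) : list lin := [con s; con 0; p; t; i; con q].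
Definition aCell (s : nat) (p t i : lin) (a : nat) : list lin := [con s; con 1; p; t; i; con a].
Definition aVal (s : nat) (t v u : lin) : list lin := [con s; con 2; t; v; u].
Definition aAns (s : nat) (t : lin) : list lin := [con s; con 3; t].
Definition aLink (s : nat) (t j i : lin) : list lin := [con s; con 4; t; j; i].
Definition aCert (s : nat) (t j i : lin) : list lin := [con s; con 5; t; j; i].
Definition aBlank (s : nat) (t j : lin) : list lin := [con s; con 6; t; j].
Definition aBit (s : nat) (t j : lin) : list lin := [con s; con 7; t; j].
Definition aEnd (s : nat) (t j : lin) : list lin := [con s; con 8; t; j].

Definition lits (ls : list (bool * list lin)) : pt :=
  fold_right (fun l p => PSeq (PLit (fst l) (snd l)) p) PNil ls.
Definition cl (ls : list (bool * list lin)) : sch := SClause (lits ls).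
Definition seqs (l : list sch) : sch := fold_right SSeq SNil l.

Definition scode (a : sym) : nat := match a with None => 0 | Some false => 1 | Some true => 2 end.

(** Halting states become fixed points, so that a verdict can be read at any later time, and a query
    takes its answer from a guess in place of an oracle. *)
Definition qstep (M : TM) (q : nat) (a : sym) (ans : bool) : nat * sym * move :=
  if (q =? q_acc) || (q =? q_rej) then (q, a, MStay)
  else if q =? q_query then (if ans then q_yes else q_no, a, MStay)
  else delta M q a.

Definition newpos (m : move) (i : nat) : nat :=
  match m with MStay => i | MRight => i + 1 | MLeft => pred i end.

(* Run number 0 is the run of the oracle machine; run number [t + 1] is the run of the verifier for a query
   that is asked at time [t] and answered positively. *)
Definition prefix (main : bool) : lin := if main then con 0 else var1 r0.
(** In clause form a hypothesis changes its sign, so the positive answer comes with a negative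
    literal. A verifier run knows only the answer [false], in accordance with [no_oracle]. *)
Definition extra (s : nat) (main : bool) : list (bool * list (bool * list lin)) :=
  if main then [(true, [(false, aAns s (var rt))]); (false, [(true, aAns s (var rt))])] else [(false, [])].

Definition rule (s : nat) (main : bool) (q : nat) (a : sym) (ex : list (bool * list lin)) (x : nat * sym * move) : sch :=
  let '(q', b, m) := x in
  let p := prefix main in
  let both i i' :=
    let hyp := (false, aHead s p (var rt) i q) :: (false, aCell s p (var rt) i (scode a)) :: ex in
    SSeq (cl (hyp ++ [(true, aHead s p (var1 rt) i' q')])) (cl (hyp ++ [(true, aCell s p (var1 rt) i (scode b))])) in
  match m with
  | MStay => SFor ri rN (both (var ri) (var ri))
  | MRight => SFor ri rN (both (var ri) (var1 ri))
  | MLeft => SSeq (both (con 0) (con 0)) (SFor ri rN (both (var1 ri) (var ri)))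
  end.

(** Two distinct positions are written as [ri] and [ri + rd + 1], in either role, because the scheme
    language has no test for inequality. *)
Definition frame (s : nat) (main : bool) (q : nat) (a : sym) : sch :=
  let p := prefix main in
  let far := ([ri; rd], 1) in
  SFor ri rN (SFor rd rN
    (SSeq (cl [(false, aHead s p (var rt) (var ri) q); (false, aCell s p (var rt) far (scode a));
               (true, aCell s p (var1 rt) far (scode a))])
          (cl [(false, aHead s p (var rt) far q); (false, aCell s p (var rt) (var ri) (scode a));
               (true, aCell s p (var1 rt) (var ri) (scode a))]))).

Definition all_syms : list sym := [None; Some false; Some true].

(** All clauses are implications forward in time. Nothing excludes further heads or symbols: a
    conflict with the negative clauses of [S_verdict] and [S_threshold] arises from the atoms forced
    by the run alone. *)
Definition trans (s : nat) (main : bool) (M : TM) : sch :=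
  seqs (flat_map (fun q => flat_map (fun a =>
    frame s main q a :: map (fun e => rule s main q a (snd e) (qstep M q a (fst e))) (extra s main))
      all_syms) (seq 0 (nst M))).

Lemma leval_con r c : leval r (con c) = c.
Proof. reflexivity. Qed.

Lemma leval_var r x : leval r (var x) = r x.
Proof. unfold leval, var. cbn. lia. Qed.

Lemma leval_var1 r x : leval r (var1 x) = r x + 1.
Proof. unfold leval, var1. cbn. lia. Qed.

Lemma leval_two r x y c : leval r ([x; y], c) = r x + r y + c.
Proof. unfold leval. cbn. lia. Qed.

Ltac ev := unfold cl, lits, aHead, aCell, aVal, aAns, aLink, aCert, aBlank, aBit, aEnd, prefix;
  cbn [ssem psem fold_right fst snd map app]; unfold atom; cbn [map];
  rewrite ?leval_con, ?leval_var, ?leval_var1, ?leval_two;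
  repeat rewrite upd_other by discriminate; rewrite ?upd_same.

Tactic Notation "ev" "in" hyp(H) :=
  unfold cl, lits, aHead, aCell, aVal, aAns, aLink, aCert, aBlank, aBit, aEnd, prefix in H;
  cbn [ssem psem fold_right fst snd map app] in H; unfold atom in H; cbn [map] in H;
  rewrite ?leval_con, ?leval_var, ?leval_var1, ?leval_two in H;
  repeat rewrite upd_other in H by discriminate; rewrite ?upd_same in H.

Lemma ssem_seqs A w l r : ssem A w (seqs l) r <-> forall s, In s l -> ssem A w s r.
Proof.
  induction l as [|s l IH]; cbn; [firstorder|]. rewrite IH. firstorder congruence.
Qed.

Definition run_index (main : bool) (r : nat -> nat) : nat := if main then 0 else r r0 + 1.

Definition ans_ok (A : list nat -> Prop) (s : nat) (main : bool) (t : nat) (ans : bool) : Prop :=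
  if main then (if ans then A [s; 3; t] else ~ A [s; 3; t]) else ans = false.

Lemma trans_sound A w s main M r q a i ans : ssem A w (trans s main M) r ->
  q < nst M -> i < r rN -> ans_ok A s main (r rt) ans ->
  A [s; 0; run_index main r; r rt; i; q] -> A [s; 1; run_index main r; r rt; i; scode a] ->
  let '(q', b, m) := qstep M q a ans in
  A [s; 0; run_index main r; r rt + 1; newpos m i; q'] /\ A [s; 1; run_index main r; r rt + 1; i; scode b].
Proof.
  intros H Hq Hi Ha H1 H2.
  assert (He : exists ex, In (ans, ex) (extra s main)).
  { destruct main; cbn in *; [destruct ans; eauto|subst; eauto]. }
  destruct He as [ex He].
  assert (HR : ssem A w (rule s main q a ex (qstep M q a ans)) r).
  { unfold trans in H. rewrite ssem_seqs in H. apply H. apply in_flat_map. exists q. split; [apply in_seq; lia|].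
    apply in_flat_map. exists a. split; [destruct a as [[]|]; cbn; auto|]. right.
    apply in_map_iff. exists (ans, ex). auto. }
  clear H. destruct (qstep M q a ans) as [[q' b] m].
  assert (HB : main = true /\ (ans = true /\ ex = [(false, aAns s (var rt))] \/ ans = false /\ ex = [(true, aAns s (var rt))])
     \/ main = false /\ ex = []).
  { destruct main; cbn in He; [left; split; [reflexivity|]|right].
    - destruct He as [E|[E|[]]]; inversion E; auto.
    - destruct He as [E|[]]; inversion E; auto. }
  clear He. unfold rule in HR.
  destruct m; [destruct i as [|i]; [destruct HR as [HR _]|destruct HR as [_ HR]; specialize (HR i ltac:(lia))]|
    specialize (HR i Hi)|specialize (HR i Hi)];
    destruct HB as [[-> [[-> ->]|[-> ->]]]|[-> ->]]; cbn in Ha, H1, H2 |- *;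
    ev in HR; cbn [newpos pred] in *; rewrite ?Nat.add_1_r in *; tauto.
Qed.

Lemma frame_sound A w s main M r q a i j : ssem A w (trans s main M) r ->
  q < nst M -> i < r rN -> j < r rN -> j <> i ->
  A [s; 0; run_index main r; r rt; i; q] -> A [s; 1; run_index main r; r rt; j; scode a] ->
  A [s; 1; run_index main r; r rt + 1; j; scode a].
Proof.
  intros H Hq Hi Hj Hij H1 H2.
  assert (HR : ssem A w (frame s main q a) r).
  { unfold trans in H. rewrite ssem_seqs in H. apply H. apply in_flat_map. exists q. split; [apply in_seq; lia|].
    apply in_flat_map. exists a. split; [destruct a as [[]|]; cbn; auto|]. now left. }
  clear H. unfold frame in HR. destruct (Nat.lt_ge_cases i j) as [L|L].
  - specialize (HR i Hi (j - i - 1)). destruct HR as [HR _]; [rewrite upd_other by discriminate; lia|].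
    destruct main; ev in HR; cbn in *; replace (i + (j - i - 1) + 1) with j in HR by lia; tauto.
  - specialize (HR j Hj (i - j - 1)). destruct HR as [_ HR]; [rewrite upd_other by discriminate; lia|].
    destruct main; ev in HR; cbn in *; replace (j + (i - j - 1) + 1) with i in HR by lia; tauto.
Qed.

Lemma trans_complete A w s main M r :
  (forall q a i ans, ans_ok A s main (r rt) ans ->
    A [s; 0; run_index main r; r rt; i; q] -> A [s; 1; run_index main r; r rt; i; scode a] ->
    let '(q', b, m) := qstep M q a ans in
    A [s; 0; run_index main r; r rt + 1; newpos m i; q'] /\ A [s; 1; run_index main r; r rt + 1; i; scode b]) ->
  (forall q a i j, j <> i ->
    A [s; 0; run_index main r; r rt; i; q] -> A [s; 1; run_index main r; r rt; j; scode a] ->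
    A [s; 1; run_index main r; r rt + 1; j; scode a]) ->
  ssem A w (trans s main M) r.
Proof.
  intros HR HF. unfold trans. rewrite ssem_seqs. intros x Hx.
  apply in_flat_map in Hx as (q & _ & Hx). apply in_flat_map in Hx as (a & _ & [<-|Hx]).
  - unfold frame. intros i _ d _. specialize (HF q a).
    pose proof (HF i (i + d + 1) ltac:(lia)) as H1. pose proof (HF (i + d + 1) i ltac:(lia)) as H2.
    destruct main; ev; cbn in *; tauto.
  - apply in_map_iff in Hx as ([ans ex] & <- & He). cbn [fst snd]. specialize (HR q a).
    destruct (qstep M q a ans) as [[q' b] m] eqn:E.
    assert (HB : main = true /\ (ans = true /\ ex = [(false, aAns s (var rt))] \/ ans = false /\ ex = [(true, aAns s (var rt))])
       \/ main = false /\ ans = false /\ ex = []).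
    { destruct main; cbn in He; [left; split; [reflexivity|]|right].
      - destruct He as [E'|[E'|[]]]; inversion E'; auto.
      - destruct He as [E'|[]]; inversion E'; auto. }
    clear He. assert (HR' := fun i => HR i ans). clear HR. rewrite E in HR'.
    unfold rule. destruct m; [split; [specialize (HR' 0)|intros i _; specialize (HR' (i + 1))]|
      intros i _; specialize (HR' i)|intros i _; specialize (HR' i)];
    destruct HB as [[-> [[-> ->]|[-> ->]]]|[-> [-> ->]]]; cbn in HR'; ev; cbn [newpos] in *;
    rewrite ?Nat.add_1_r in *; cbn [pred] in *; tauto.
Qed.

(** * Runs and their values *)

Definition cstep (M : TM) (ans : bool) (c : config) : config :=
  let '(q', b, m) := qstep M (cst c) (ccur c) ans in
  let '(l, a, r) := apply_move m (cleft c) b (cright c) in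
  mkconf q' l a r.

Definition pos (c : config) : nat := length (cleft c).
Definition cells (c : config) : list sym := rev (cleft c) ++ ccur c :: cright c.
Definition tapef (c : config) (j : nat) : sym := nth j (cells c) None.

Fixpoint run (M : TM) (ans : nat -> bool) (c : config) (t : nat) : config :=
  match t with
  | 0 => c
  | S t => cstep M (ans t) (run M ans c t)
  end.

Lemma tapef_pos c : tapef c (pos c) = ccur c.
Proof.
  unfold tapef, cells, pos. rewrite app_nth2; rewrite length_rev; [|lia].
  now rewrite Nat.sub_diag.
Qed.

Lemma nth_app_cons {A} (u r : list A) b b' d j : j <> length u ->
  nth j (u ++ b :: r) d = nth j (u ++ b' :: r) d.
Proof.
  intros H. destruct (Nat.lt_ge_cases j (length u)).
  - now rewrite !app_nth1.
  - rewrite !app_nth2 by lia. destruct (j - length u) as [|n] eqn:E; [lia|]. reflexivity.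
Qed.

Lemma cstep_spec M ans c : let '(q', b, m) := qstep M (cst c) (ccur c) ans in
  cst (cstep M ans c) = q' /\ pos (cstep M ans c) = newpos m (pos c) /\
  tapef (cstep M ans c) (pos c) = b /\ (forall j, j <> pos c -> tapef (cstep M ans c) j = tapef c j).
Proof.
  unfold cstep. destruct (qstep M (cst c) (ccur c) ans) as [[q' b] m].
  destruct c as [q l a r]. cbn [cst cleft ccur cright] in *.
  assert (HS : forall l' a' r', (forall j, nth j (rev l' ++ a' :: r') None = nth j (rev l ++ b :: r) None) ->
     tapef (mkconf q' l' a' r') (length l) = b /\
     forall j, j <> length l -> tapef (mkconf q' l' a' r') j = tapef (mkconf q l a r) j).
  { intros l' a' r' H. unfold tapef, cells. cbn [cleft ccur cright]. split.
    - rewrite H, app_nth2; rewrite length_rev; [|lia]. now rewrite Nat.sub_diag.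
    - intros j Hj. rewrite H. apply nth_app_cons. now rewrite length_rev. }
  destruct m; [destruct l as [|x l]|destruct r as [|x r]|]; cbn [apply_move];
    (split; [reflexivity|split; [unfold pos; cbn; lia|unfold pos; cbn [cleft]; apply HS; intros j]]).
  - reflexivity.
  - cbn [rev]. now rewrite <- app_assoc.
  (* A move beyond the right end stores an explicit blank, which agrees with the default value of
     [nth]. *)
  - cbn [rev]. rewrite <- app_assoc. cbn [app]. destruct (Nat.lt_ge_cases j (length (rev l ++ [b]))).
    + change (rev l ++ [b; None]) with (rev l ++ [b] ++ [None]). rewrite app_assoc, app_nth1 by assumption. reflexivity.
    + rewrite (nth_overflow (rev l ++ [b])) by assumption.
      change (rev l ++ [b; None]) with (rev l ++ [b] ++ [None]). rewrite app_assoc, app_nth2 by assumption.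
      destruct (j - _) as [|[|]]; reflexivity.
  - cbn [rev]. now rewrite <- app_assoc.
  - reflexivity.
Qed.

Lemma cstep_nst M ans c : cst c < nst M -> cst (cstep M ans c) < nst M.
Proof.
  intros H. pose proof (cstep_spec M ans c) as HS. destruct (qstep M (cst c) (ccur c) ans) as [[q' b] m] eqn:E.
  destruct HS as [-> _]. unfold qstep in E. pose proof (nst_ge M).
  destruct ((cst c =? q_acc) || (cst c =? q_rej)); [inversion E; subst; exact H|].
  destruct (cst c =? q_query).
  - inversion E. subst. destruct ans; unfold q_yes, q_no; lia.
  - pose proof (delta_ok M (cst c) (ccur c) H) as D. rewrite E in D. exact D.
Qed.

Lemma run_nst M ans c t : cst c < nst M -> cst (run M ans c t) < nst M.
Proof. intros H. induction t; cbn; [exact H|now apply cstep_nst]. Qed.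

Lemma run_pos M ans c t : pos c = 0 -> pos (run M ans c t) <= t.
Proof.
  intros H. induction t as [|t IH]; cbn [run]; [lia|].
  pose proof (cstep_spec M (ans t) (run M ans c t)) as HS. destruct (qstep _ _ _ _) as [[q' b] m].
  destruct HS as (_ & -> & _). destruct m; cbn; lia.
Qed.

Lemma cstep_cells M ans c : length (cells (cstep M ans c)) <= S (length (cells c)).
Proof.
  unfold cstep, cells. destruct (qstep M (cst c) (ccur c) ans) as [[q' b] m].
  destruct c as [q l a r]. cbn [cleft ccur cright].
  destruct m; [destruct l as [|x l]|destruct r as [|x r]|]; cbn;
    rewrite ?length_app, ?length_rev; cbn; rewrite ?length_app, ?length_rev; cbn; lia.
Qed.

Lemma run_cells M ans c t : length (cells (run M ans c t)) <= length (cells c) + t.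
Proof.
  induction t as [|t IH]; cbn [run]; [lia|]. pose proof (cstep_cells M (ans t) (run M ans c t)). lia.
Qed.

Lemma cstep_halt M ans c : cst c = q_acc \/ cst c = q_rej -> cstep M ans c = c.
Proof.
  intros H. unfold cstep, qstep.
  replace ((cst c =? q_acc) || (cst c =? q_rej)) with true.
  - destruct c; reflexivity.
  - destruct H as [-> | ->]; reflexivity.
Qed.

Lemma run_halt M ans c t t' : t <= t' -> cst (run M ans c t) = q_acc \/ cst (run M ans c t) = q_rej ->
  run M ans c t' = run M ans c t.
Proof.
  intros H Hc. induction H as [|t' H IH]; [reflexivity|]. cbn. rewrite IH. now apply cstep_halt.
Qed.

Lemma run_shift M ans c t : run M ans c (S t) = run M (fun t => ans (S t)) (cstep M (ans 0) c) t.
Proof. induction t as [|t IH]; [reflexivity|]. cbn [run] in *. now rewrite IH. Qed.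

Fixpoint queries (M : TM) (ans : nat -> bool) (c : config) (t : nat) : nat :=
  match t with
  | 0 => 0
  | S t => queries M ans c t + (if cst (run M ans c t) =? q_query then 1 else 0)
  end.

Lemma queries_shift M ans c t : queries M ans c (S t) =
  (if cst c =? q_query then 1 else 0) + queries M (fun t => ans (S t)) (cstep M (ans 0) c) t.
Proof.
  induction t as [|t IH]; [cbn; lia|].
  change (queries M ans c (S (S t))) with
    (queries M ans c (S t) + (if cst (run M ans c (S t)) =? q_query then 1 else 0)).
  rewrite IH, run_shift. cbn [queries]. lia.
Qed.

Lemma queries_halt M ans c t t' : t <= t' -> cst (run M ans c t) = q_acc \/ cst (run M ans c t) = q_rej ->
  queries M ans c t' = queries M ans c t.
Proof.
  intros H Hc. induction H as [|t' H IH]; [reflexivity|]. cbn.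
  rewrite (run_halt M ans c t t' H Hc), IH. destruct Hc as [-> | ->]; cbn; lia.
Qed.

Lemma step_cstep M O c c' b ans : step M O c c' b ->
  (cst c = q_query -> (ans = true <-> O (read_from c))) -> cstep M ans c = c' /\ b = (cst c =? q_query).
Proof.
  intros H Ha. destruct H as [c H1 H2 H3|c H1 H2|c H1 H2]; unfold cstep, qstep.
  - rewrite !(proj2 (Nat.eqb_neq _ _)) by assumption. auto.
  - rewrite H1. cbn. destruct ans; [auto|]. apply Ha in H2; [discriminate|assumption].
  - rewrite H1. cbn. destruct ans; [|auto]. exfalso. apply H2, Ha; auto.
Qed.

Lemma reaches_run M O n k c c' : reaches M O n k c c' -> forall ans,
  (forall t, t < n -> cst (run M ans c t) = q_query -> (ans t = true <-> O (read_from (run M ans c t)))) ->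
  run M ans c n = c' /\ queries M ans c n = k.
Proof.
  induction 1 as [c|n k c c' c'' b Hs H IH]; intros ans Ha; [auto|].
  destruct (step_cstep M O c c' b (ans 0) Hs) as [E Eb].
  { apply (Ha 0). lia. }
  rewrite run_shift, queries_shift, E.
  destruct (IH (fun t => ans (S t))) as [H1 H2].
  { intros t Ht. specialize (Ha (S t) ltac:(lia)). rewrite run_shift, E in Ha. exact Ha. }
  split; [exact H1|]. rewrite H2, <- Eb. destruct b; lia.
Qed.

Definition decide (P : Prop) : bool := if excluded_middle_informative P then true else false.

Lemma decide_iff P : decide P = true <-> P.
Proof. unfold decide. destruct (excluded_middle_informative P); intuition congruence. Qed.

Fixpoint oracle_run (M : TM) (O : list bool -> Prop) (c : config) (t : nat) : config :=
  match t with
  | 0 => c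
  | S t => cstep M (decide (O (read_from (oracle_run M O c t)))) (oracle_run M O c t)
  end.

Definition oracle_ans (M : TM) (O : list bool -> Prop) (c : config) (t : nat) : bool :=
  decide (O (read_from (oracle_run M O c t))).

Lemma run_oracle M O c t : run M (oracle_ans M O c) c t = oracle_run M O c t.
Proof. induction t as [|t IH]; cbn; [reflexivity|]. now rewrite IH. Qed.

Lemma init_cells w : forall j, tapef (init w) j = nth j (map Some w) None.
Proof. intros j. destruct w as [|b w]; destruct j as [|[|j]]; reflexivity. Qed.

Lemma init_pos w : pos (init w) = 0.
Proof. now destruct w. Qed.

Lemma init_cst w : cst (init w) = q_start.
Proof. now destruct w. Qed.

Lemma init_length w : length (cells (init w)) <= S (length w).
Proof. destruct w; cbn; rewrite ?length_map; lia. Qed.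

Lemma tapef_right c i : tapef c (pos c + i) = nth i (ccur c :: cright c) None.
Proof. unfold tapef, cells, pos. rewrite app_nth2; rewrite length_rev; [|lia]. f_equal. lia. Qed.

Lemma take_nonblank_spec l : (forall i, i < length (take_nonblank l) ->
    nth i l None = Some (nth i (take_nonblank l) false)) /\
  nth (length (take_nonblank l)) l None = None /\ length (take_nonblank l) <= length l.
Proof.
  induction l as [|[b|] l (IH1 & IH2 & IH3)]; cbn.
  - repeat split; intros; lia.
  - split; [|split; [exact IH2|lia]]. intros [|i] Hi; [reflexivity|]. apply IH1. lia.
  - repeat split; intros; lia.
Qed.

Lemma read_from_spec c : (forall i, i < length (read_from c) ->
    tapef c (pos c + i) = Some (nth i (read_from c) false)) /\
  tapef c (pos c + length (read_from c)) = None /\ pos c + length (read_from c) <= length (cells c).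
Proof.
  destruct (take_nonblank_spec (ccur c :: cright c)) as (H1 & H2 & H3). fold (read_from c) in *.
  split; [intros i Hi; rewrite tapef_right; now apply H1|split; [now rewrite tapef_right|]].
  unfold cells, pos. rewrite length_app, length_rev. lia.
Qed.

(* The value of a run is an interval [v, v + u): it is halved by each query, a positive answer selecting the
   upper half. *)
Fixpoint value (M : TM) (ans : nat -> bool) (c : config) (T t : nat) : nat * nat :=
  match t with
  | 0 => (0, T)
  | S t => let '(v, u) := value M ans c T t in
           if cst (run M ans c t) =? q_query
           then (if ans t then (v + u / 2, u / 2) else (v, u / 2))
           else (v, u)
  end.

Lemma value_bound M ans c T t : fst (value M ans c T t) + snd (value M ans c T t) <= T.
Proof.
  induction t as [|t IH]; cbn [value fst snd]; [lia|]. destruct (value M ans c T t) as [v u]. cbn [fst snd] in IH.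
  pose proof (Nat.div_mod u 2 ltac:(lia)).
  destruct (_ =? _); [destruct (ans t)|]; cbn [fst snd]; lia.
Qed.

(** A wrong run may ask more queries than the correct one and shrink its interval to width 0. The
    strict bound on its left end survives this, since halving a positive width leaves a smaller
    one. *)
Lemma value_nested M ans c T t t' : t <= t' ->
  fst (value M ans c T t) <= fst (value M ans c T t') /\
  (fst (value M ans c T t') + snd (value M ans c T t') <= fst (value M ans c T t) + snd (value M ans c T t)) /\
  (1 <= snd (value M ans c T t) -> fst (value M ans c T t') < fst (value M ans c T t) + snd (value M ans c T t)).
Proof.
  intros H.
  assert (G : fst (value M ans c T t) <= fst (value M ans c T t') /\
    fst (value M ans c T t') + snd (value M ans c T t') <= fst (value M ans c T t) + snd (value M ans c T t) /\
    (1 <= snd (value M ans c T t) -> fst (value M ans c T t') < fst (value M ans c T t) + snd (value M ans c T t))).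
  { induction H as [|t' H IH]; [lia|]. cbn [value].
    destruct (value M ans c T t) as [v0 u0]. destruct (value M ans c T t') as [v u]. cbn [fst snd] in IH |- *.
    pose proof (Nat.div_mod u 2 ltac:(lia)). pose proof (Nat.mod_upper_bound u 2 ltac:(lia)).
    destruct (_ =? _); [destruct (ans t')|]; cbn [fst snd]; lia. }
  exact G.
Qed.

(** [Q] stands for the queries still to come: rounding down is harmless, because a width of at least
    [2 ^ S Q] has a half of at least [2 ^ Q]. *)
Lemma value_width M ans c T Q t : 2 ^ (queries M ans c t + Q) <= T -> 2 ^ Q <= snd (value M ans c T t).
Proof.
  revert Q. induction t as [|t IH]; intros Q H; cbn [value]; [exact H|]. cbn [queries] in H.
  destruct (value M ans c T t) as [v u] eqn:E. cbn [snd] in IH.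
  destruct (cst (run M ans c t) =? q_query).
  - specialize (IH (S Q)). cbn [snd] in IH.
    assert (2 ^ S Q <= u) by (apply IH; eapply Nat.le_trans; [|exact H]; apply Nat.pow_le_mono_r; lia).
    assert (2 ^ Q <= u / 2) by (apply Nat.div_le_lower_bound; cbn [Nat.pow] in *; lia).
    destruct (ans t); cbn [snd]; assumption.
  - apply IH. eapply Nat.le_trans; [|exact H]. apply Nat.pow_le_mono_r; lia.
Qed.

Lemma run_ext M ans ans' c t : (forall i, i < t -> cst (run M ans c i) = q_query -> ans i = ans' i) ->
  run M ans c t = run M ans' c t.
Proof.
  induction t as [|t IH]; intros H; [reflexivity|]. cbn.
  rewrite <- IH by (intros i Hi; apply H; lia). unfold cstep, qstep.
  destruct (cst (run M ans c t) =? q_query) eqn:E; [|reflexivity].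
  apply Nat.eqb_eq in E. now rewrite (H t ltac:(lia) E).
Qed.

Lemma value_ext M ans ans' c T t : (forall i, i < t -> cst (run M ans c i) = q_query -> ans i = ans' i) ->
  value M ans c T t = value M ans' c T t.
Proof.
  induction t as [|t IH]; intros H; [reflexivity|]. cbn.
  assert (H' : forall i, i < t -> cst (run M ans c i) = q_query -> ans i = ans' i) by (intros i Hi; apply H; lia).
  rewrite <- (run_ext M ans ans' c t H'), <- (IH H').
  destruct (value M ans c T t). destruct (_ =? _) eqn:E; [|reflexivity].
  apply Nat.eqb_eq in E. now rewrite (H t ltac:(lia) E).
Qed.

(* At the first wrong answer, which must be negative, the correct run moves to the upper half. *)
Lemma value_max M O ans c T : (forall t, t < T -> cst (run M ans c t) = q_query -> ans t = true -> O (read_from (run M ans c t))) ->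
  2 ^ queries M (oracle_ans M O c) c T <= T ->
  fst (value M ans c T T) < fst (value M (oracle_ans M O c) c T T) \/
  (value M ans c T T = value M (oracle_ans M O c) c T T /\ run M ans c T = oracle_run M O c T).
Proof.
  intros H HQ. set (oa := oracle_ans M O c) in *.
  destruct (classic (exists i, i < T /\ cst (run M ans c i) = q_query /\ ans i <> oa i)) as [(i0 & H0)|N].
  2:{ right. assert (H' : forall i, i < T -> cst (run M ans c i) = q_query -> ans i = oa i).
      { intros i Hi Hc. destruct (bool_dec (ans i) (oa i)); [assumption|]. exfalso. eauto. }
      split; [now apply value_ext|]. rewrite <- run_oracle. now apply run_ext. }
  left.
  assert (HM : exists i, (i < T /\ cst (run M ans c i) = q_query /\ ans i <> oa i) /\
     forall j, j < i -> cst (run M ans c j) = q_query -> ans j = oa j).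
  { induction i0 as [i IH] using lt_wf_ind.
    destruct (classic (exists j, j < i /\ cst (run M ans c j) = q_query /\ ans j <> oa j)) as [(j & Hj & Hc & Hn)|N].
    - apply (IH j Hj). split; [lia|auto].
    - exists i. split; [exact H0|]. intros j Hj Hc. destruct (bool_dec (ans j) (oa j)); [assumption|]. exfalso. eauto. }
  clear i0 H0. destruct HM as (i & (Hi & Hc & Hn) & Hj).
  pose proof (run_ext M ans oa c i Hj) as ER. pose proof (value_ext M ans oa c T i Hj) as EV.
  assert (Ha : ans i = false /\ oa i = true).
  { destruct (ans i) eqn:Ea.
    - exfalso. apply Hn. symmetry. unfold oa, oracle_ans. apply decide_iff.
      rewrite <- run_oracle. fold oa. rewrite <- ER. apply H; auto.
    - split; [reflexivity|]. destruct (oa i); [reflexivity|congruence]. }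
  destruct Ha as [Ha Ho].
  (* The correct run still has the query at time [i] to count, so its interval has width at least 2
     there and both halves are nonempty. *)
  assert (HW : 1 <= snd (value M oa c T i) / 2).
  { apply Nat.div_le_lower_bound; [lia|]. apply (value_width M oa c T 1 i).
    eapply Nat.le_trans; [|exact HQ]. apply Nat.pow_le_mono_r; [lia|].
    assert (HI : forall t, i < t -> queries M oa c i + 1 <= queries M oa c t).
    { intros t Ht. induction Ht as [|t Ht IH]; cbn [queries]; [rewrite <- ER, Hc; cbn; lia|lia]. }
    apply HI, Hi. }
  destruct (value_nested M ans c T (S i) T Hi) as (_ & _ & N1).
  destruct (value_nested M oa c T (S i) T Hi) as (N2 & _ & _).
  cbn [value] in N1, N2. rewrite EV, Ha, Hc in N1. rewrite <- ER, Hc, Ho in N2. cbn [Nat.eqb] in N1, N2. rewrite Nat.eqb_refl in N1, N2.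
  destruct (value M oa c T i) as [v u]. cbn [fst snd] in *. specialize (N1 HW). lia.
Qed.

(** * Satisfying assignments of a tableau contain a run *)

Definition S_init (s : nat) : sch := seqs [
  cl [(true, aHead s (con 0) (con 0) (con 0) q_start)];
  SInput rx (cl [(true, aCell s (con 0) (con 0) (var rx) 2)]) (cl [(true, aCell s (con 0) (con 0) (var rx) 1)]);
  SFor ri rN (cl [(true, aCell s (con 0) (con 0) ([rn; ri], 0) 0)]);
  cl [(true, aVal s (con 0) (con 0) (var rT))]].

(** Halving without division: the old width is matched against [ru + ru + b], where [b] is its
    parity, and the new width is [ru]. *)
Definition S_val (s : nat) (M : TM) : sch :=
  seqs (map (fun q => SFor ri rN (SFor rv rN (SFor ru rN (
    if q =? q_query then seqs (flat_map (fun b =>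
      [cl [(false, aHead s (con 0) (var rt) (var ri) q); (false, aAns s (var rt));
           (false, aVal s (var rt) (var rv) ([ru; ru], b)); (true, aVal s (var1 rt) ([rv; ru], 0) (var ru))];
       cl [(false, aHead s (con 0) (var rt) (var ri) q); (true, aAns s (var rt));
           (false, aVal s (var rt) (var rv) ([ru; ru], b)); (true, aVal s (var1 rt) (var rv) (var ru))]])
      [0; 1])
    else cl [(false, aHead s (con 0) (var rt) (var ri) q);
             (false, aVal s (var rt) (var rv) (var ru)); (true, aVal s (var1 rt) (var rv) (var ru))]))))
    (seq 0 (nst M))).

Definition S_run (s : nat) (M : TM) : sch := SFor rt rT (SSeq (trans s true M) (S_val s M)).

Definition S_verifier (s : nat) (V : TM) : sch := SFor r0 rT (SFor rt rN (trans s false V)).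

(* The tape of a verifier is filled with the query, read from the tape of the oracle machine through the
   [aLink] atoms, and with a certificate, whose remaining length is counted by the [aCert] atoms. *)
Definition S_link (s a d : nat) : sch :=
  let tape i b := (true, aCell s (var1 r0) (con 0) i b) in
  let active := [(false, aHead s (con 0) (var r0) (var ri) q_query); (false, aAns s (var r0))] in
  let link := (false, aLink s (var r0) (var ri) (var rl)) in
  let cell b := (false, aCell s (con 0) (var r0) (var ri) b) in
  let cert := (false, aCert s (var r0) (var ri) (var1 rl)) in
  let stop b := (b, aEnd s (var r0) (var ri)) in
  let bit b := (b, aBit s (var r0) (var ri)) in
  SFor r0 rT (seqs [
    SFor ri rN (SSeq (cl (active ++ [(true, aLink s (var r0) (var ri) (con 0))]))
                     (cl (active ++ [(true, aHead s (var1 r0) (con 0) (con 0) q_start)])));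
    SFor ri rN (SFor rl rN (seqs [
      cl [link; cell 1; tape ([rl; rl], 0) 1]; cl [link; cell 1; tape ([rl; rl], 1) 1];
      cl [link; cell 2; tape ([rl; rl], 0) 1]; cl [link; cell 2; tape ([rl; rl], 1) 2];
      cl [link; cell 1; (true, aLink s (var r0) (var1 ri) (var1 rl))];
      cl [link; cell 2; (true, aLink s (var r0) (var1 ri) (var1 rl))];
      cl [link; cell 0; tape ([rl; rl], 0) 2]; cl [link; cell 0; tape ([rl; rl], 1) 2];
      SPoly rp a d rl (cl [link; cell 0; (true, aCert s (var r0) ([rl; rl], 2) (var rp))])]));
    SFor ri rN (SFor rl rN (seqs [
      cl [cert; stop true; bit false; tape (var ri) 2];
      cl [cert; stop true; bit true; tape (var ri) 1];
      cl [cert; stop true; (true, aCert s (var r0) (var1 ri) (var rl))];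
      cl [cert; stop false; (true, aBlank s (var r0) (var ri))]]));
    SFor ri rN (seqs [
      cl [(false, aCert s (var r0) (var ri) (con 0)); (true, aBlank s (var r0) (var ri))];
      cl [(false, aBlank s (var r0) (var ri)); tape (var ri) 0];
      cl [(false, aBlank s (var r0) (var ri)); (true, aBlank s (var r0) (var1 ri))]])]).

(** Position [rN] has a clause of its own, because the head can be there after [rN] steps while the
    loop stops before [rN]. *)
Definition S_verdict (s : nat) : sch :=
  SFor r0 rT (SSeq (SFor ri rN (cl [(false, aHead s (var1 r0) (var rN) (var ri) q_rej)]))
    (cl [(false, aHead s (var1 r0) (var rN) (var rN) q_rej)])).

Definition S_threshold (s : nat) (o : bool) : sch :=
  SSeq (SFor rv rk (SFor ru rN (cl [(false, aVal s (var rT) (var rv) (var ru))])))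
    (if o then SFor ru rN (SFor ri rN (cl [(false, aVal s (var rT) (var rk) (var ru));
                                           (false, aHead s (con 0) (var rT) (var ri) q_rej)])) else SNil).

Definition tableau (s : nat) (o : bool) (M V : TM) (a d : nat) : sch :=
  seqs [S_init s; S_run s M; S_verifier s V; S_link s a d; S_verdict s; S_threshold s o].

Ltac resolve X := repeat match type of X with
  | ~ _ \/ _ => destruct X as [X|X]; [solve [exfalso; apply X; assumption]|]
  | _ \/ False => destruct X as [X|[]]
  | _ \/ _ => destruct X as [X|X]; [solve [contradiction]|]
  end.
Ltac by_clause X := solve [resolve X; exact X].

Definition run_facts (A : list nat -> Prop) (s p N t : nat) (c : config) : Prop :=
  A [s; 0; p; t; pos c; cst c] /\ forall j, j < N -> A [s; 1; p; t; j; scode (tapef c j)].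

(** In fewer than [TT <= r rN] steps the head stays below [r rN], so the clauses for positions below
    [r rN] determine each next configuration. *)
Lemma run_sound A w s main M r c ans TT :
  (forall t, t < TT -> ssem A w (trans s main M) (upd r rt t)) -> TT <= r rN ->
  (forall t, t < TT -> ans_ok A s main t (ans t)) -> cst c < nst M -> pos c = 0 ->
  run_facts A s (run_index main r) (r rN) 0 c ->
  forall t, t <= TT -> run_facts A s (run_index main r) (r rN) t (run M ans c t).
Proof.
  intros HS HN Ha Hc Hp H0. induction t as [|t IH]; intros Ht; [exact H0|].
  destruct (IH ltac:(lia)) as [H1 H2]. cbn [run]. set (c' := run M ans c t) in *.
  assert (Hq : cst c' < nst M) by now apply run_nst.
  assert (Hi : pos c' < r rN) by (pose proof (run_pos M ans c t Hp); unfold c'; lia).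
  specialize (HS t ltac:(lia)). specialize (Ha t ltac:(lia)).
  pose proof (trans_sound A w s main M (upd r rt t) (cst c') (ccur c') (pos c') (ans t) HS Hq) as T1.
  rewrite upd_same in T1. rewrite (upd_other r rt rN) in T1 by discriminate.
  replace (run_index main (upd r rt t)) with (run_index main r) in T1 by (destruct main; reflexivity).
  pose proof (H2 _ Hi) as H3. rewrite tapef_pos in H3. specialize (T1 Hi Ha H1 H3).
  pose proof (cstep_spec M (ans t) c') as CS. destruct (qstep M (cst c') (ccur c') (ans t)) as [[q' b] m].
  destruct CS as (C1 & C2 & C3 & C4). rewrite Nat.add_1_r in T1. destruct T1 as [T1 T2].
  split; [now rewrite C1, C2|]. intros j Hj. destruct (Nat.eq_dec j (pos c')) as [->|Hn]; [now rewrite C3|].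
  rewrite C4 by exact Hn.
  pose proof (frame_sound A w s main M (upd r rt t) (cst c') (tapef c' j) (pos c') j HS Hq) as F.
  rewrite upd_same in F. rewrite (upd_other r rt rN) in F by discriminate.
  replace (run_index main (upd r rt t)) with (run_index main r) in F by (destruct main; reflexivity).
  rewrite Nat.add_1_r in F. apply F; auto.
Qed.

Lemma init_sound A w s r : r rn = length w -> ssem A w (S_init s) r ->
  run_facts A s 0 (r rN) 0 (init w) /\ A [s; 2; 0; 0; r rT].
Proof.
  intros Hn.
  unfold S_init. cbn [seqs fold_right ssem]. intros (H1 & H2 & H3 & H4 & _).
  ev in H1. ev in H4. split; [|tauto]. split; [rewrite init_pos, init_cst; tauto|].
  intros j Hj. rewrite init_cells. destruct (Nat.lt_ge_cases j (length w)) as [L|L].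
  - specialize (H2 j L). rewrite nth_indep with (d' := Some false) by now rewrite length_map.
    rewrite map_nth. destruct (nth j w false); ev in H2; cbn; tauto.
  - rewrite nth_overflow by now rewrite length_map. specialize (H3 (j - length w)).
    ev in H3. rewrite Hn in H3. replace (length w + (j - length w) + 0) with j in H3 by lia.
    destruct H3 as [H3|[]]; [lia|exact H3].
Qed.

Lemma val_sound A w s r M c t (ans : bool) v u : ssem A w (S_val s M) r -> t = r rt ->
  cst c < nst M -> pos c < r rN -> v < r rN -> u < r rN ->
  (if ans then A [s; 3; t] else ~ A [s; 3; t]) ->
  A [s; 0; 0; t; pos c; cst c] -> A [s; 2; t; v; u] ->
  let '(v', u') := if cst c =? q_query then (if ans then (v + u / 2, u / 2) else (v, u / 2)) else (v, u) in
  A [s; 2; t + 1; v'; u'].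
Proof.
  intros H -> Hq Hp Hv Hu Ha H1 H2. unfold S_val in H. rewrite ssem_seqs in H.
  assert (HI : In (cst c) (seq 0 (nst M))) by (apply in_seq; lia).
  specialize (H _ (in_map _ _ _ HI)). cbn beta in H.
  pose proof (Nat.div_mod u 2 ltac:(lia)) as D. pose proof (Nat.mod_upper_bound u 2 ltac:(lia)) as D'.
  destruct (cst c =? q_query).
  - assert (Hu2 : u / 2 < r rN) by lia. specialize (H (pos c) Hp v Hv (u / 2) Hu2).
    set (h := u / 2) in *. cbn [flat_map app seqs fold_right] in H.
    assert (E : u = h + h + 0 \/ u = h + h + 1) by lia.
    destruct H as (Ha0 & Hb0 & Ha1 & Hb1 & _).
    ev in Ha0. ev in Hb0. ev in Ha1. ev in Hb1. rewrite ?Nat.add_0_r in *.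
    destruct E as [E|E]; rewrite <- E in *; destruct ans;
      first [by_clause Ha0|by_clause Hb0|by_clause Ha1|by_clause Hb1].
  - specialize (H (pos c) Hp v Hv u Hu). ev in H. tauto.
Qed.


Definition cert_rules (A : list nat -> Prop) (s N t0 : nat) : Prop := forall i, i < N ->
  (forall l, l < N ->
    (A [s; 5; t0; i; l + 1] -> ~ A [s; 8; t0; i] -> A [s; 7; t0; i] -> A [s; 1; t0 + 1; 0; i; 2]) /\
    (A [s; 5; t0; i; l + 1] -> ~ A [s; 8; t0; i] -> ~ A [s; 7; t0; i] -> A [s; 1; t0 + 1; 0; i; 1]) /\
    (A [s; 5; t0; i; l + 1] -> ~ A [s; 8; t0; i] -> A [s; 5; t0; i + 1; l]) /\
    (A [s; 5; t0; i; l + 1] -> A [s; 8; t0; i] -> A [s; 6; t0; i])) /\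
  (A [s; 5; t0; i; 0] -> A [s; 6; t0; i]).

(** The certificate is read off the guessed bits from position [j] on, up to the first guessed end
    or until the countdown [R] is used up; the countdown enforces the length bound. *)
Lemma cert_sound A s N t0 : cert_rules A s N t0 ->
  forall R j, A [s; 5; t0; j; R] -> j + R < N -> exists y, length y <= R /\
    (forall i, i < length y -> A [s; 1; t0 + 1; 0; j + i; scode (Some (nth i y false))]) /\
    A [s; 6; t0; j + length y].
Proof.
  intros H. induction R as [|R IH]; intros j Hj HN.
  - exists []. split; [cbn; lia|split; [cbn; intros; lia|]]. cbn. rewrite Nat.add_0_r.
    apply (H j ltac:(lia)). exact Hj.
  - destruct (H j ltac:(lia)) as [H1 _]. destruct (H1 R ltac:(lia)) as (Ha & Hb & Hc & Hd).
    rewrite (Nat.add_1_r R) in Ha, Hb, Hc, Hd. destruct (classic (A [s; 8; t0; j])) as [He|He].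
    + exists []. split; [cbn; lia|split; [cbn; intros; lia|]]. cbn. rewrite Nat.add_0_r. tauto.
    + destruct (IH (j + 1)) as (y & L & Y1 & Y2); [tauto|lia|].
      assert (HB : exists b : bool, A [s; 1; t0 + 1; 0; j; scode (Some b)]).
      { destruct (classic (A [s; 7; t0; j])); [exists true|exists false]; cbn [scode]; tauto. }
      destruct HB as [b HB]. exists (b :: y). split; [cbn; lia|split].
      * intros [|i] Hi; [rewrite Nat.add_0_r; exact HB|]. cbn [nth]. specialize (Y1 i ltac:(cbn in Hi; lia)).
        replace (j + S i) with (j + 1 + i) by lia. exact Y1.
      * cbn [length]. replace (j + S (length y)) with (j + 1 + length y) by lia. exact Y2.
Qed.

Lemma pair_nth q y :
  (forall i, i < length q -> nth (i + i) (map Some (pair_enc q y)) None = Some false) /\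
  (forall i, i < length q -> nth (i + i + 1) (map Some (pair_enc q y)) None = Some (nth i q false)) /\
  nth (length q + length q) (map Some (pair_enc q y)) None = Some true /\
  nth (length q + length q + 1) (map Some (pair_enc q y)) None = Some true /\
  forall i, nth (length q + length q + 2 + i) (map Some (pair_enc q y)) None = nth i (map Some y) None.
Proof.
  induction q as [|b q (H1 & H2 & H3 & H4 & H5)].
  - repeat split; cbn; intros; try lia; reflexivity.
  - assert (E : map Some (pair_enc (b :: q) y) = Some false :: Some b :: map Some (pair_enc q y)) by reflexivity.
    rewrite E. clear E. cbn [length]. repeat split.
    + intros [|i] Hi; [reflexivity|]. replace (S i + S i) with (S (S (i + i))) by lia. apply H1. lia.
    + intros [|i] Hi; [reflexivity|]. replace (S i + S i + 1) with (S (S (i + i + 1))) by lia. apply H2. lia.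
    + replace (S (length q) + S (length q)) with (S (S (length q + length q))) by lia. exact H3.
    + replace (S (length q) + S (length q) + 1) with (S (S (length q + length q + 1))) by lia. exact H4.
    + intros i. replace (S (length q) + S (length q) + 2 + i) with (S (S (length q + length q + 2 + i))) by lia. apply H5.
Qed.

Lemma pair_position l j : (exists i, i < l /\ j = i + i) \/ (exists i, i < l /\ j = i + i + 1) \/
  j = l + l \/ j = l + l + 1 \/ exists i, j = l + l + 2 + i.
Proof.
  pose proof (Nat.div_mod j 2 ltac:(lia)). pose proof (Nat.mod_upper_bound j 2 ltac:(lia)).
  destruct (Nat.lt_ge_cases (j / 2) l).
  - assert (j mod 2 = 0 \/ j mod 2 = 1) as [E|E] by lia; [left|right; left]; exists (j / 2); lia.
  - right. right. destruct (Nat.le_gt_cases (l + l + 2) j); [right; right; exists (j - (l + l + 2)); lia|lia].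
Qed.

Lemma link_sound A w s a d r t0 c : ssem A w (S_link s a d) r -> t0 < r rT ->
  cst c = q_query -> A [s; 3; t0] -> run_facts A s 0 (r rN) t0 c ->
  let q := read_from c in
  pos c + length q < r rN -> 2 * length q + 2 + poly a d (length q) < r rN ->
  exists y, length y <= poly a d (length q) /\ run_facts A s (t0 + 1) (r rN) 0 (init (pair_enc q y)).
Proof.
  intros H Ht Hc Ha [F1 F2] q HN1 HN2. rewrite Hc in F1. set (N := r rN) in *. set (L := length q) in *.
  specialize (H t0 Ht). cbn [seqs fold_right ssem] in H. destruct H as (HA & HL & HC & HB & _).
  rewrite !(upd_other r r0 rN) in * by discriminate. fold N in HA, HL, HC, HB.
  assert (HA' : A [s; 4; t0; pos c; 0] /\ A [s; 0; t0 + 1; 0; 0; q_start]).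
  { specialize (HA (pos c) ltac:(lia)). ev in HA. tauto. }
  destruct HA' as [HA1 HA2]. clear HA.
  assert (HL' : forall i l, i < N -> l < N ->
    (forall b, A [s; 4; t0; i; l] -> A [s; 1; 0; t0; i; scode (Some b)] ->
        A [s; 1; t0 + 1; 0; l + l; 1] /\ A [s; 1; t0 + 1; 0; l + l + 1; scode (Some b)] /\ A [s; 4; t0; i + 1; l + 1]) /\
    (A [s; 4; t0; i; l] -> A [s; 1; 0; t0; i; 0] ->
        A [s; 1; t0 + 1; 0; l + l; 2] /\ A [s; 1; t0 + 1; 0; l + l + 1; 2] /\ A [s; 5; t0; l + l + 2; poly a d l])).
  { intros i l Hi Hl. specialize (HL i Hi). rewrite !(upd_other _ _ rN) in HL by discriminate.
    specialize (HL l Hl). destruct HL as (X1 & X2 & X3 & X4 & X5 & X6 & X7 & X8 & X9 & _).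
    ev in X1. ev in X2. ev in X3. ev in X4. ev in X5. ev in X6. ev in X7. ev in X8. ev in X9.
    rewrite ?Nat.add_0_r in *.
    split; [intros [|]; cbn [scode]|]; intros Y1 Y2; (split; [|split]);
    first [by_clause X1|by_clause X2|by_clause X3|by_clause X4|by_clause X5|by_clause X6|by_clause X7|by_clause X8|by_clause X9]. }
  clear HL.
  assert (HC' : cert_rules A s N t0).
  { intros i Hi. specialize (HB i Hi). destruct HB as (B1 & _). ev in B1. split; [|tauto].
    intros l Hl. specialize (HC i Hi). rewrite !(upd_other _ _ rN) in HC by discriminate.
    specialize (HC l Hl). destruct HC as (X1 & X2 & X3 & X4 & _).
    ev in X1. ev in X2. ev in X3. ev in X4.
    split; [intros; by_clause X1|split; [intros; by_clause X2|split; [intros; by_clause X3|intros; by_clause X4]]]. }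
  clear HC.
  assert (HB' : forall i, i < N -> A [s; 6; t0; i] -> A [s; 1; t0 + 1; 0; i; 0] /\ A [s; 6; t0; i + 1]).
  { intros i Hi. specialize (HB i Hi). destruct HB as (_ & X1 & X2 & _). ev in X1. ev in X2. tauto. }
  clear HB.
  destruct (read_from_spec c) as (R1 & R2 & _). fold q in R1, R2. fold L in R1, R2.
  (* The link atoms travel along the query and carry the offset at which the next bit is to be
     copied. *)
  assert (HK : forall i, i <= L -> A [s; 4; t0; pos c + i; i]).
  { induction i as [|i IH]; intros Hi; [rewrite Nat.add_0_r; exact HA1|].
    destruct (HL' (pos c + i) i ltac:(lia) ltac:(lia)) as [X _].
    specialize (X (nth i q false) (IH ltac:(lia))). rewrite <- R1 in X by lia.
    specialize (X (F2 (pos c + i) ltac:(lia))). rewrite ?Nat.add_1_r in X. rewrite Nat.add_succ_r. tauto. }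
  destruct (HL' (pos c + L) L ltac:(lia) ltac:(lia)) as [_ X].
  specialize (X (HK L (le_n _))). pose proof (F2 (pos c + L) ltac:(lia)) as F3. rewrite R2 in F3.
  destruct (X F3) as (X1 & X2 & X3). clear X F3.
  destruct (cert_sound A s N t0 HC' _ _ X3) as (y & Hy & Y1 & Y2); [lia|].
  exists y. split; [exact Hy|].
  (* Behind the certificate the blank atoms propagate to the end of the tape section, as the
     verifier must not see foreign symbols there. *)
  assert (HBL : forall i, L + L + 2 + length y + i < N -> A [s; 6; t0; L + L + 2 + length y + i]).
  { induction i as [|i IH]; intros Hi; [rewrite Nat.add_0_r; exact Y2|].
    destruct (HB' (L + L + 2 + length y + i) ltac:(lia) (IH ltac:(lia))) as [_ X].
    rewrite Nat.add_1_r in X. rewrite Nat.add_succ_r. exact X. }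
  split; [rewrite init_pos, init_cst; exact HA2|].
  intros j Hj. rewrite init_cells. destruct (pair_nth q y) as (P1 & P2 & P3 & P4 & P5). fold L in P1, P2, P3, P4, P5.
  destruct (pair_position L j) as [(i & Hi & ->)|[(i & Hi & ->)|[->|[->|(i & ->)]]]].
  - rewrite P1 by exact Hi. destruct (HL' (pos c + i) i ltac:(lia) ltac:(lia)) as [X _].
    apply (X (nth i q false) (HK i ltac:(lia))). rewrite <- R1 by lia. apply F2. lia.
  - rewrite P2 by exact Hi. destruct (HL' (pos c + i) i ltac:(lia) ltac:(lia)) as [X _].
    apply (X (nth i q false) (HK i ltac:(lia))). rewrite <- R1 by lia. apply F2. lia.
  - rewrite P3. exact X1.
  - rewrite P4. exact X2.
  - rewrite P5. destruct (Nat.lt_ge_cases i (length y)) as [Hi|Hi].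
    + rewrite nth_indep with (d' := Some false) by now rewrite length_map. rewrite map_nth. now apply Y1.
    + rewrite nth_overflow by now rewrite length_map.
      specialize (HBL (i - length y)). replace (L + L + 2 + length y + (i - length y)) with (L + L + 2 + i) in HBL by lia.
      now apply HB'; [|apply HBL].
Qed.

Lemma main_sound A w s M r ans : r rn = length w -> r rT < r rN ->
  ssem A w (S_init s) r -> ssem A w (S_run s M) r -> (forall t, ans t = true <-> A [s; 3; t]) ->
  forall t, t <= r rT -> run_facts A s 0 (r rN) t (run M ans (init w) t) /\
    A [s; 2; t; fst (value M ans (init w) (r rT) t); snd (value M ans (init w) (r rT) t)].
Proof.
  intros Hn HTN HI HR Ha. destruct (init_sound A w s r Hn HI) as [I1 I2].
  assert (Ha' : forall t, if ans t then A [s; 3; t] else ~ A [s; 3; t]).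
  { intros t. specialize (Ha t). destruct (ans t); [tauto|]. intros X. apply Ha in X. discriminate. }
  assert (HQ : cst (init w) < nst M) by (rewrite init_cst; pose proof (nst_ge M); unfold q_start; lia).
  assert (HF : forall t, t <= r rT -> run_facts A s 0 (r rN) t (run M ans (init w) t)).
  { apply (run_sound A w s true M r (init w) ans (r rT)).
    - intros t Ht. exact (proj1 (HR t Ht)).
    - lia.
    - intros t _. apply Ha'.
    - exact HQ.
    - apply init_pos.
    - exact I1. }
  intros t Ht. split; [now apply HF|]. induction t as [|t IH]; [exact I2|].
  specialize (IH ltac:(lia)). destruct (HF t ltac:(lia)) as [H1 _].
  destruct (HR t ltac:(lia)) as [_ HV].
  pose proof (value_bound M ans (init w) (r rT) t) as VB. cbn [value].
  destruct (value M ans (init w) (r rT) t) as [v u]. cbn [fst snd] in *.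
  pose proof (val_sound A w s (upd r rt t) M (run M ans (init w) t) t (ans t) v u HV) as X.
  rewrite upd_same in X. rewrite !(upd_other r rt rN) in X by discriminate.
  specialize (X eq_refl (run_nst _ _ _ _ HQ)). pose proof (run_pos M ans (init w) t (init_pos w)).
  specialize (X ltac:(lia) ltac:(lia) ltac:(lia) (Ha' t) H1 IH). rewrite Nat.add_1_r in X.
  destruct (cst (run M ans (init w) t) =? q_query); [destruct (ans t)|]; exact X.
Qed.

(** The answers are read off the [aAns] atoms; they force the run and its value and, for each
    positive answer, a verifier run on some guessed certificate. Not rejecting stands for accepting,
    because the verifier is later given enough time to halt. *)
Lemma tableau_sound A w s o M V a d r : ssem A w (tableau s o M V a d) r ->
  r rn = length w -> r rT < r rN ->
  2 * (length w + r rT + 1) + 2 + poly a d (length w + r rT + 1) < r rN ->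
  let ans t := decide (A [s; 3; t]) in
  (forall t, t < r rT -> cst (run M ans (init w) t) = q_query -> ans t = true ->
     exists y, length y <= poly a d (length (read_from (run M ans (init w) t))) /\
       cst (run V (fun _ => false) (init (pair_enc (read_from (run M ans (init w) t)) y)) (r rN)) <> q_rej) /\
  r rk <= fst (value M ans (init w) (r rT) (r rT)) /\
  (o = true -> fst (value M ans (init w) (r rT) (r rT)) = r rk -> cst (run M ans (init w) (r rT)) <> q_rej).
Proof.
  intros H Hn HT HN ans. cbn [tableau seqs fold_right ssem] in H. destruct H as (H1 & H2 & H3 & H4 & H5 & H6 & _).
  pose proof (main_sound A w s M r ans Hn HT H1 H2 (fun t => decide_iff _)) as HM.
  split; [|split].
  - intros t Ht Hc Ha. apply (proj1 (decide_iff (A [s; 3; t]))) in Ha. destruct (HM t ltac:(lia)) as [HF _].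
    set (c := run M ans (init w) t) in *.
    destruct (read_from_spec c) as (_ & _ & HL).
    pose proof (run_cells M ans (init w) t) as HL2. fold c in HL2. pose proof (init_length w) as HL3.
    pose proof (poly_mono a d (length (read_from c)) (length w + r rT + 1) ltac:(lia)) as HP.
    destruct (link_sound A w s a d r t c H4 Ht Hc Ha HF) as (y & Hy & HV); [lia|lia|].
    exists y. split; [exact Hy|]. set (c' := init (pair_enc (read_from c) y)) in *.
    assert (HQ : cst c' < nst V) by (unfold c'; rewrite init_cst; pose proof (nst_ge V); unfold q_start; lia).
    destruct (run_sound A w s false V (upd r r0 t) c' (fun _ => false) (r rN)) with (t := r rN) as [HE _].
    + intros t' Ht'. exact (H3 t Ht t' Ht').
    + apply Nat.le_refl.
    + reflexivity.
    + exact HQ.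
    + apply init_pos.
    + exact HV.
    + lia.
    + cbn [run_index] in HE. rewrite upd_same in HE.
      pose proof (run_pos V (fun _ => false) c' (r rN) (init_pos _)) as HP'.
      intros E. rewrite E in HE. destruct (H5 t Ht) as [X1 X2].
      apply Nat.lt_eq_cases in HP' as [HP'|HP'].
      * specialize (X1 _ HP'). ev in X1. tauto.
      * rewrite HP' in HE. ev in X2. tauto.
  - destruct (HM (r rT) (le_n _)) as [_ HV]. destruct H6 as [H6 _].
    pose proof (value_bound M ans (init w) (r rT) (r rT)) as VB.
    destruct (Nat.le_gt_cases (r rk) (fst (value M ans (init w) (r rT) (r rT)))) as [|L]; [assumption|].
    exfalso. specialize (H6 _ L). cbn [ssem] in H6. rewrite upd_other in H6 by discriminate. specialize (H6 (snd (value M ans (init w) (r rT) (r rT))) ltac:(lia)).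
    ev in H6. tauto.
  - intros -> E HE. destruct (HM (r rT) (le_n _)) as [[HF _] HV]. destruct H6 as [_ H6].
    pose proof (value_bound M ans (init w) (r rT) (r rT)) as VB.
    pose proof (run_pos M ans (init w) (r rT) (init_pos w)) as HP.
    specialize (H6 (snd (value M ans (init w) (r rT) (r rT))) ltac:(lia)). cbn [ssem] in H6. rewrite upd_other in H6 by discriminate.
    specialize (H6 (pos (run M ans (init w) (r rT))) ltac:(lia)). ev in H6. rewrite E in HV. rewrite HE in HF. tauto.
Qed.

(** * A run satisfies the tableau *)

Section model.
Variables (M V : TM) (w : list bool) (ans : nat -> bool) (cert : nat -> list bool) (T a d : nat).

Definition main_run (t : nat) : config := run M ans (init w) t.
Definition active (t : nat) : Prop := cst (main_run t) = q_query /\ ans t = true.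
Definition query (t : nat) : list bool := read_from (main_run t).
Definition cert_pos (t : nat) : nat := length (query t) + length (query t) + 2.

Definition nth_run (p t : nat) : config :=
  match p with
  | 0 => main_run t
  | S t0 => run V (fun _ => false) (init (pair_enc (query t0) (cert t0))) t
  end.

Definition live (p : nat) : Prop := match p with 0 => True | S t0 => active t0 end.

(** The intended reading of the atoms for the run given by [ans] and [cert]. Heads and cells of a
    verifier run whose query is not [active] are false, so the step clauses and the verdict for that
    run hold vacuously. *)
Definition model (l : list nat) : Prop :=
  match l with
  | _ :: k :: args =>
      match k, args with
      | 0, [p; t; i; q] => live p /\ pos (nth_run p t) = i /\ cst (nth_run p t) = q
      | 1, [p; t; j; b] => live p /\ scode (tapef (nth_run p t) j) = b
      | 2, [t; v; u] => value M ans (init w) T t = (v, u)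
      | 3, [t] => ans t = true
      | 4, [t; j; i] => active t /\ j = pos (main_run t) + i /\ i <= length (query t)
      | 5, [t; j; n] => active t /\ exists i, i <= length (cert t) /\ j = cert_pos t + i /\
                          n + i = poly a d (length (query t))
      | 6, [t; j] => active t /\ cert_pos t + length (cert t) <= j
      | 7, [t; j] => nth (j - cert_pos t) (cert t) false = true
      | 8, [t; j] => cert_pos t + length (cert t) <= j
      | _, _ => False
      end
  | _ => False
  end.

Variables (s : nat) (r : nat -> nat).
Hypothesis (Hn : r rn = length w) (HT : r rT = T).

Lemma scode_inj x y : scode x = scode y -> x = y.
Proof. destruct x as [[]|], y as [[]|]; cbn; congruence. Qed.

Lemma trans_model main X r1 : (main = true -> X = M) -> (main = false -> X = V) ->
  ssem model w (trans s main X) r1.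
Proof.
  intros HM HV.
  assert (HS : forall p t, run_index main r1 = p -> nth_run p (t + 1) = cstep X (if main then ans t else false) (nth_run p t)).
  { intros p t <-. rewrite Nat.add_1_r. destruct main; cbn [run_index].
    - rewrite HM by reflexivity. reflexivity.
    - rewrite Nat.add_1_r, HV by reflexivity. reflexivity. }
  apply trans_complete.
  - intros q b i an Ha (H1 & H2 & H3) (_ & H4). apply scode_inj in H4. subst i q b.
    set (p := run_index main r1) in *. set (t := r1 rt) in *.
    assert (Ea : an = if main then ans t else false).
    { destruct main; cbn in Ha; [|exact Ha]. destruct an; cbn in Ha; [now rewrite Ha|].
      destruct (ans t); [now destruct Ha|reflexivity]. }
    specialize (HS p t eq_refl). rewrite <- Ea in HS. rewrite tapef_pos.
    pose proof (cstep_spec X an (nth_run p t)) as C. destruct (qstep X _ _ an) as [[q' b] m].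
    destruct C as (C1 & C2 & C3 & _). cbn. rewrite HS. intuition congruence.
  - intros q b i j Hij (H1 & H2 & H3) (_ & H4). cbn. split; [exact H1|]. subst i.
    set (p := run_index main r1) in *. rewrite (HS p _ eq_refl).
    pose proof (cstep_spec X (if main then ans (r1 rt) else false) (nth_run p (r1 rt))) as C.
    destruct (qstep X _ _ _) as [[q' b'] m]. destruct C as (_ & _ & _ & C4). rewrite C4; [exact H4|].
    exact Hij.
Qed.

Lemma init_model : ssem model w (S_init s) r.
Proof.
  unfold S_init. cbn [seqs fold_right ssem]. split; [|split; [|split; [|split; [|exact I]]]].
  - ev. left. cbn. unfold main_run. cbn. now rewrite init_pos, init_cst.
  - intros v Hv.
    assert (E : tapef (init w) v = Some (nth v w false)).
    { rewrite init_cells, nth_indep with (d' := Some false) by now rewrite length_map. apply map_nth. }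
    destruct (nth v w false); ev; left; cbn; (split; [exact I|]); unfold main_run; cbn; now rewrite E.
  - intros i _. ev. left. cbn. split; [exact I|]. unfold main_run. cbn. rewrite init_cells, nth_overflow; [reflexivity|].
    rewrite length_map. lia.
  - ev. left. cbn. now rewrite HT.
Qed.

Lemma val_model r1 : ssem model w (S_val s M) r1.
Proof.
  unfold S_val. rewrite ssem_seqs. intros x Hx. apply in_map_iff in Hx as (q & <- & _).
  intros i _ v _ u _.
  assert (HV : forall t v0 u0, value M ans (init w) T t = (v0, u0) -> value M ans (init w) T (t + 1) =
    if cst (main_run t) =? q_query then (if ans t then (v0 + u0 / 2, u0 / 2) else (v0, u0 / 2)) else (v0, u0)).
  { intros t v0 u0 E. rewrite Nat.add_1_r. cbn [value]. now rewrite E. }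
  assert (E2 : forall b, b < 2 -> (u + u + b) / 2 = u).
  { intros b Hb. symmetry. apply (Nat.div_unique _ 2 u b); lia. }
  assert (HQ : forall b (sg : bool), b < 2 -> live 0 /\ pos (nth_run 0 (r1 rt)) = i /\ cst (nth_run 0 (r1 rt)) = q_query ->
     (if sg then ans (r1 rt) = true else ans (r1 rt) <> true) ->
     value M ans (init w) T (r1 rt) = (v, u + u + b) ->
     value M ans (init w) T (r1 rt + 1) = if sg then (v + u, u) else (v, u)).
  { intros b sg Hb (_ & _ & Hc) Ha E. rewrite (HV _ _ _ E). cbn in Hc. rewrite Hc, E2 by exact Hb. cbn.
    destruct sg, (ans (r1 rt)); congruence. }
  destruct (q =? q_query) eqn:Eq.
  - apply Nat.eqb_eq in Eq. subst q. cbn [flat_map app seqs fold_right ssem].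
    split; [|split; [|split; [|split; [|exact I]]]]; ev; cbn [model];
      rewrite ?Nat.add_0_r;
      [specialize (HQ 0 true)|specialize (HQ 0 false)|specialize (HQ 1 true)|specialize (HQ 1 false)];
      rewrite ?Nat.add_0_r in HQ; specialize (HQ ltac:(lia)); cbn iota in HQ; tauto.
  - ev. cbn [model]. apply Nat.eqb_neq in Eq.
    destruct (classic (live 0 /\ pos (nth_run 0 (r1 rt)) = i /\ cst (nth_run 0 (r1 rt)) = q)) as [H|]; [right|tauto].
    destruct H as (_ & _ & Hc). cbn in Hc.
    destruct (classic (value M ans (init w) T (r1 rt) = (v, u))) as [E|]; [right|tauto]. left.
    rewrite (HV _ _ _ E), Hc. apply Nat.eqb_neq in Eq. now rewrite Eq.
Qed.

Hypothesis Hcert : forall t, t < T -> active t ->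
  length (cert t) <= poly a d (length (query t)) /\
  cst (run V (fun _ => false) (init (pair_enc (query t) (cert t))) (r rN)) <> q_rej.

Lemma link_model : ssem model w (S_link s a d) r.
Proof.
  unfold S_link. intros t Ht. rewrite HT in Ht. cbn [seqs fold_right ssem app].
  assert (HC := Hcert t Ht).
  destruct (read_from_spec (main_run t)) as (R1 & R2 & _). fold (query t) in R1, R2.
  destruct (pair_nth (query t) (cert t)) as (P1 & P2 & P3 & P4 & P5).
  assert (HI : forall j, tapef (nth_run (t + 1) 0) j = nth j (map Some (pair_enc (query t) (cert t))) None).
  { intros j. rewrite Nat.add_1_r. cbn. apply init_cells. }
  assert (HL : live (t + 1) = active t) by (rewrite Nat.add_1_r; reflexivity).
  split; [|split; [|split; [|split; [|exact I]]]].
  - intros i _. ev. cbn [model]. rewrite HL. unfold active.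
    destruct (classic (cst (main_run t) = q_query)) as [H1|]; [|cbn; tauto].
    destruct (classic (ans t = true)) as [H2|]; [|tauto].
    destruct (classic (pos (main_run t) = i)) as [H3|]; [|cbn; tauto].
    split; right; right; left.
    + split; [auto|]. split; lia.
    + split; [auto|]. rewrite Nat.add_1_r. cbn. now rewrite init_pos, init_cst.
  - intros i _ l _.
    (* All copying clauses are propositional consequences of two facts: [HB] for a bit inside the
       query and [HZ] for the blank that ends it. *)
    assert (HB : forall b : bool, (active t /\ i = pos (main_run t) + l /\ l <= length (query t)) ->
      (live 0 /\ scode (tapef (nth_run 0 t) i) = scode (Some b)) ->
      (active t /\ scode (tapef (nth_run (t + 1) 0) (l + l)) = 1) /\
      (active t /\ scode (tapef (nth_run (t + 1) 0) (l + l + 1)) = scode (Some b)) /\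
      (active t /\ i + 1 = pos (main_run t) + (l + 1) /\ l + 1 <= length (query t))).
    { intros b (H1 & -> & H3) [_ H4]. apply scode_inj in H4. cbn in H4.
      assert (L : l < length (query t)).
      { apply Nat.lt_eq_cases in H3 as [|E]; [assumption|]. rewrite E in H4. congruence. }
      rewrite R1 in H4 by exact L. rewrite !HI, P1, P2 by exact L. rewrite H4.
      split; [auto|split; [auto|split; [exact H1|lia]]]. }
    assert (HZ : (active t /\ i = pos (main_run t) + l /\ l <= length (query t)) ->
      (live 0 /\ scode (tapef (nth_run 0 t) i) = 0) ->
      (active t /\ scode (tapef (nth_run (t + 1) 0) (l + l)) = 2) /\
      (active t /\ scode (tapef (nth_run (t + 1) 0) (l + l + 1)) = 2) /\
      (active t /\ exists i0, i0 <= length (cert t) /\ l + l + 2 = cert_pos t + i0 /\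
                          poly a d l + i0 = poly a d (length (query t)))).
    { intros (H1 & -> & H3) [_ H4]. cbn in H4.
      assert (L : l = length (query t)).
      { apply Nat.lt_eq_cases in H3 as [L|E]; [|assumption]. rewrite R1 in H4 by exact L.
        destruct (nth l (query t) false); discriminate. }
      subst l. rewrite !HI, P3, P4. split; [auto|split; [auto|split; [auto|]]].
      exists 0. unfold cert_pos. split; [lia|split; [lia|lia]]. }
    cbn [ssem]. repeat (split; [ev; cbn [model]; rewrite ?HL, ?Nat.add_0_r; clear -HB HZ;
      first [specialize (HB false); cbn [scode] in HB; tauto|specialize (HB true); cbn [scode] in HB; tauto|tauto]|]).
    exact I.
  - intros i _ l _.
    assert (HB : (active t /\ exists i0, i0 <= length (cert t) /\ i = cert_pos t + i0 /\ l + 1 + i0 = poly a d (length (query t))) ->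
      (~ cert_pos t + length (cert t) <= i ->
        (nth (i - cert_pos t) (cert t) false = true -> active t /\ scode (tapef (nth_run (t + 1) 0) i) = 2) /\
        (nth (i - cert_pos t) (cert t) false <> true -> active t /\ scode (tapef (nth_run (t + 1) 0) i) = 1) /\
        (active t /\ exists i0, i0 <= length (cert t) /\ i + 1 = cert_pos t + i0 /\ l + i0 = poly a d (length (query t))))).
    { intros (H1 & i0 & H2 & -> & H3) H4.
      replace (cert_pos t + i0 - cert_pos t) with i0 by lia. rewrite HI. unfold cert_pos at 1 2. rewrite P5.
      rewrite nth_indep with (d' := Some false) by (rewrite length_map; lia). rewrite map_nth.
      split; [intros ->; auto|split; [|split; [exact H1|exists (i0 + 1); lia]]].
      intros H5. split; [exact H1|]. destruct (nth i0 (cert t) false); [now destruct H5|reflexivity]. }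
    assert (HZ : (active t /\ exists i0, i0 <= length (cert t) /\ i = cert_pos t + i0 /\ l + 1 + i0 = poly a d (length (query t))) -> active t)
      by tauto.
    repeat (split; [ev; cbn [model]; rewrite ?HL; clear -HB HZ; tauto|]). exact I.
  - intros i _.
    assert (H1 : (active t /\ exists i0, i0 <= length (cert t) /\ i = cert_pos t + i0 /\ 0 + i0 = poly a d (length (query t))) ->
      active t /\ cert_pos t + length (cert t) <= i).
    { intros (H1 & i0 & H2 & -> & H3). specialize (HC H1). split; [exact H1|lia]. }
    assert (H2 : (active t /\ cert_pos t + length (cert t) <= i) ->
       (active t /\ scode (tapef (nth_run (t + 1) 0) i) = 0) /\ (active t /\ cert_pos t + length (cert t) <= i + 1)).
    { intros [H2 H3]. split; [split; [exact H2|]|split; [exact H2|lia]]. rewrite HI.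
      unfold cert_pos in H3. replace i with (length (query t) + length (query t) + 2 + (i - (length (query t) + length (query t) + 2))) by lia.
      rewrite P5, nth_overflow; [reflexivity|]. rewrite length_map. lia. }
    repeat (split; [ev; cbn [model]; rewrite ?HL; clear -H1 H2; tauto|]). exact I.
Qed.

Lemma verdict_model : ssem model w (S_verdict s) r.
Proof.
  intros t Ht. rewrite HT in Ht. assert (HC := Hcert t Ht).
  assert (H : forall i, ~ model [s; 0; t + 1; r rN; i; q_rej]).
  { intros i. rewrite Nat.add_1_r. cbn. intros (H1 & _ & H2). now apply HC in H1 as [_ H1]. }
  split; [intros i _|]; ev; left; apply H.
Qed.

Lemma threshold_model o : r rk <= fst (value M ans (init w) T T) ->
  (o = true -> fst (value M ans (init w) T T) = r rk -> cst (main_run T) <> q_rej) ->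
  ssem model w (S_threshold s o) r.
Proof.
  intros H1 H2. split.
  - intros v Hv u _. ev. left. cbn. rewrite HT. intros E. rewrite E in H1. cbn in H1. lia.
  - destruct o; [|exact I]. intros u _ i _. ev. cbn [model]. rewrite HT.
    destruct (classic (value M ans (init w) T T = (r rk, u))) as [E|]; [right; left|tauto].
    rewrite E in H2. cbn [fst] in H2. cbn. intros (_ & _ & Hc). now apply H2.
Qed.

Lemma tableau_complete o : r rk <= fst (value M ans (init w) T T) ->
  (o = true -> fst (value M ans (init w) T T) = r rk -> cst (main_run T) <> q_rej) ->
  ssem model w (tableau s o M V a d) r.
Proof.
  intros H1 H2. cbn [tableau seqs fold_right ssem].
  split; [apply init_model|split; [|split; [|split; [apply link_model|split; [apply verdict_model|split; [now apply threshold_model|exact I]]]]]].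
  - intros t _. split; [now apply trans_model|apply val_model].
  - intros t0 _ t _. now apply trans_model.
Qed.

End model.

(** * The pigeonhole formula *)

(** The layout follows the printing loops of [S_php], which run below a register: [K + 1] pigeons
    are the pigeons [i + 1] with [i < K] and pigeon 0, and the partners of pigeon [i + 1] are [i]
    and all [i' < i]. *)
Definition php_cnf (p : nat -> nat -> nat) (K : nat) : cnf :=
  flat_map (fun i => [flat_map (fun j => [(p (i + 1) j, true)]) (seq 0 K)]) (seq 0 K) ++
  [flat_map (fun j => [(p 0 j, true)]) (seq 0 K)] ++
  flat_map (fun i => flat_map (fun j => [[(p i j, false); (p (i + 1) j, false)]] ++
      flat_map (fun i' => [[(p i' j, false); (p (i + 1) j, false)]]) (seq 0 i)) (seq 0 K)) (seq 0 K).

Definition ren (f : nat -> nat) (F : cnf) : cnf := map (map (fun l => (f (fst l), snd l))) F.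

Fixpoint tren (f : nat -> nat) (t : tree) : tree :=
  match t with
  | Leaf => Leaf
  | Node x t1 t2 => Node (f x) (tren f t1) (tren f t2)
  end.

Lemma tren_size f t : tree_size (tren f t) = tree_size t.
Proof. induction t as [|x t1 IH1 t2 IH2]; cbn; [reflexivity|]. now rewrite IH1, IH2. Qed.

Lemma restrict_ren f F x b : (forall v, In v (vars F) -> f v = f x -> v = x) ->
  restrict (ren f F) [(f x, b)] = ren f (restrict F [(x, b)]).
Proof.
  intros Hf. induction F as [|C F IH]; [reflexivity|].
  assert (HC : forall v c, In (v, c) C -> f v = f x -> v = x).
  { intros v c Hv. apply Hf. apply in_vars. exists C, c. split; [now left|exact Hv]. }
  assert (IH' : restrict (ren f F) [(f x, b)] = ren f (restrict F [(x, b)])).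
  { apply IH. intros v Hv. apply Hf. cbn. apply in_or_app. now right. }
  cbn [ren map]. fold (ren f F). rewrite !restrict_cons1, IH'. clear IH IH' Hf.
  assert (E : existsb (fun l => lit_eqb l (f x, b)) (map (fun l => (f (fst l), snd l)) C) =
    existsb (fun l => lit_eqb l (x, b)) C).
  { apply eq_true_iff_eq. rewrite !existsb_lit, in_map_iff. split.
    - intros ([v c] & E & Hv). cbn in E. inversion E; subst. now rewrite <- (HC v b Hv) by assumption.
    - intros H. now exists (x, b). }
  rewrite E. destruct (existsb (fun l => lit_eqb l (x, b)) C); [reflexivity|]. cbn [ren map]. f_equal.
  clear E. unfold red. induction C as [|[v c] C IH]; [reflexivity|]. cbn [map filter fst snd].
  rewrite IH by (intros u e Hu; apply (HC u e); now right).
  replace (lit_eqb (neg_lit (f v, c)) (f x, b)) with (lit_eqb (neg_lit (v, c)) (x, b)).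
  2:{ apply eq_true_iff_eq. rewrite !neg_lit_eqb. split; intros E; inversion E; subst; [reflexivity|].
      f_equal. apply (HC v (negb b)); [now left|assumption]. }
  destruct (negb (lit_eqb (neg_lit (v, c)) (x, b))); reflexivity.
Qed.

Lemma bst_ren f F T : is_bst F T -> (forall u v, In u (vars F) -> In v (vars F) -> f u = f v -> u = v) ->
  is_bst (ren f F) (tren f T).
Proof.
  induction 1 as [F H|F x T1 T2 Hn Hx H1 IH1 H2 IH2]; intros Hf.
  - constructor. apply in_map_iff. now exists [].
  - assert (HR : forall b, restrict (ren f F) [(f x, b)] = ren f (restrict F [(x, b)]))
      by (intros b; apply restrict_ren; intros v Hv; now apply Hf).
    cbn [tren]. constructor.
    + intros Hi. apply in_map_iff in Hi as (C & E & HC). destruct C; [contradiction|discriminate].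
    + apply in_vars in Hx as (C & b & HC & Hx). apply in_vars.
      exists (map (fun l => (f (fst l), snd l)) C), b. split; [apply in_map, HC|]. apply in_map_iff. now exists (x, b).
    + rewrite HR. apply IH1. intros u v Hu Hv. apply vars_restrict in Hu, Hv. now apply Hf.
    + rewrite HR. apply IH2. intros u v Hu Hv. apply vars_restrict in Hu, Hv. now apply Hf.
Qed.

Lemma ren_php f p K : ren f (php_cnf p K) = php_cnf (fun i j => f (p i j)) K.
Proof.
  unfold ren, php_cnf. rewrite !map_app, !map_flat_map. cbn [map]. f_equal; [|f_equal].
  - apply flat_map_ext. intros i. now rewrite map_flat_map.
  - now rewrite map_flat_map.
  - apply flat_map_ext. intros i. rewrite map_flat_map. apply flat_map_ext. intros j.
    cbn [app map fst snd]. f_equal. now rewrite map_flat_map.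
Qed.

Lemma in_php p K C : In C (php_cnf p K) <->
  (exists i, i <= K /\ C = flat_map (fun j => [(p i j, true)]) (seq 0 K)) \/
  exists i i' j, i < i' <= K /\ j < K /\ C = [(p i j, false); (p i' j, false)].
Proof.
  unfold php_cnf. rewrite !in_app_iff, !in_flat_map. split.
  - intros [(i & Hi & [<-|[]])|[[<-|[]]|(i & Hi & H)]].
    + apply in_seq in Hi. left. exists (i + 1). split; [lia|reflexivity].
    + left. exists 0. split; [lia|reflexivity].
    + apply in_seq in Hi. apply in_flat_map in H as (j & Hj & H). apply in_seq in Hj. right.
      destruct H as [<-|H].
      * exists i, (i + 1), j. repeat split; lia.
      * apply in_flat_map in H as (i' & Hi' & [<-|[]]). apply in_seq in Hi'.
        exists i', (i + 1), j. repeat split; lia.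
  - intros [([|i] & Hi & ->)|(i & i' & j & Hi & Hj & ->)].
    + right. left. now left.
    + left. exists i. split; [apply in_seq; lia|]. left. now rewrite Nat.add_1_r.
    + right. right. exists (i' - 1). split; [apply in_seq; lia|]. apply in_flat_map. exists j.
      split; [apply in_seq; lia|]. replace (i' - 1 + 1) with i' by lia.
      destruct (Nat.eq_dec i (i' - 1)) as [->|Hn]; [now left|right].
      apply in_flat_map. exists i. split; [apply in_seq; lia|now left].
Qed.

Lemma in_php_wide (p : nat -> nat -> nat) K i (l : lit) : In l (flat_map (fun j => [(p i j, true)]) (seq 0 K)) <-> exists j, j < K /\ l = (p i j, true).
Proof.
  rewrite in_flat_map. split.
  - intros (j & Hj & [<-|[]]). apply in_seq in Hj. exists j. split; [lia|reflexivity].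
  - intros (j & Hj & ->). exists j. split; [apply in_seq; lia|now left].
Qed.

Lemma php_cnf_clause p K C : In C (php_cnf p K) -> php_clause p K C.
Proof.
  intros H. apply in_php in H as [(i & _ & ->)|(i & i' & j & Hi & _ & ->)].
  - apply php_wide with i. apply in_php_wide.
  - apply php_pair. lia.
Qed.

Lemma php_unsat p K A : ~ sat A (php_cnf p K).
Proof.
  intros H. apply (pigeonhole (fun i j => A (p i j)) K).
  - intros i Hi. destruct (H _ (proj2 (in_php p K _) (or_introl (ex_intro _ i (conj Hi eq_refl))))) as (l & Hl & Tl).
    apply in_php_wide in Hl as (j & Hj & ->). exists j. split; [exact Hj|exact Tl].
  - intros i i' j Hi Hj H1 H2.
    destruct (H [(p i j, false); (p i' j, false)]) as (l & [<-|[<-|[]]] & Tl).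
    + apply in_php. right. exists i, i', j. auto.
    + now apply Tl.
    + now apply Tl.
Qed.

Lemma php_nil p K : 1 <= K -> ~ In [] (php_cnf p K).
Proof.
  intros HK H. apply in_php in H as [(i & _ & E)|(i & i' & j & _ & _ & E)]; [|discriminate].
  destruct K as [|K]; [lia|discriminate].
Qed.

Lemma php_vars p K v : In v (vars (php_cnf p K)) -> exists i j, v = p i j.
Proof.
  intros H. apply in_vars in H as (C & b & HC & Hv). eapply php_clause_var; [apply php_cnf_clause, HC|exact Hv].
Qed.

(** Search trees are carried over by renaming in both directions, which makes the minimum [h] the
    same for both copies. *)
Lemma php_minbst p q K :
  (forall i j i' j', p i j = p i' j' -> i = i' /\ j = j') ->
  (forall i j i' j', q i j = q i' j' -> i = i' /\ j = j') ->
  exists h, minbst (php_cnf p K) h /\ minbst (php_cnf q K) h /\ 2 ^ K <= S h.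
Proof.
  intros Hp Hq.
  assert (HF : forall p q : nat -> nat -> nat, (forall i j i' j', p i j = p i' j' -> i = i' /\ j = j') ->
     exists f : nat -> nat, forall i j : nat, f (p i j) = q i j).
  { clear. intros p q Hp.
    assert (H : forall v, exists u, forall i j, v = p i j -> u = q i j).
    { intros v. destruct (classic (exists i j, v = p i j)) as [(i & j & ->)|N].
      - exists (q i j). intros i' j' E. apply Hp in E as [-> ->]. reflexivity.
      - exists 0. intros i j E. exfalso. eauto. }
    exists (fun v => proj1_sig (constructive_indefinite_description _ (H v))).
    intros i j. destruct (constructive_indefinite_description _ _) as [u Hu]. now apply Hu. }
  assert (HT : forall p q : nat -> nat -> nat, (forall i j i' j', p i j = p i' j' -> i = i' /\ j = j') ->
    (forall i j i' j', q i j = q i' j' -> i = i' /\ j = j') ->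
    forall T, is_bst (php_cnf p K) T -> exists T', is_bst (php_cnf q K) T' /\ tree_size T' = tree_size T).
  { clear -HF. intros p q Hp Hq T HT. destruct (HF p q Hp) as [f Hf]. exists (tren f T).
    split; [|apply tren_size].
    assert (E : php_cnf q K = ren f (php_cnf p K)).
    { rewrite ren_php. unfold php_cnf. f_equal; [|f_equal].
      - apply flat_map_ext. intros i. f_equal. apply flat_map_ext. intros j. now rewrite Hf.
      - f_equal. apply flat_map_ext. intros j. now rewrite Hf.
      - apply flat_map_ext. intros i. apply flat_map_ext. intros j. rewrite !Hf. f_equal.
        apply flat_map_ext. intros i'. now rewrite !Hf. }
    rewrite E. apply bst_ren; [exact HT|]. intros u v Hu Hv E'.
    apply php_vars in Hu as (i & j & ->). apply php_vars in Hv as (i' & j' & ->). rewrite !Hf in E'.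
    apply Hq in E' as [-> ->]. reflexivity. }
  destruct (unsat_bst (php_cnf p K) (php_unsat p K)) as (T & HT0 & _).
  destruct (minbst_exists _ _ HT0) as (h & _ & Mh). exists h. split; [exact Mh|].
  destruct Mh as [(T1 & H1 & S1) L1]. split; [split|].
  - destruct (HT p q Hp Hq T1 H1) as (T' & H' & S'). exists T'. split; [exact H'|lia].
  - intros T' H'. destruct (HT q p Hq Hp T' H') as (T2 & H2 & S2). specialize (L1 T2 H2). lia.
  - rewrite <- S1. apply (php_lower p K Hp (php_cnf p K)); [apply php_cnf_clause|exact H1].
Qed.

(** * The complete formula *)

Definition aSel (s : nat) (k : lin) : list lin := [con s; con 9; k].
Definition aSplit (s : nat) : list lin := [con s; con 10].
Definition aHole (s : nat) (i j : lin) : list lin := [con s; con 11; i; j].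

Definition S_php (s : nat) : sch :=
  SSeq (SFor ri rK (SClause (PFor rd rK (PLit true (aHole s (var1 ri) (var rd))))))
    (SSeq (SClause (PFor rd rK (PLit true (aHole s (con 0) (var rd)))))
      (SFor ri rK (SFor rl rK (SSeq
        (cl [(false, aHole s (var ri) (var rl)); (false, aHole s (var1 ri) (var rl))])
        (SFor rd ri (cl [(false, aHole s (var rd) (var rl)); (false, aHole s (var1 ri) (var rl))])))))).

Lemma sden_php w s r : sden w (S_php s) r = php_cnf (fun i j => code [s; 11; i; j]) (r rK).
Proof.
  unfold S_php, php_cnf, cl, lits. cbn [sden pden fold_right fst snd].
  repeat rewrite upd_other by discriminate.
  f_equal; [|f_equal].
  - apply flat_map_ext. intros i. rewrite upd_other by discriminate. f_equal.
    apply flat_map_ext. intros j. f_equal. unfold aHole. ev. reflexivity.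
  - f_equal. apply flat_map_ext. intros j. unfold aHole. ev. reflexivity.
  - apply flat_map_ext. intros i. rewrite upd_other by discriminate. apply flat_map_ext. intros j. f_equal.
    + unfold aHole. ev. reflexivity.
    + rewrite upd_other, upd_same by discriminate. apply flat_map_ext. intros i'. unfold aHole. ev. reflexivity.
Qed.

Definition S_hard (s a d : nat) : sch := SPoly rK a d rN (S_php s).

(** The two copies of [U] share all their variables, which is harmless because the minimum size of
    [branch] does not depend on disjointness. *)
Definition S_item (s : nat) (o : bool) (M V : TM) (a d aK dK : nat) : sch :=
  let U := SSeq (tableau s o M V a d) (S_hard s aK dK) in
  SSeq (SPre (PLit true (aSplit s)) U) (SPre (PLit false (aSplit s)) U).

(** A loop cannot nest [branch] to variable depth, so the nesting is flattened: item [k] carries the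
    negated selectors below [k] and the positive selector [k], the base all selectors negated. *)
Definition S_chain (s : nat) (item base : sch) : sch :=
  SSeq (SFor rk rT (SPre (PSeq (PFor rj rk (PLit false (aSel s (var rj)))) (PLit true (aSel s (var rk)))) item))
    (SPre (PFor rj rT (PLit false (aSel s (var rj)))) base).

(** The first chain ends in the empty clause, of minimum size 0; the second one ends in the
    additional pigeonhole formula. *)
Definition S_full (M V : TM) (a d aK dK : nat) : sch :=
  SSeq (S_chain 0 (S_item 0 false M V a d aK dK) (SClause PNil))
    (S_chain 1 (S_item 1 true M V a d aK dK) (S_hard 1 aK dK)).

Definition S_top (M V : TM) (a d aT dT aN dN aK dK : nat) : sch :=
  SLen rn (SPoly rT aT dT rn (SPoly rN aN dN rT (S_full M V a d aK dK))).

(** * Syntactic conditions on the schemes *)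

Definition pre_ok (p : pt) : Prop := forall act top, ~ In rj act -> gwf act top (pgen p).

Lemma gwf_lits act top ls : gwf act top (pgen (lits ls)).
Proof.
  induction ls as [|[b a] ls IH]; cbn; [exact I|]. split; [|exact IH]. split; [exact I|split; [|exact I]].
  clear. induction a as [|l a IH]; cbn; auto.
Qed.

Lemma gwf_seqs act top pre l : (forall s, In s l -> gwf act top (sgen pre s)) -> gwf act top (sgen pre (seqs l)).
Proof.
  induction l as [|s l IH]; intros H; cbn; [exact I|]. split; [apply H; now left|apply IH; intros; apply H; now right].
Qed.

Lemma fresh_seqs l ss : (forall s, In s ss -> fresh l s) -> fresh l (seqs ss).
Proof.
  induction ss as [|s ss IH]; intros H; cbn; [exact I|]. split; [apply H; now left|apply IH; intros; apply H; now right].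
Qed.

Lemma sall_seqs Q ss : (forall s, In s ss -> sall Q s) -> sall Q (seqs ss).
Proof.
  induction ss as [|s ss IH]; intros H; cbn; [exact I|]. split; [apply H; now left|apply IH; intros; apply H; now right].
Qed.

Ltac notin := let H := fresh in intros H; cbn in H; repeat (destruct H as [H|H]; [discriminate|]); exact H.
Ltac wf Hpre := unfold cl; cbn [sgen gwf seqs fold_right flat_map app]; repeat match goal with
  | |- _ /\ _ => split
  | |- True => exact I
  | |- _ <> _ => discriminate
  | |- ?a = ?a => reflexivity
  | |- ~ _ => notin
  | |- gwf _ _ (pgen (lits _)) => apply gwf_lits
  | |- gwf _ _ (pgen (PFor _ _ _)) => cbn
  | |- gwf _ _ (pgen _) => apply Hpre; notin
  end.

Lemma trans_wf act pre s main M : pre_ok pre -> ~ In rj act -> ~ In ri act -> ~ In rd act ->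
  gwf act true (sgen pre (trans s main M)).
Proof.
  intros Hp Hj Hi Hd. unfold trans. apply gwf_seqs. intros x Hx.
  apply in_flat_map in Hx as (q & _ & Hx). apply in_flat_map in Hx as (b & _ & [<-|Hx]).
  - unfold frame, cl. cbn [sgen gwf].
    repeat match goal with
    | |- _ /\ _ => split
    | |- True => exact I
    | |- _ <> _ => discriminate
    | |- gwf _ _ (pgen (lits _)) => apply gwf_lits
    | |- gwf _ _ (pgen _) => apply Hp
    | |- ~ _ => cbn; intuition discriminate
    end.
  - apply in_map_iff in Hx as (e & <- & _). unfold rule. destruct (qstep M q b (fst e)) as [[q' b'] m].
    destruct m; unfold cl; cbn [sgen gwf];
    repeat match goal with
    | |- _ /\ _ => split
    | |- True => exact I
    | |- _ <> _ => discriminate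
    | |- gwf _ _ (pgen (lits _)) => apply gwf_lits
    | |- gwf _ _ (pgen _) => apply Hp
    | |- ~ _ => cbn; intuition discriminate
    end.
Qed.

Lemma tableau_wf pre s o M V a d : pre_ok pre -> gwf [rk; rN; rT; rn] true (sgen pre (tableau s o M V a d)).
Proof.
  intros Hp. unfold tableau. cbn [seqs fold_right sgen gwf].
  split; [|split; [|split; [|split; [|split; [|split; [|exact I]]]]]].
  - unfold S_init. wf Hp.
  - unfold S_run. cbn [sgen gwf]. split; [notin|split; [discriminate|split; [apply trans_wf; [exact Hp|notin..]|]]].
    unfold S_val. apply gwf_seqs. intros x Hx. apply in_map_iff in Hx as (q & <- & _).
    destruct (q =? q_query); wf Hp.
  - unfold S_verifier. cbn [sgen gwf]. repeat (split; [first [notin|discriminate]|]). apply trans_wf; [exact Hp|notin..].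
  - unfold S_link. wf Hp.
  - unfold S_verdict. wf Hp.
  - unfold S_threshold. destruct o; wf Hp.
Qed.

Lemma php_wf act pre s : pre_ok pre -> ~ In rj act -> ~ In ri act -> ~ In rd act -> ~ In rl act ->
  gwf act true (sgen pre (S_php s)).
Proof.
  intros Hp Hj Hi Hd Hl. unfold S_php, cl. cbn [sgen gwf].
  repeat match goal with
  | |- _ /\ _ => split
  | |- True => exact I
  | |- _ <> _ => discriminate
  | |- gwf _ _ (pgen (lits _)) => apply gwf_lits
  | |- gwf _ _ (pgen (PFor _ _ _)) => cbn [pgen gwf gcode fold_right aHole]
  | |- gwf _ _ (pgen _) => apply Hp
  | |- gwf _ _ (GSeq _ _) => split
  | |- gwf _ _ _ => exact I
  | |- ~ _ => cbn; intuition discriminate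
  end.
Qed.

Lemma top_wf M V a d aT dT aN dN aK dK : gwf [] true (sgen PNil (S_top M V a d aT dT aN dN aK dK)).
Proof.
  assert (H0 : pre_ok (PSeq PNil (PFor rj rT (PLit false (aSel 1 (var rj)))))).
  { intros act top H. cbn. repeat split; [exact H|discriminate]. }
  assert (HP : forall s b, pre_ok (PSeq (PSeq PNil (PSeq (PFor rj rk (PLit false (aSel s (var rj)))) (PLit true (aSel s (var rk)))))
      (PLit b (aSplit s)))).
  { intros s b act top H. cbn. repeat split; [exact H|discriminate]. }
  unfold S_top, S_full, S_chain, S_item, S_hard. cbn [sgen gwf].
  repeat match goal with
  | |- _ /\ _ => split
  | |- _ = _ => reflexivity
  | |- ~ In _ _ => notin
  | |- _ <> _ => discriminate
  | |- gwf _ _ (sgen _ (tableau _ _ _ _ _ _)) => apply tableau_wf, HP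
  | |- gwf _ _ (sgen _ (S_php _)) => apply php_wf; [first [apply HP|apply H0]|notin..]
  end; cbn; repeat split; try notin; try discriminate.
Qed.

Ltac fresh_solve Hl := unfold cl; cbn [fresh seqs fold_right flat_map app]; repeat match goal with
  | |- _ /\ _ => split
  | |- True => exact I
  | |- ~ In _ _ => let H := fresh in intros H; apply Hl in H; revert H; notin
  end.

Lemma trans_fresh l s main M : (forall x, In x l -> In x [rk; rj; rT]) -> fresh l (trans s main M).
Proof.
  intros Hl. unfold trans. apply fresh_seqs. intros x Hx.
  apply in_flat_map in Hx as (q & _ & Hx). apply in_flat_map in Hx as (b & _ & [<-|Hx]).
  - unfold frame. fresh_solve Hl.
  - apply in_map_iff in Hx as (e & <- & _). unfold rule. destruct (qstep M q b (fst e)) as [[q' b'] m].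
    destruct m; fresh_solve Hl.
Qed.

Lemma tableau_fresh l s o M V a d : (forall x, In x l -> In x [rk; rj; rT]) -> fresh l (tableau s o M V a d).
Proof.
  intros Hl. unfold tableau. cbn [seqs fold_right fresh].
  split; [|split; [|split; [|split; [|split; [|split; [|exact I]]]]]].
  - unfold S_init. fresh_solve Hl.
  - unfold S_run. fresh_solve Hl; [now apply trans_fresh|].
    unfold S_val. apply fresh_seqs. intros x Hx. apply in_map_iff in Hx as (q & <- & _).
    destruct (q =? q_query); fresh_solve Hl.
  - unfold S_verifier. fresh_solve Hl. now apply trans_fresh.
  - unfold S_link. fresh_solve Hl.
  - unfold S_verdict. fresh_solve Hl.
  - unfold S_threshold. destruct o; fresh_solve Hl.
Qed.

Lemma php_fresh l s : (forall x, In x l -> In x [rk; rj; rT]) -> fresh l (S_php s).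
Proof. intros Hl. unfold S_php. fresh_solve Hl. Qed.

Lemma top_fresh M V a d aT dT aN dN aK dK : fresh [] (S_top M V a d aT dT aN dN aK dK).
Proof.
  unfold S_top, S_full, S_chain, S_item, S_hard. cbn [fresh pfv flat_map app fst aSel aSplit con var].
  repeat match goal with
  | |- _ /\ _ => split
  | |- True => exact I
  | |- ~ In _ _ => notin
  | |- fresh _ (tableau _ _ _ _ _ _) => apply tableau_fresh; intros x Hx; cbn in Hx |- *; tauto
  | |- fresh _ (S_php _) => apply php_fresh; intros x Hx; cbn in Hx |- *; tauto
  end.
Qed.

(** The first two entries of an atom are constants, the half and the sort. They separate the
    variables of the tableaux, with sorts up to 8, from the selectors, with sorts 9 and 10, and from
    the pigeonhole variables, with sort 11. *)
Definition kind (s : nat) (P : nat -> Prop) (a : list lin) : Prop :=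
  match a with ([], s') :: ([], k) :: _ => s' = s /\ P k | _ => False end.

Ltac sall_solve := unfold cl; cbn [sall seqs fold_right flat_map app]; repeat match goal with
  | |- _ /\ _ => split
  | |- True => exact I
  | |- pall _ _ => cbn [pall lits fold_right fst snd app]
  | |- kind _ _ _ => cbn; split; [reflexivity|lia]
  end.

Lemma trans_kind s main M : sall (kind s (fun k => k <= 8)) (trans s main M).
Proof.
  unfold trans. apply sall_seqs. intros x Hx.
  apply in_flat_map in Hx as (q & _ & Hx). apply in_flat_map in Hx as (b & _ & [<-|Hx]).
  - unfold frame. sall_solve.
  - apply in_map_iff in Hx as ([e ex] & <- & He). unfold rule. cbn [fst snd].
    destruct (qstep M q b e) as [[q' b'] m].
    destruct main; cbn [extra In] in He;
      repeat (destruct He as [He|He]; [inversion He; subst; destruct m; sall_solve|]); destruct He.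
Qed.

Lemma tableau_kind s o M V a d : sall (kind s (fun k => k <= 8)) (tableau s o M V a d).
Proof.
  unfold tableau. cbn [seqs fold_right sall].
  split; [|split; [|split; [|split; [|split; [|split; [|exact I]]]]]].
  - unfold S_init. sall_solve.
  - unfold S_run. sall_solve; [apply trans_kind|].
    unfold S_val. apply sall_seqs. intros x Hx. apply in_map_iff in Hx as (q & <- & _).
    destruct (q =? q_query); sall_solve.
  - unfold S_verifier. sall_solve. apply trans_kind.
  - unfold S_link. sall_solve.
  - unfold S_verdict. sall_solve.
  - unfold S_threshold. destruct o; sall_solve.
Qed.

Lemma tableau_vars w s o M V a d r v : In v (vars (sden w (tableau s o M V a d) r)) ->
  exists k l, k <= 8 /\ v = code (s :: k :: l).
Proof.
  intros H. apply (sall_vars (kind s (fun k => k <= 8))) in H as (at0 & r' & Hk & ->); [|apply tableau_kind].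
  destruct at0 as [|[[|] s'] [|[[|] k] l]]; try contradiction. destruct Hk as [-> Hk].
  exists k, (atom r' l). split; [exact Hk|reflexivity].
Qed.

(** * Optimality of the root *)

(** Stated for any first index [k0], because peeling off one selector shortens the negative prefixes
    of all later items. *)
Lemma chain_flatten x base (F : nat -> cnf) n : forall k0,
  flat_map (fun k => map (app (flat_map (fun j => [(x j, false)]) (seq k0 (k - k0)) ++ [(x k, true)])) (F k)) (seq k0 n) ++
    map (app (flat_map (fun j => [(x j, false)]) (seq k0 n))) base =
  chain x k0 (map F (seq k0 n)) base.
Proof.
  induction n as [|n IH]; intros k0; cbn [seq flat_map map chain app].
  - apply map_id.
  - unfold branch. rewrite Nat.sub_diag. cbn [seq flat_map app]. rewrite <- app_assoc. f_equal.
    rewrite <- IH, map_app, map_map. f_equal.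
    + rewrite map_flat_map. rewrite !flat_map_concat_map. f_equal. apply map_ext_in. intros k Hk. apply in_seq in Hk.
      rewrite map_map. apply map_ext. intros C.
      replace (k - k0) with (S (k - S k0)) by lia. reflexivity.
Qed.

Lemma sden_chain w s item base r :
  sden w (S_chain s item base) r =
  chain (fun k => code [s; 9; k]) 0 (map (fun k => sden w item (upd r rk k)) (seq 0 (r rT))) (sden w base r).
Proof.
  rewrite <- chain_flatten. unfold S_chain. cbn [sden pden]. f_equal.
  - apply flat_map_ext. intros k. rewrite upd_same, Nat.sub_0_r. f_equal. f_equal. f_equal.
    + apply flat_map_ext. intros j. unfold aSel. ev. reflexivity.
    + unfold aSel. ev. reflexivity.
  - f_equal. f_equal. apply flat_map_ext. intros j. unfold aSel. ev. reflexivity.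
Qed.

Lemma sden_item w s o M V a d aK dK r :
  let U := sden w (tableau s o M V a d) r ++ php_cnf (fun i j => code [s; 11; i; j]) (poly aK dK (r rN)) in
  sden w (S_item s o M V a d aK dK) r = branch (code [s; 10]) U U.
Proof.
  cbn zeta. unfold S_item, S_hard. cbn [sden]. rewrite sden_php, upd_same. reflexivity.
Qed.

Definition svar (s : nat) (P : nat -> Prop) (v : nat) : Prop := exists k l, P k /\ v = code (s :: k :: l).

Lemma svar_disjoint s s' P P' v : svar s P v -> svar s' P' v -> s = s' /\ exists k, P k /\ P' k.
Proof.
  intros (k & l & H & ->) (k' & l' & H' & E). apply code_inj in E. inversion E; subst. eauto.
Qed.

Lemma sum_le (f g : nat -> nat) c n : (forall k, k < n -> f k <= g k + c) ->
  list_sum (map f (seq 0 n)) <= list_sum (map g (seq 0 n)) + n * c.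
Proof.
  induction n as [|n IH]; intros H; [cbn; lia|].
  rewrite seq_S, !map_app, !list_sum_app. cbn. specialize (H n) as Hn. specialize (IH (fun k Hk => H k (Nat.lt_lt_succ_r _ _ Hk))). lia.
Qed.

(** The index [v] is singled out to carry a gap [e], while all terms share the error [c]. *)
Lemma sum_le_extra (f g : nat -> nat) c e v n : v < n -> (forall k, k < n -> k <> v -> f k <= g k + c) ->
  f v + e <= g v + c -> list_sum (map f (seq 0 n)) + e <= list_sum (map g (seq 0 n)) + n * c.
Proof.
  induction n as [|n IH]; intros Hv H He; [lia|].
  rewrite seq_S, !map_app, !list_sum_app. cbn.
  destruct (Nat.eq_dec v n) as [->|Hn].
  - pose proof (sum_le f g c n) as HS. specialize (HS (fun k Hk => H k ltac:(lia) ltac:(lia))). lia.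
  - specialize (IH ltac:(lia) (fun k Hk => H k ltac:(lia)) He). specialize (H n ltac:(lia) ltac:(lia)). lia.
Qed.

Section reduction.
Variables (M V : TM) (a d aK dK : nat) (w : list bool) (r : nat -> nat).
Let T := r rT.
Let K := poly aK dK (r rN).
Let tab s o k := sden w (tableau s o M V a d) (upd r rk k).
Let hard s := php_cnf (fun i j => code [s; 11; i; j]) K.
Let item s o k := branch (code [s; 10]) (tab s o k ++ hard s) (tab s o k ++ hard s).
Let sel s k := code [s; 9; k].

Lemma hard_vars s v : In v (vars (hard s)) -> svar s (fun k => k = 11) v.
Proof. intros H. apply php_vars in H as (i & j & ->). exists 11, [i; j]. auto. Qed.

Lemma tab_vars s o k v : In v (vars (tab s o k)) -> svar s (fun k => k <= 8) v.
Proof. intros H. apply tableau_vars in H as (k' & l & Hk & ->). exists k', l. auto. Qed.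

Lemma union_vars s o k v : In v (vars (tab s o k ++ hard s)) -> svar s (fun k => k <= 8 \/ k = 11) v.
Proof.
  intros H. rewrite vars_app in H. apply in_app_or in H as [H|H].
  - apply tab_vars in H as (k' & l & Hk & ->). exists k', l. auto.
  - apply hard_vars in H as (k' & l & Hk & ->). exists k', l. auto.
Qed.

Lemma item_vars s o k v : In v (vars (item s o k)) -> svar s (fun k => k <= 8 \/ k = 10 \/ k = 11) v.
Proof.
  intros H. apply vars_branch in H as [->|[H|H]].
  - exists 10, []. auto.
  - apply union_vars in H as (k' & l & Hk & ->). exists k', l. split; [lia|auto].
  - apply union_vars in H as (k' & l & Hk & ->). exists k', l. split; [lia|auto].
Qed.

Lemma item_minbst s o h : 1 <= K -> minbst (hard s) h -> exists n : nat -> nat, forall k,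
  minbst (item s o k) (S (n k + n k)) /\ ((exists A, sat A (tab s o k)) -> n k = h) /\
  ((forall A, ~ sat A (tab s o k)) -> S (n k) <= 2 ^ length (vars (tab s o k))).
Proof.
  intros HK Hh.
  assert (HU : forall k, exists n, minbst (tab s o k ++ hard s) n /\ ((exists A, sat A (tab s o k)) -> n = h) /\
    ((forall A, ~ sat A (tab s o k)) -> S n <= 2 ^ length (vars (tab s o k)))).
  { intros k. apply union_minbst; [|now apply php_nil|exact Hh].
    intros v H1 H2. apply tab_vars in H1. apply hard_vars in H2.
    destruct (svar_disjoint _ _ _ _ _ H1 H2) as (_ & k' & H3 & H4). lia. }
  exists (fun k => proj1_sig (constructive_indefinite_description _ (HU k))). intros k.
  destruct (constructive_indefinite_description _ (HU k)) as (n & Hn & H1 & H2). cbn [proj1_sig].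
  split; [|auto].
  assert (Hy : ~ In (code [s; 10]) (vars (tab s o k ++ hard s))).
  { intros H. apply union_vars in H as (k' & l & Hk & E). apply code_inj in E. inversion E. lia. }
  now apply branch_minbst.
Qed.

Lemma sel_inj s i j : sel s i = sel s j -> i = j.
Proof. intros E. apply code_inj in E. congruence. Qed.

Lemma sel_item s o k k' : ~ In (sel s k) (vars (item s o k')).
Proof. intros H. apply item_vars in H as (k0 & l & Hk & E). apply code_inj in E. inversion E. lia. Qed.

Lemma chain_vars s o k l base v : (forall u, In u (vars base) -> svar s (fun _ => True) u) ->
  In v (vars (chain (sel s) k (map (item s o) l) base)) -> svar s (fun _ => True) v.
Proof.
  intros HB H. apply vars_chain in H as [(j & _ & ->)|[(F & HF & H)|H]].
  - exists 9, [j]. auto.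
  - apply in_map_iff in HF as (k' & <- & _). apply item_vars in H as (k0 & l0 & _ & ->). exists k0, l0. auto.
  - auto.
Qed.

(** Thresholds below [v] are satisfiable on both sides and those above [v] on neither, so up to an
    error [c] per index only [v] counts. There the first side pays [2 * h], and the second side pays
    as much iff [acc]; its base of size [h] lies between the two outcomes. *)
Lemma obv_full B v (acc : Prop) :
  v < T -> B + T + 3 <= K ->
  (forall k, k < T -> length (vars (tab 0 false k)) <= B /\ length (vars (tab 1 true k)) <= B) ->
  (forall s k, (exists A, sat A (tab s false k)) <-> k <= v) ->
  (forall s k, (exists A, sat A (tab s true k)) <-> k < v \/ (k = v /\ acc)) ->
  (OBV (sden w (S_full M V a d aK dK) r) (code [0; 9; 0]) <-> acc).
Proof.
  intros Hv HK HB HE HO.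
  destruct (php_minbst (fun i j => code [0; 11; i; j]) (fun i j => code [1; 11; i; j]) K) as (h & M0 & M1 & Hh).
  { intros i j i' j' E. apply code_inj in E. inversion E. auto. }
  { intros i j i' j' E. apply code_inj in E. inversion E. auto. }
  fold (hard 0) in M0. fold (hard 1) in M1.
  destruct (item_minbst 0 false h ltac:(lia) M0) as (e & He).
  destruct (item_minbst 1 true h ltac:(lia) M1) as (o & Ho).
  assert (EF : sden w (S_full M V a d aK dK) r =
    chain (sel 0) 0 (map (item 0 false) (seq 0 T)) [[]] ++ chain (sel 1) 0 (map (item 1 true) (seq 0 T)) (hard 1)).
  { unfold S_full. cbn [sden]. rewrite !sden_chain.
    assert (E : forall s o, map (fun k => sden w (S_item s o M V a d aK dK) (upd r rk k)) (seq 0 (r rT)) =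
      map (item s o) (seq 0 T)) by (intros s o0; apply map_ext; intros k; apply sden_item).
    rewrite !E. unfold S_hard at 1. cbn [sden]. rewrite sden_php, upd_same. reflexivity. }
  rewrite EF. clear EF.
  assert (MQ : minbst (chain (sel 1) 0 (map (item 1 true) (seq 0 T)) (hard 1))
     (list_sum (map S (map (fun k => S (o k + o k)) (seq 0 T))) + h)).
  { apply chain_minbst.
    - apply sel_inj.
    - intros F k HF. apply in_map_iff in HF as (k' & <- & _). apply sel_item.
    - intros k H. apply hard_vars in H as (k0 & l & Hk & E). apply code_inj in E. inversion E. lia.
    - exact M1.
    - induction (seq 0 T) as [|k l IH]; cbn; constructor; [apply Ho|exact IH]. }
  assert (MP : forall k l, minbst (chain (sel 0) k (map (item 0 false) l) [[]])
     (list_sum (map S (map (fun k => S (e k + e k)) l)))).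
  { intros k l. rewrite <- (Nat.add_0_r (list_sum _)). apply chain_minbst.
    - apply sel_inj.
    - intros F k0 HF. apply in_map_iff in HF as (k' & <- & _). apply sel_item.
    - intros k0 [].
    - split; [exists Leaf; split; [constructor; now left|reflexivity]|intros; lia].
    - induction l as [|k0 l IH]; cbn; constructor; [apply He|exact IH]. }
  rewrite !map_map in MQ.
  (* The first selector is split off, since [obv_union] is about the selector of an outermost
     branch. *)
  assert (EP : chain (sel 0) 0 (map (item 0 false) (seq 0 T)) [[]] =
    branch (sel 0 0) (item 0 false 0) (chain (sel 0) 1 (map (item 0 false) (seq 1 (T - 1))) [[]])).
  { destruct T as [|T']; [lia|]. cbn [seq map chain]. now rewrite Nat.sub_succ, Nat.sub_0_r. }
  rewrite EP. change (code [0; 9; 0]) with (sel 0 0).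
  rewrite (obv_union (sel 0 0) _ _ _ (S (e 0 + e 0))
    (list_sum (map S (map (fun k => S (e k + e k)) (seq 1 (T - 1)))))
    (list_sum (map (fun k => S (S (o k + o k))) (seq 0 T)) + h)).
  2:{ apply sel_item. }
  2:{ intros H. apply vars_chain in H as [(j & Hj & E)|[(F & HF & H)|[]]].
      - apply sel_inj in E. lia.
      - apply in_map_iff in HF as (k' & <- & _). now apply sel_item in H. }
  2:{ intros u H1 H2. rewrite <- EP in H1.
      apply chain_vars in H1; [|intros ? []]. apply chain_vars in H2.
      - destruct (svar_disjoint _ _ _ _ _ H1 H2). discriminate.
      - intros u' Hu. apply hard_vars in Hu as (k & l & _ & ->). exists k, l. auto. }
  2:{ destruct T as [|T']; [lia|]. cbn [seq map chain]. apply nil_branch. }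
  2:{ apply He. }
  2:{ apply MP. }
  2:{ exact MQ. }
  rewrite map_map.
  assert (ES : S (S (e 0 + e 0) + list_sum (map (fun k => S (S (e k + e k))) (seq 1 (T - 1)))) =
    list_sum (map (fun k => S (S (e k + e k))) (seq 0 T))).
  { destruct T as [|T']; [lia|]. cbn [seq map]. rewrite Nat.sub_succ, Nat.sub_0_r. reflexivity. }
  rewrite ES. clear ES EP MP MQ.
  (* An unsatisfiable item has size [S (n + n)] with [S n <= 2 ^ B], so together with its selector
     it costs at most [c]. *)
  set (c := 2 * 2 ^ B).
  (* The summand 3 in the bound on [K] yields [2 ^ K >= 8 * 2 ^ T * 2 ^ B]; with [T < 2 ^ T] this
     exceeds the total error. *)
  assert (Hc : T * c + 2 <= h).
  { assert (2 ^ (B + T + 3) <= 2 ^ K) by (apply Nat.pow_le_mono_r; lia).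
    rewrite !Nat.pow_add_r in H. pose proof (Nat.pow_gt_lin_r 2 T ltac:(lia)).
    pose proof (Nat.pow_nonzero 2 B ltac:(lia)). unfold c. change (2 ^ 3) with 8 in H. nia. }
  assert (HeU : forall k, k < T -> ~ (exists A, sat A (tab 0 false k)) -> S (e k) <= 2 ^ B).
  { intros k Hk N. destruct (He k) as (_ & _ & H). eapply Nat.le_trans; [apply H; intros A HA; eauto|].
    apply Nat.pow_le_mono_r; [lia|exact (proj1 (HB k Hk))]. }
  assert (HoU : forall k, k < T -> ~ (exists A, sat A (tab 1 true k)) -> S (o k) <= 2 ^ B).
  { intros k Hk N. destruct (Ho k) as (_ & _ & H). eapply Nat.le_trans; [apply H; intros A HA; eauto|].
    apply Nat.pow_le_mono_r; [lia|exact (proj2 (HB k Hk))]. }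
  assert (HeS : forall k, (exists A, sat A (tab 0 false k)) -> e k = h) by (intros k; apply He).
  assert (HoS : forall k, (exists A, sat A (tab 1 true k)) -> o k = h) by (intros k; apply Ho).
  clear He Ho M0 M1 Hh HB.
  split.
  - intros Hle. destruct (classic acc) as [|N]; [assumption|exfalso].
    (* Without [acc] the first sum is ahead by [2 * h] at [v], which the base [h] and the errors
       [T * c] cannot make up for. *)
    pose proof (sum_le_extra (fun k => S (S (o k + o k))) (fun k => S (S (e k + e k))) c (2 * h) v T Hv) as X.
    assert (X' : list_sum (map (fun k => S (S (o k + o k))) (seq 0 T)) + 2 * h <=
      list_sum (map (fun k => S (S (e k + e k))) (seq 0 T)) + T * c); [apply X|lia].
    + intros k Hk Hn. destruct (Nat.lt_ge_cases k v) as [L|L].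
      * rewrite HeS by (apply HE; lia). rewrite HoS by (apply HO; lia). lia.
      * pose proof (HoU k Hk) as Y. rewrite HO in Y. specialize (Y ltac:(lia)). unfold c. lia.
    + pose proof (HoU v Hv) as Y. rewrite HO in Y. rewrite (HeS v) by (apply HE; lia).
      assert (Y' : S (o v) <= 2 ^ B) by (apply Y; intros [|[_ ?]]; [lia|contradiction]). unfold c. lia.
  - intros Ha.
    (* With [acc] no term of the first sum exceeds its counterpart by more than [c], and the base
       [h] absorbs [T * c]. *)
    pose proof (sum_le (fun k => S (S (e k + e k))) (fun k => S (S (o k + o k))) c T) as X.
    assert (X' : list_sum (map (fun k => S (S (e k + e k))) (seq 0 T)) <=
      list_sum (map (fun k => S (S (o k + o k))) (seq 0 T)) + T * c); [apply X|lia].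
    intros k Hk. destruct (Nat.le_gt_cases k v) as [L|L].
    + rewrite HeS by (apply HE; lia).
      rewrite HoS by (apply HO; destruct (Nat.lt_eq_cases k v) as [Z _]; specialize (Z L); tauto). lia.
    + pose proof (HeU k Hk) as Y. rewrite HE in Y. specialize (Y ltac:(lia)). unfold c. lia.
Qed.

End reduction.

(** * The reduction *)

(** From left to right, [value_max] bounds the value of the certified run by [v], and at value [v]
    that run is the correct one, so its verdict counts. From right to left, the correct run with a
    certificate for each positive answer is a model. *)
Lemma tableau_sat (M V : TM) (O : list bool -> Prop) a d w s o r :
  let c t := oracle_run M O (init w) t in
  let v := fst (value M (oracle_ans M O (init w)) (init w) (r rT) (r rT)) in
  r rn = length w -> r rT < r rN ->
  2 * (length w + r rT + 1) + 2 + poly a d (length w + r rT + 1) < r rN ->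
  2 ^ queries M (oracle_ans M O (init w)) (init w) (r rT) <= r rT ->
  (forall q, length q <= length w + r rT + 1 -> (O q <-> exists y, length y <= poly a d (length q) /\
     cst (run V (fun _ => false) (init (pair_enc q y)) (r rN)) <> q_rej)) ->
  ((exists A, sat A (sden w (tableau s o M V a d) r)) <->
   r rk <= v /\ (o = true -> v = r rk -> cst (c (r rT)) <> q_rej)).
Proof.
  intros c v Hn HT HN HQ HO. set (oa := oracle_ans M O (init w)) in *.
  assert (HL : forall ans t, t <= r rT -> length (read_from (run M ans (init w) t)) <= length w + r rT + 1).
  { intros ans t Ht. destruct (read_from_spec (run M ans (init w) t)) as (_ & _ & HL).
    pose proof (run_cells M ans (init w) t). pose proof (init_length w). lia. }
  split.
  - intros (A & HA). apply (sden_sem A (fun l => A (code l))) in HA; [|reflexivity].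
    destruct (tableau_sound _ w s o M V a d r HA Hn HT HN) as (H1 & H2 & H3).
    set (ans := fun t => decide (A (code [s; 3; t]))) in *.
    assert (HV : forall t, t < r rT -> cst (run M ans (init w) t) = q_query -> ans t = true ->
      O (read_from (run M ans (init w) t))).
    { intros t Ht Hc Ha. apply HO; [apply HL; lia|]. now apply H1. }
    destruct (value_max M O ans (init w) (r rT) HV HQ) as [L|[E1 E2]].
    + fold oa in L. split; [unfold v; lia|]. intros _ E. unfold v in E. lia.
    + fold oa in E1. unfold v. rewrite <- E1. split; [exact H2|]. intros Ho E. unfold c. rewrite <- E2. now apply H3.
  - intros [H1 H2].
    (* The positive answers of the correct run are true, so each has a certificate; choice collects
       them into one function. *)
    assert (HC : exists cert : nat -> list bool, forall t, t < r rT -> active M w oa t ->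
      length (cert t) <= poly a d (length (query M w oa t)) /\
      cst (run V (fun _ => false) (init (pair_enc (query M w oa t) (cert t))) (r rN)) <> q_rej).
    { assert (HC : forall t, exists y, t < r rT -> active M w oa t -> length y <= poly a d (length (query M w oa t)) /\
        cst (run V (fun _ => false) (init (pair_enc (query M w oa t) y)) (r rN)) <> q_rej).
      { intros t. destruct (classic (t < r rT /\ active M w oa t)) as [[Ht [Hc Ha]]|N].
        - assert (HOq : O (query M w oa t)).
          { unfold query, main_run. unfold oa at 1. rewrite run_oracle. unfold oa, oracle_ans in Ha. now apply (proj1 (decide_iff _)) in Ha. }
          apply HO in HOq as (y & Hy); [|apply HL; lia]. now exists y.
        - exists []. intros Ht Hc. exfalso. tauto. }
      exists (fun t => proj1_sig (constructive_indefinite_description _ (HC t))). intros t.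
      destruct (constructive_indefinite_description _ (HC t)) as [y Hy]. exact Hy. }
    destruct HC as [cert HC].
    exists (fun n => model M V w oa cert (r rT) a d (decode n)).
    apply (sden_sem _ (model M V w oa cert (r rT) a d)); [intros l; now rewrite decode_code|].
    apply tableau_complete; auto.
    intros Ho E. unfold main_run. unfold oa. rewrite run_oracle. now apply H2.
Qed.

Definition reduction_gen (M V : TM) (a d aT dT aN dN aK dK : nat) : gen :=
  GSeq (GEmit (enc_nat (code [0; 9; 0]) ++ tok_end_lit)) (sgen PNil (S_top M V a d aT dT aN dN aK dK)).

Lemma gden_reduction M V a d aT dT aN dN aK dK w :
  gden w (reduction_gen M V a d aT dT aN dN aK dK) (fun _ => 0) =
  enc_obv (sden w (S_top M V a d aT dT aN dN aK dK) (fun _ => 0)) (code [0; 9; 0]).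
Proof.
  unfold reduction_gen, enc_obv. cbn [gden]. rewrite gden_sgen by apply top_fresh.
  cbn [pden]. rewrite (map_ext _ (fun C => C)), map_id by reflexivity. now rewrite <- app_assoc.
Qed.

(** This is where the logarithmic number of queries enters: the interval of values, and hence the
    number of thresholds, stays polynomial. *)
Lemma pbounded_pow2_log c : pbounded (fun n => 2 ^ (c * Nat.log2 n + c)).
Proof.
  apply pbounded_le with (fun n => (2 * n + 2) ^ c); [|pbound].
  intros n. replace (c * Nat.log2 n + c) with ((Nat.log2 n + 1) * c) by lia. rewrite Nat.pow_mul_r.
  apply Nat.pow_le_mono_l. rewrite Nat.pow_add_r. destruct n as [|n]; [cbn; lia|].
  pose proof (Nat.log2_spec (S n) ltac:(lia)). change (2 ^ 1) with 2. lia.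
Qed.

(** Halted configurations are fixed points of [cstep], so the verdict can be read at any [T] past
    the time bound, and not rejecting then means accepting. *)
Lemma decides_run M O L t qb w : decides M O L t qb -> forall T, t (length w) <= T ->
  let ans := oracle_ans M O (init w) in
  queries M ans (init w) T <= qb (length w) /\
  (cst (oracle_run M O (init w) T) <> q_rej <-> L w).
Proof.
  intros HD T HT ans. destruct (HD w) as (n & k & c & HR & Hn & Hk & Hc & HL).
  destruct (reaches_run M O n k (init w) c HR ans) as [E1 E2].
  { intros i _ _. unfold ans. rewrite run_oracle. apply decide_iff. }
  assert (Hh : cst (run M ans (init w) n) = q_acc \/ cst (run M ans (init w) n) = q_rej) by (rewrite E1; exact Hc).
  split.
  - rewrite (queries_halt M ans (init w) n T) by (auto; lia). lia.
  - rewrite <- run_oracle. fold ans. rewrite (run_halt M ans (init w) n T) by (auto; lia). rewrite E1, <- HL.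
    destruct Hc as [E|E]; rewrite E; unfold q_acc, q_rej; split; congruence.
Qed.

Lemma no_oracle_run M c t : oracle_run M no_oracle c t = run M (fun _ => false) c t.
Proof.
  induction t as [|t IH]; [reflexivity|]. cbn. rewrite IH. f_equal.
  unfold decide. destruct (excluded_middle_informative _) as [H|]; [destruct H|reflexivity].
Qed.

Lemma length_pair_enc w y : length (pair_enc w y) = 2 * length w + 2 + length y.
Proof. unfold pair_enc. rewrite !length_app, length_tok_digits. cbn. lia. Qed.

(** * Injectivity of the encoding *)

Lemma pos_bits_inj p : forall q, pos_bits p = pos_bits q -> p = q.
Proof.
  assert (HN : forall p, pos_bits p <> []) by (intros []; discriminate).
  induction p as [p IH|p IH|]; intros [q|q|] E; cbn in E; inversion E as [E'];
    try reflexivity; try (f_equal; now apply IH); exfalso; eapply HN; eauto.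
Qed.

Lemma nat_bits_inj n m : nat_bits n = nat_bits m -> n = m.
Proof.
  unfold nat_bits. intros H. apply Nnat.Nat2N.inj.
  assert (HN : forall p, pos_bits p <> []) by (intros []; discriminate).
  destruct (N.of_nat n) as [|p], (N.of_nat m) as [|q]; try reflexivity.
  - symmetry in H. now apply HN in H.
  - now apply HN in H.
  - f_equal. now apply pos_bits_inj.
Qed.

(** Digits and end marks are two-bit tokens that differ in their first bit, so the end of a number
    is recognised without ambiguity. *)
Lemma tok_digits_inj l : forall l' u u', flat_map tok_digit l ++ tok_end_lit ++ u =
  flat_map tok_digit l' ++ tok_end_lit ++ u' -> l = l' /\ u = u'.
Proof.
  induction l as [|b l IH]; intros [|b' l'] u u' E; cbn in E; inversion E; auto.
  destruct (IH l' u u' ltac:(assumption)). subst. auto.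
Qed.

Lemma enc_nat_inj n m u u' : enc_nat n ++ tok_end_lit ++ u = enc_nat m ++ tok_end_lit ++ u' -> n = m /\ u = u'.
Proof. intros E. apply tok_digits_inj in E as [E ->]. split; [now apply nat_bits_inj|reflexivity]. Qed.

Lemma enc_lits_inj C : forall C' u u', flat_map enc_lit C ++ tok_end_clause ++ u =
  flat_map enc_lit C' ++ tok_end_clause ++ u' -> C = C' /\ u = u'.
Proof.
  induction C as [|[v b] C IH]; intros [|[v' b'] C'] u u' E; cbn [flat_map app] in E.
  - inversion E. auto.
  - discriminate.
  - discriminate.
  - unfold enc_lit in E. cbn [fst snd] in E. rewrite <- !app_assoc in E. cbn [tok_digit app] in E.
    inversion E as [[Eb E']]. apply (enc_nat_inj v v') in E' as [-> E'].
    apply IH in E' as [-> ->]. auto.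
Qed.

Lemma enc_cnf_inj F : forall F', enc_cnf F = enc_cnf F' -> F = F'.
Proof.
  unfold enc_cnf. assert (HN : forall C u, enc_clause C ++ u <> []).
  { intros C u E. unfold enc_clause in E. destruct (flat_map enc_lit C); discriminate. }
  induction F as [|C F IH]; intros [|C' F'] E; cbn [flat_map] in E.
  - reflexivity.
  - symmetry in E. now apply HN in E.
  - now apply HN in E.
  - unfold enc_clause at 1 3 in E. rewrite <- !app_assoc in E.
    apply enc_lits_inj in E as [-> E]. f_equal. now apply IH.
Qed.

Lemma obv_lang_enc F x : OBV_lang (enc_obv F x) <-> OBV F x.
Proof.
  split; [|intros H; now exists F, x].
  intros (F' & x' & E & H). unfold enc_obv in E. apply enc_nat_inj in E as [-> E].
  apply enc_cnf_inj in E as ->. exact H.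
Qed.

Theorem theorem1 : Theta2_hard OBV_lang.
Proof.
  intros L (M & A & a0 & d0 & c & (VL & a & d & (MV & av & dv & HMV) & HA) & HM).
  (* [T] has to cover the running time of [M], the [2 ^ q] subintervals and the input length, and to
     be positive. *)
  assert (HT : pbounded (fun n => poly a0 d0 n + 2 ^ (c * Nat.log2 n + c) + n + 1)).
  { pose proof (pbounded_pow2_log c). pbound. }
  destruct HT as (aT & dT & HT).
  (* [N] covers tape positions and verifier times: a query has length at most
     [n + T + 1 <= T + T + 1], its pair code adds marks and a certificate, and the verifier runs on
     the result. *)
  assert (HN : pbounded (fun T => 2 * (T + T + 1) + 2 + poly a d (T + T + 1) +
     poly av dv (2 * (T + T + 1) + 2 + poly a d (T + T + 1)) + T + 1)) by pbound.
  destruct HN as (aN & dN & HN).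
  destruct (vars_bound (tableau 0 false M MV a d)) as (f0 & P0 & B0).
  destruct (vars_bound (tableau 1 true M MV a d)) as (f1 & P1 & B1).
  (* [K] exceeds the occurrences in the tableaux of both halves by at least [T + 3], as [T < N]. *)
  assert (HK : pbounded (fun N => f0 N + f1 N + N + 3)) by pbound.
  destruct HK as (aK & dK & HK).
  exists (fun w => enc_obv (sden w (S_top M MV a d aT dT aN dN aK dK) (fun _ => 0)) (code [0; 9; 0])). split.
  { assert (HG : fp_computable (fun w => gden w (reduction_gen M MV a d aT dT aN dN aK dK) (fun _ => 0))).
    { apply gen_computable. split; [exact I|apply top_wf]. }
    destruct HG as (M' & a' & d' & HG). exists M', a', d'. intros w. rewrite <- gden_reduction. apply HG. }
  intros w. rewrite obv_lang_enc. set (n := length w).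
  set (T := poly aT dT n). set (N := poly aN dN T).
  set (r := upd (upd (upd (fun _ => 0) rn n) rT T) rN N).
  assert (Er : sden w (S_top M MV a d aT dT aN dN aK dK) (fun _ => 0) = sden w (S_full M MV a d aK dK) r) by reflexivity.
  rewrite Er. clear Er.
  specialize (HT n). fold T in HT. specialize (HN T). fold N in HN. specialize (HK N).
  set (v := fst (value M (oracle_ans M A (init w)) (init w) T T)).
  destruct (decides_run M A L _ _ w HM T) as [HQ HL]; [fold n; lia|]. fold n in HQ.
  assert (HQ2 : 2 ^ queries M (oracle_ans M A (init w)) (init w) T <= T).
  { assert (2 ^ queries M (oracle_ans M A (init w)) (init w) T <= 2 ^ (c * Nat.log2 n + c))
      by (apply Nat.pow_le_mono_r; lia). lia. }
  assert (HS : forall s o k, (exists B, sat B (sden w (tableau s o M MV a d) (upd r rk k))) <->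
    k <= v /\ (o = true -> v = k -> L w)).
  { intros s o k. rewrite (tableau_sat M MV A a d w s o (upd r rk k)).
    - change (upd r rk k rk) with k. change (upd r rk k rT) with T. fold v. rewrite HL. reflexivity.
    - reflexivity.
    - change (T < N). lia.
    - change (2 * (n + T + 1) + 2 + poly a d (n + T + 1) < N).
      pose proof (poly_mono a d (n + T + 1) (T + T + 1) ltac:(lia)). lia.
    - exact HQ2.
    - change (forall q, length q <= n + T + 1 -> (A q <-> exists y, length y <= poly a d (length q) /\
        cst (run MV (fun _ => false) (init (pair_enc q y)) N) <> q_rej)).
      intros q Hq. rewrite HA.
      assert (HE : forall y, length y <= poly a d (length q) ->
        (cst (run MV (fun _ => false) (init (pair_enc q y)) N) <> q_rej <-> VL (pair_enc q y))).
      { intros y Hy. rewrite <- no_oracle_run. apply (decides_run MV no_oracle VL _ _ _ HMV).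
        rewrite length_pair_enc. pose proof (poly_mono a d (length q) (T + T + 1) ltac:(lia)).
        pose proof (poly_mono av dv (2 * length q + 2 + length y) (2 * (T + T + 1) + 2 + poly a d (T + T + 1)) ltac:(lia)).
        lia. }
      split; intros (y & Hy & Hv); exists y; (split; [exact Hy|now apply HE]). }
  assert (HB : forall s o k f, (forall act w r N, gwf act true (sgen PNil (tableau s o M MV a d)) -> fresh [] (tableau s o M MV a d) ->
      (forall v, ~ In v act -> r v = 0) -> (forall v, r v <= N) -> length w <= N ->
      length (vars (sden w (tableau s o M MV a d) r)) <= f N) -> k < T ->
      length (vars (sden w (tableau s o M MV a d) (upd r rk k))) <= f N).
  { intros s o k f H Hk. apply (H [rk; rN; rT; rn]).
    - apply tableau_wf. intros act top _. exact I.
    - apply tableau_fresh. intros x [].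
    - intros x Hx. cbn in Hx. unfold r. rewrite !upd_other by intuition congruence. reflexivity.
    - intros x. unfold r, upd. destruct (x =? rk); [lia|]. destruct (x =? rN); [lia|].
      destruct (x =? rT); [lia|]. destruct (x =? rn); lia.
    - fold n. lia. }
  apply iff_sym. rewrite (obv_full M MV a d aK dK w r (f0 N + f1 N) v (L w)); [reflexivity|..].
  (* All values lie in the initial interval from 0 up to [T], which is nonempty. *)
  - change (r rT) with T. pose proof (value_nested M (oracle_ans M A (init w)) (init w) T 0 T ltac:(lia)) as (_ & _ & X).
    cbn [value fst snd] in X. unfold v. lia.
  - change (r rT) with T. change (r rN) with N. lia.
  - intros k Hk. change (r rT) with T in Hk. split.
    + eapply Nat.le_trans; [apply (HB 0 false k f0 B0 Hk)|lia].
    + eapply Nat.le_trans; [apply (HB 1 true k f1 B1 Hk)|lia].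
  - intros s k. rewrite HS. split; [tauto|]. intros H. split; [exact H|discriminate].
  - intros s k. rewrite HS. split.
    + intros [H1 H2]. apply Nat.lt_eq_cases in H1 as [H1|H1]; [now left|right]. split; [exact H1|]. apply H2; auto.
    + intros [H|[-> H]]; [split; [lia|lia]|auto].
Qed.
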